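(* For any $\epsilon>0$, there exists a randomized $n^{O(\log n/\epsilon^4)}$-time $(1-1/e-\epsilon)$-approximation algorithm for submodular Max-Sum Diversification; that is, given $(U,d)$, $p$ and value-oracle access to $f$, it outputs $S\subseteq U$ with $|S|=p$ and $\mathbb{E}[\mathrm{div}(S)]\ge (1-1/e-\epsilon)\max_{S'\subseteq U,|S'|=p}\mathrm{div}(S')$.
   Context: Submodular Max-Sum Diversification: given a finite metric space $(U,d)$ with $|U|=n$, an integer $p\ge 2$, and a monotone submodular set function $f:2^U\to\mathbb{R}_{\ge0}$ accessible via a value oracle, select $S\subseteq U$ of size $p$ maximizing $\mathrm{div}(S):=\mathrm{disp}(S)+f(S)$, where $\mathrm{disp}(S):=\sum_{\{u,v\}\subseteq S}d(u,v)$ over unordered pairs of distinct elements. *)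

(* Defs.v *)
From HB Require Import structures.
From mathcomp Require Import all_boot all_order all_algebra.
From mathcomp Require Import all_classical all_reals all_analysis.

Set Implicit Arguments.
Unset Strict Implicit.
Unset Printing Implicit Defensive.

Import Order.TTheory GRing.Theory Num.Theory.
Local Open Scope ring_scope.

(** * The optimization problem *)

Section Problem.
Variables (R : realType) (n : nat).
Implicit Types (d : 'I_n -> 'I_n -> R) (f : {set 'I_n} -> R).

Definition is_metric d : Prop :=
  [/\ forall x y, 0 <= d x y,
      forall x y, d x y = 0 <-> x = y,
      forall x y, d x y = d y x
    & forall x y z, d x z <= d x y + d y z].

Definition set_monotone f : Prop :=
  forall A B : {set 'I_n}, A \subset B -> f A <= f B.

Definition submodular f : Prop :=
  forall A B : {set 'I_n}, f (A :|: B) + f (A :&: B) <= f A + f B.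

(* Each unordered pair of distinct points is counted once, as i < j. *)
Definition disp d (S : {set 'I_n}) : R :=
  \sum_(i in S) \sum_(j in S | (i < j)%N) d i j.

Definition divers d f (S : {set 'I_n}) : R := disp d S + f S.

(* When d and f are nonnegative and p <= n, the default 0 is harmless and
   this is the maximum over the (nonempty) family of p-subsets. *)
Definition opt_divers d f (p : nat) : R :=
  \big[Num.max/0]_(S : {set 'I_n} | #|S| == p) divers d f S.

End Problem.

(** * Randomized real-RAM programs with a value oracle

    A single program works for all inputs: its syntax mentions neither n, nor
    the instance, nor real constants. The memory consists of natural-number
    cells (used for control, addressing and encoding sets) and of real cells,
    both indirectly addressable. Every syntax node that is evaluated costs one
    time unit, and so do a coin flip and an oracle call. Naturals only have
    addition and truncated subtraction, and there is no rounding of reals to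
    integers: unit-cost multiplication of naturals, or unit-cost rounding,
    would make the model unreasonably powerful. *)

Inductive nexp : Type :=
| NConst of nat
| NSize                      (* n, the number of points *)
| NCard                      (* p, the required cardinality *)
| NCell of nexp
| NAdd of nexp & nexp
| NSub of nexp & nexp.

Inductive rexp : Type :=
| RNat of nexp
| RCell of nexp
| RDist of nexp & nexp       (* entry of the distance matrix *)
| RAdd of rexp & rexp
| RSub of rexp & rexp
| RMul of rexp & rexp
| RDiv of rexp & rexp.

Inductive bexp : Type :=
| BNLe of nexp & nexp
| BRLe of rexp & rexp
| BNot of bexp
| BAnd of bexp & bexp.

Inductive com : Type :=
| Skip
| NSet of nexp & nexp        (* natural cell [address] := value *)
| RSet of nexp & rexp        (* real cell [address] := value *)
| Flip of nexp               (* natural cell [address] := fair coin in {0,1} *)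
| Query of nexp & nexp       (* real cell [address] := f (set stored at base) *)
| Seq of com & com
| If of bexp & com & com
| While of bexp & com.

Fixpoint ncost (e : nexp) : nat :=
  match e with
  | NConst _ | NSize | NCard => 1
  | NCell a => (ncost a).+1
  | NAdd a b | NSub a b => (ncost a + ncost b).+1
  end.

Fixpoint rcost (e : rexp) : nat :=
  match e with
  | RNat a | RCell a => (ncost a).+1
  | RDist a b => (ncost a + ncost b).+1
  | RAdd a b | RSub a b | RMul a b | RDiv a b => (rcost a + rcost b).+1
  end.

Fixpoint bcost (e : bexp) : nat :=
  match e with
  | BNLe a b => (ncost a + ncost b).+1
  | BRLe a b => (rcost a + rcost b).+1
  | BNot a => (bcost a).+1
  | BAnd a b => (bcost a + bcost b).+1
  end.

(* [coins] is the part of the random tape that has not been read yet. *)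
Record state (R : Type) : Type := State {
  nmem : nat -> nat;
  rmem : nat -> R;
  coins : seq bool
}.

Section Semantics.
Variables (R : realType) (n p : nat).
Variables (d : 'I_n -> 'I_n -> R) (f : {set 'I_n} -> R).
Implicit Types (s : state R).

Definition upd (A : Type) (m : nat -> A) (a : nat) (v : A) : nat -> A :=
  fun x => if x == a then v else m x.

(* The set whose characteristic vector is stored in cells b, ..., b + n - 1. *)
Definition stored_set (m : nat -> nat) (b : nat) : {set 'I_n} :=
  [set i : 'I_n | m (b + i)%N != 0%N].

Definition dist_entry (i j : nat) : R :=
  match insub i, insub j with
  | Some x, Some y => d x y
  | _, _ => 0
  end.

Fixpoint neval s (e : nexp) : nat :=
  match e with
  | NConst k => k
  | NSize => n
  | NCard => p
  | NCell a => nmem s (neval s a)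
  | NAdd a b => (neval s a + neval s b)%N
  | NSub a b => (neval s a - neval s b)%N
  end.

Fixpoint reval s (e : rexp) : R :=
  match e with
  | RNat a => (neval s a)%:R
  | RCell a => rmem s (neval s a)
  | RDist a b => dist_entry (neval s a) (neval s b)
  | RAdd a b => reval s a + reval s b
  | RSub a b => reval s a - reval s b
  | RMul a b => reval s a * reval s b
  | RDiv a b => reval s a / reval s b
  end.

Fixpoint beval s (e : bexp) : bool :=
  match e with
  | BNLe a b => (neval s a <= neval s b)%N
  | BRLe a b => reval s a <= reval s b
  | BNot a => ~~ beval s a
  | BAnd a b => beval s a && beval s b
  end.

(* [exec c s k s']: from state s, c halts in state s' after k time units.
   A flip is stuck once the random tape is exhausted. *)
Inductive exec : com -> state R -> nat -> state R -> Prop :=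
| exec_Skip s : exec Skip s 1 s
| exec_NSet s a e :
    exec (NSet a e) s (ncost a + ncost e).+1
      (State (upd (nmem s) (neval s a) (neval s e)) (rmem s) (coins s))
| exec_RSet s a e :
    exec (RSet a e) s (ncost a + rcost e).+1
      (State (nmem s) (upd (rmem s) (neval s a) (reval s e)) (coins s))
| exec_Flip s a b w : coins s = b :: w ->
    exec (Flip a) s (ncost a).+1
      (State (upd (nmem s) (neval s a) (nat_of_bool b)) (rmem s) w)
| exec_Query s a b :
    exec (Query a b) s (ncost a + ncost b).+1
      (State (nmem s)
         (upd (rmem s) (neval s a) (f (stored_set (nmem s) (neval s b))))
         (coins s))
| exec_Seq c1 c2 s s1 s2 k1 k2 :
    exec c1 s k1 s1 -> exec c2 s1 k2 s2 ->
    exec (Seq c1 c2) s (k1 + k2).+1 s2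
| exec_IfT b c1 c2 s s1 k : beval s b -> exec c1 s k s1 ->
    exec (If b c1 c2) s (bcost b + k).+1 s1
| exec_IfF b c1 c2 s s1 k : ~~ beval s b -> exec c2 s k s1 ->
    exec (If b c1 c2) s (bcost b + k).+1 s1
| exec_WhileF b c s : ~~ beval s b ->
    exec (While b c) s (bcost b).+1 s
| exec_WhileT b c s s1 s2 k1 k2 : beval s b ->
    exec c s k1 s1 -> exec (While b c) s1 k2 s2 ->
    exec (While b c) s (bcost b + k1 + k2).+1 s2.

Definition init_state (w : seq bool) : state R :=
  State (fun _ => 0%N) (fun _ => 0) w.

(* With random tape w, P halts within T time units and outputs S, read off
   the natural cells 0, ..., n - 1. *)
Definition outputs_within (P : com) (w : seq bool) (T : nat)
    (S : {set 'I_n}) : Prop :=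
  exists k s, [/\ exec P (init_state w) k s, (k <= T)%N
                & stored_set (nmem s) 0 = S].

End Semantics.

(* Expectation over a uniformly random tape of T fair coins. A run of at most
   T time units flips at most T coins, so T coins are enough. *)
Definition expect_coins (R : realType) (T : nat) (X : T.-tuple bool -> R) : R :=
  (\sum_(w : T.-tuple bool) X w) / 2 ^+ T.

(* Main.v *)
Require Import Defs.
From HB Require Import structures.
From mathcomp Require Import all_boot all_order all_algebra.
From mathcomp Require Import all_classical all_reals all_analysis.
From mathcomp Require Import ring lra zify.
Import Order.TTheory GRing.Theory Num.Theory.
Set Implicit Arguments.
Unset Strict Implicit.
Unset Printing Implicit Defensive.
Local Open Scope ring_scope.

(** Fix an optimal p-set O. The program is a greedy algorithm with guessed
    advice, and it tries all advice strings. With S the current set,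
    Q = O \ S, m = |Q|, rho the number of steps to go and th = rho / m, consider
      disp(S) + th d(S, Q) + th^2 disp(Q) + f(O) - e^(-th) (f(O) - f(S)).
    The dispersion part is the expected dispersion of S plus a random th-fraction
    of Q, and the last part is what greedy steps for f still promise. Adding the
    point v that maximizes d(S, v) + rho * avg_(o in Q) d(o, v) + e^(-th) f(S + v)
    does not decrease this potential up to lower order terms, because the average
    over v in Q does not, whether the chosen v is in O or not. Starting with
    rho slightly less than p, it goes from nearly disp(O) + (1 - 1/e) f(O) to
    disp(S) + f(S).

    The advice is the average distance profile v |-> avg_(o in Q) d(o, v), up to an
    additive constant, which does not influence the choice of v. By the triangle
    inequality |d(o, v) - avg_(o' in Q) d(o', o)| is at most the profile at v, so
    O(log n / eps^2) random points of Q determine the profile up to a factor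
    1 +- eps and a constant. For the same reason a profile stays accurate while
    O(eps^2 p) points are added, so O(1 / eps^2) rounds of O(log n / eps^2) guessed
    points suffice. If p itself is O(log n / eps^4), then O is guessed directly. *)

(** * Sampling *)

(** The marginal gain of the dispersion at [v] ignores the distances to the points still to come;
    this is why the profile of Q enters the choice, and since Q is known only to the analysis, it
    has to be supplied as advice. The samples are shown to exist by averaging, and an advice string
    is a number whose base-[N] digits are read one by one. The program flips no coin, so every
    outcome meets the guarantee, not only the average. The machine cannot evaluate e^(-th); each
    round guesses it as one more digit. The step errors grow as m shrinks, so the analysed phase
    stops after p' < p steps, with p - p' at least p / H for some H of order 1 / eps; the remaining
    points only have to do no harm, which monotonicity ensures. The two parts of the objective
    tolerate different losses. The f-part must stay within O(1 / H) of 1 - 1/e, so its errors have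
    to telescope; the dispersion part starts with a factor close to 1 and may lose a constant, as
    long as it keeps 1 - 1/e. *)

Section Sampling.
Variables (R : realType) (I J : finType).

(** Inverting [1 - y <= expR (- y)] at [y = x - 2 x^2] replaces a logarithm. The product of [1 + x]
    and [1 - y] is [1 + x^2 (1 + 2 x)], so the range ends exactly at [-1/2]. *)
Lemma expR_le_1Dx (x : R) : - 2^-1 <= x -> expR (x - 2 * x ^+ 2) <= 1 + x.
Proof.
move=> hx; set y := x - 2 * x ^+ 2.
have h1 := expR_ge1Dx (- y).
have y1 : 0 < 1 - y by rewrite /y; nra.
have h3 : 1 <= (1 + x) * (1 - y) by rewrite /y; nra.
rewrite -[y]opprK expRN; apply: (@le_trans _ _ (1 - y)^-1).
  by rewrite lef_pV2 // posrE expR_gt0.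
by rewrite -[(1 - y)^-1]mul1r ler_pdivrMr.
Qed.

Lemma exists_le_avg (A : {set I}) (F : I -> R) (c : R) :
  (0 < #|A|)%N -> \sum_(a in A) F a <= #|A|%:R * c ->
  exists2 a, a \in A & F a <= c.
Proof.
move=> A0 hs; apply: contrapT => hn.
have : \sum_(a in A) c < \sum_(a in A) F a.
  case/card_gt0P: A0 => a aA.
  apply: ltr_sum; first by apply/hasP; exists a; rewrite ?mem_index_enum.
  by move=> b bA; rewrite ltNge; apply/negP => hb; apply: hn; exists b.
rewrite sumr_const -mulr_natl => /lt_le_trans /(_ hs).
by rewrite ltxx.
Qed.

Lemma prod_ge_expR (l : seq R) :
  all (fun x => - 2^-1 <= x <= 2^-1) l ->
  expR (\sum_(x <- l) (x - 2 * x ^+ 2)) <= \prod_(x <- l) (1 + x).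
Proof.
elim: l => [|x l IH]; first by rewrite !big_nil expR0.
move=> /= /andP[/andP[x1 x2] hl]; rewrite !big_cons expRD.
by apply: ler_pM; rewrite ?expR_ge0 ?IH // expR_le_1Dx.
Qed.

(* Averaging over a in A preserves the potential
   sum_u (prod (1 + lam z) + prod (1 - lam z)), because z has mean zero. *)
Lemma balanced_samples (A : {set I}) (z : I -> J -> R) (lam : R) (k : nat) :
  (0 < #|A|)%N ->
  (forall u, \sum_(o in A) z o u = 0) ->
  (forall o u, o \in A -> `|z o u| <= 1) ->
  0 <= lam <= 2^-1 ->
  exists l : seq I, [/\ size l = k, all (fun a => a \in A) l &
    forall u, `|lam * \sum_(a <- l) z a u|
                <= ln (2 * #|J|%:R) + 2 * lam ^+ 2 * k%:R].
Proof.
move=> A0 z0 z1 /andP[lam0 lam1].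
pose pot (l : seq I) := \sum_(u : J) (\prod_(a <- l) (1 + lam * z a u)
                          + \prod_(a <- l) (1 - lam * z a u)).
have [l [sl lA pl]] : exists l : seq I,
    [/\ size l = k, all (fun a => a \in A) l & pot l <= 2 * #|J|%:R].
  elim: k => [|k [l [sl lA pl]]].
    exists [::]; split => //; rewrite /pot.
    under eq_bigr do rewrite !big_nil.
    by rewrite sumr_const -[_ *+ _]mulr_natr; apply: ler_pM => //; lra.
  have [a aA ha] : exists2 a, a \in A & pot (a :: l) <= pot l.
    apply: exists_le_avg => //.
    rewrite /pot exchange_big /= mulr_sumr; apply: ler_sum => u _.
    under eq_bigr do rewrite !big_cons !mulrDl !mul1r mulNr.
    set x := \prod_(_ <- _) _; set y := \prod_(_ <- _) _.
    rewrite (eq_bigr (fun i => (x + y) + (z i u * (lam * (x - y))))); last first.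
      by move=> i _; ring.
    by rewrite big_split /= -mulr_suml z0 mul0r addr0 sumr_const -[_ *+ _]mulr_natl.
  exists (a :: l); split; rewrite /= ?sl ?aA //.
  exact: le_trans pl.
exists l; split => // u.
(* Each product alone is at most the whole potential, and [prod_ge_expR] turns this into a bound on
   its exponent. The signs [s = 1] and [s = -1] give the two sides of the absolute value. *)
have half (s : R) : `|s| = 1 -> \prod_(a <- l) (1 + s * lam * z a u) <= 2 * #|J|%:R ->
    s * lam * \sum_(a <- l) z a u <= ln (2 * #|J|%:R) + 2 * lam ^+ 2 * k%:R.
  move=> s1 hp.
  have hb : all (fun x => - 2^-1 <= x <= 2^-1) [seq s * lam * z a u | a <- l].
    apply/allP => _ /mapP[a al ->]; rewrite -ler_norml !normrM s1 mul1r.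
    have := z1 a u (allP lA a al); rewrite (ger0_norm lam0) => h.
    have : lam * `|z a u| <= 2^-1 * 1 by apply: ler_pM.
    lra.
  have := prod_ge_expR hb; rewrite !big_map => he.
  have J0 : 0 < 2 * #|J|%:R :> R.
    by apply: lt_le_trans (expR_gt0 _) (le_trans he hp).
  have : \sum_(a <- l) (s * lam * z a u - 2 * (s * lam * z a u) ^+ 2)
      <= ln (2 * #|J|%:R).
    rewrite -[leLHS]expRK ler_ln ?posrE ?expR_gt0 //.
    exact: le_trans hp.
  rewrite big_split /= -mulr_sumr sumrN => h.
  have : \sum_(a <- l) 2 * (s * lam * z a u) ^+ 2 <= \sum_(a <- l) 2 * lam ^+ 2.
    rewrite big_seq [leRHS]big_seq; apply: ler_sum => a al.
    have /ler_normlP[h1 h2] := z1 a u (allP lA a al).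
    have s2 : s ^+ 2 = 1 by rewrite -(real_normK (num_real s)) s1 expr1n.
    rewrite !exprMn s2 mul1r.
    have zz : z a u ^+ 2 <= 1 by nra.
    have ll := sqr_ge0 lam; nra.
  rewrite big_const_seq count_predT sl iter_addr_0 -[_ *+ k]mulr_natr; lra.
have pos (s : R) : `|s| = 1 -> 0 <= \prod_(a <- l) (1 + s * lam * z a u) .
  move=> s1; rewrite big_seq; apply: prodr_ge0 => a al.
  have : `|s * lam * z a u| <= 1.
    rewrite !normrM s1 mul1r ger0_norm //.
    have h := z1 a u (allP lA a al).
    have : lam * `|z a u| <= 2^-1 * 1 by apply: ler_pM.
    lra.
  move=> /ler_normlP[]; lra.
have both : \prod_(a <- l) (1 + 1 * lam * z a u)
    + \prod_(a <- l) (1 + (-1) * lam * z a u) <= 2 * #|J|%:R.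
  apply: le_trans pl; rewrite /pot (bigD1 u) //=.
  rewrite (eq_bigr (fun a => 1 + lam * z a u)); last by move=> *; rewrite mul1r.
  rewrite [X in _ + X <= _](eq_bigr (fun a => 1 - lam * z a u)); last first.
    by move=> *; rewrite mulN1r mulNr.
  rewrite lerDl; apply: sumr_ge0 => v _; apply: addr_ge0.
    rewrite big_seq; apply: prodr_ge0 => a al.
    have /ler_normlP[] := z1 a v (allP lA a al); nra.
  rewrite big_seq; apply: prodr_ge0 => a al.
  have /ler_normlP[] := z1 a v (allP lA a al); nra.
have n1 : `|1 : R| = 1 by rewrite normr1.
have nN1 : `|-1 : R| = 1 by rewrite normrN1.
have p1 := pos 1 n1; have p2 := pos (-1) nN1.
have := half 1 n1; have := half (-1) nN1.
move=> h1 h2; rewrite ler_norml; apply/andP; split.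
  have : -1 * lam * \sum_(a <- l) z a u <= ln (2 * #|J|%:R) + 2 * lam ^+ 2 * k%:R.
    by apply: h1; lra.
  rewrite mulN1r mulNr; lra.
by rewrite -[lam]mul1r; rewrite {2}mul1r; apply: h2; lra.
Qed.

End Sampling.

(** * Distance profiles *)

Section ConstantSums.
Variables (R : realType) (T : finType).

Lemma sum_const_set (A : {set T}) (c : R) : \sum_(i in A) c = c * #|A|%:R.
Proof. by rewrite sumr_const mulr_natr. Qed.

Lemma sum_const_seq (l : seq T) (c : R) : \sum_(i <- l) c = c * (size l)%:R.
Proof. by rewrite big_const_seq count_predT iter_addr_0 mulr_natr. Qed.

End ConstantSums.

Section Distances.
Variables (R : realType) (T : finType) (d : T -> T -> R).
Hypotheses (d_ge0 : forall x y, 0 <= d x y) (d_xx : forall x, d x x = 0).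
Hypotheses (d_sym : forall x y, d x y = d y x).
Hypotheses (d_tri : forall x y z, d x z <= d x y + d y z).
Implicit Types (X Y : {set T}).

Definition dsum X u : R := \sum_(x in X) d x u.
Definition dcross X Y : R := \sum_(y in Y) dsum X y.
Definition mean_dist X u : R := dsum X u / #|X|%:R.

Lemma dsum_ge0 X u : 0 <= dsum X u.
Proof. exact: sumr_ge0. Qed.

Lemma mean_dist_ge0 X u : 0 <= mean_dist X u.
Proof. by rewrite divr_ge0 ?dsum_ge0. Qed.

Lemma dcross_ge0 X Y : 0 <= dcross X Y.
Proof. by apply: sumr_ge0 => y _; exact: dsum_ge0. Qed.

Lemma dcrossC X Y : dcross X Y = dcross Y X.
Proof.
rewrite /dcross /dsum exchange_big /=.
by apply: eq_bigr => x _; apply: eq_bigr => y _; rewrite d_sym.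
Qed.

Lemma sum_subset (F : T -> R) X Y :
  (forall x, 0 <= F x) -> X \subset Y -> \sum_(x in X) F x <= \sum_(x in Y) F x.
Proof.
move=> F0 XY; rewrite [leRHS](big_setID X) /= (finset.setIidPr XY) lerDl.
exact: sumr_ge0.
Qed.

Lemma dsum_subset X Y u : X \subset Y -> dsum X u <= dsum Y u.
Proof. exact: sum_subset. Qed.

Lemma dcross_subset X Y X' Y' :
  X \subset X' -> Y \subset Y' -> dcross X Y <= dcross X' Y'.
Proof.
move=> sX sY; apply: (@le_trans _ _ (dcross X' Y)).
  by apply: ler_sum => y _; exact: dsum_subset.
exact: sum_subset (dsum_ge0 _) sY.
Qed.

Lemma dsumU1 X v u : v \notin X -> dsum (v |: X) u = d v u + dsum X u.
Proof. by move=> vX; rewrite /dsum big_setU1. Qed.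

Lemma dsumD1 X v u : v \in X -> dsum (X :\ v) u = dsum X u - d v u.
Proof. by move=> vX; rewrite /dsum [in RHS](big_setD1 v) //=; lra. Qed.

Lemma dcrossU1l X Y v : v \notin X ->
  dcross (v |: X) Y = dcross X Y + dsum Y v.
Proof.
move=> vX; rewrite /dcross addrC -big_split /=.
by apply: eq_bigr => y _; rewrite dsumU1 // d_sym.
Qed.

Lemma dcrossU1 X v : v \notin X ->
  dcross (v |: X) (v |: X) = dcross X X + 2 * dsum X v.
Proof.
move=> vX; rewrite dcrossU1l // dcrossC dcrossU1l // dsumU1 // d_xx; lra.
Qed.

Lemma dcrossD1r X Y v : v \in Y ->
  dcross X (Y :\ v) = dcross X Y - dsum X v.
Proof. by move=> vY; rewrite /dcross [in RHS](big_setD1 v) //=; lra. Qed.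

Lemma dcrossD1 Y v : v \in Y ->
  dcross (Y :\ v) (Y :\ v) = dcross Y Y - 2 * dsum Y v.
Proof.
move=> vY; rewrite dcrossD1r // dcrossC dcrossD1r // dsumD1 // d_xx; lra.
Qed.

(** * Doubly centred distances and sampled profiles *)

Section Centered.
Variable (X : {set T}).
Hypothesis X0 : (0 < #|X|)%N.
Let m : R := #|X|%:R.
Let m0 : 0 < m. Proof. by rewrite /m ltr0n. Qed.

Lemma mean_dist_triangle o u : d o u <= mean_dist X o + mean_dist X u.
Proof.
rewrite /mean_dist -mulrDl ler_pdivlMr // /dsum -big_split /= mulrC.
rewrite /m mulr_natl -sumr_const; apply: ler_sum => w _.
by rewrite (d_sym w o) d_tri.
Qed.

Lemma mean_dist_le o u : mean_dist X o <= d o u + mean_dist X u.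
Proof.
rewrite /mean_dist ler_pdivrMr // mulrDl divfK ?gt_eqF // mulrC /m mulr_natl.
rewrite -sumr_const /dsum -big_split /=; apply: ler_sum => w _.
by rewrite addrC (d_sym o u) d_tri.
Qed.

Definition mean_pdist : R := (\sum_(o in X) mean_dist X o) / m.

Lemma mean_pdist_ge0 : 0 <= mean_pdist.
Proof. by rewrite divr_ge0 ?(ltW m0) //; apply: sumr_ge0 => *; exact: mean_dist_ge0. Qed.

Lemma mean_pdist_le u : mean_pdist <= 2 * mean_dist X u.
Proof.
rewrite /mean_pdist ler_pdivrMr //.
apply: (@le_trans _ _ (\sum_(o in X) (d o u + mean_dist X u))).
  by apply: ler_sum => o _; exact: mean_dist_le.
rewrite big_split /= sum_const_set -/m.
have -> : \sum_(o in X) d o u = mean_dist X u * m by rewrite divfK ?gt_eqF.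
lra.
Qed.

(** Double centring has mean zero over [o] in [X], and by the triangle inequality its size is
    controlled by the profile at [u]. Sampling errors are therefore relative to the profile, not to
    the diameter. *)
Definition dcentered o u : R := d o u - mean_dist X o - mean_dist X u + mean_pdist.

Lemma dcentered_sum0 u : \sum_(o in X) dcentered o u = 0.
Proof.
rewrite /dcentered 2!big_split /= big_split /= !sumrN !sum_const_set -/m.
by rewrite /mean_pdist {2}/mean_dist -/(dsum X u) -/m !divfK ?gt_eqF //; lra.
Qed.

Lemma dcentered_le o u : `|dcentered o u| <= 2 * mean_dist X u.
Proof.
rewrite /dcentered ler_norml; have := mean_dist_triangle o u; have := mean_dist_le o u.
have := mean_pdist_le u; have := mean_pdist_ge0; lra.
Qed.

(** [balanced_samples] is applied to [dcentered o u / (2 * mean_dist X u)] with [lam = eps / 4]. The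
    hypothesis on [k] makes both error terms at most [eps^2 k / 8], and division by [lam] leaves
    [eps k]. The centring terms that do not depend on [u] form the constant [c]. *)
Lemma sampled_profile (eps : R) (k : nat) :
  0 < eps <= 1 -> (0 < k)%N -> 8 * ln (2 * #|T|%:R) <= eps ^+ 2 * k%:R ->
  exists l : seq T, [/\ size l = k, all (fun a => a \in X) l &
    exists c, forall u,
      `|(\sum_(a <- l) d a u) / k%:R - c - mean_dist X u| <= 2 * eps * mean_dist X u].
Proof.
move=> /andP[e0 e1] k0 hk.
pose z o u := dcentered o u / (2 * mean_dist X u).
have z0 u : \sum_(o in X) z o u = 0.
  by rewrite -mulr_suml dcentered_sum0 mul0r.
have z1 o u : o \in X -> `|z o u| <= 1.
  move=> _; have h := dcentered_le o u; have h0 := mean_dist_ge0 X u.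
  rewrite /z normrM normfV [`|2 * _|]ger0_norm; last lra.
  have [->|hn] := eqVneq (mean_dist X u) 0; first by rewrite mulr0 invr0 mulr0.
  by rewrite ler_pdivrMr ?mul1r //; lra.
have hl : 0 <= eps / 4 <= 2^-1 by lra.
have [l [sl lX hb]] := balanced_samples k X0 z0 z1 hl.
exists l; split => //.
have k0' : 0 < k%:R :> R by rewrite ltr0n.
exists ((\sum_(a <- l) mean_dist X a) / k%:R - mean_pdist) => u.
have hZ : `|\sum_(a <- l) dcentered a u| <= 2 * eps * mean_dist X u * k%:R.
  have h0 := mean_dist_ge0 X u.
  (* Where the profile vanishes, the quotient [z] is 0 by convention, and [dcentered_le] makes
     [dcentered a u] vanish too. *)
  have zE a : dcentered a u = z a u * (2 * mean_dist X u).
    rewrite /z; have [h|hn] := eqVneq (mean_dist X u) 0; last by rewrite divfK //; lra.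
    have := dcentered_le a u; rewrite h !mulr0 normr_le0 => /eqP ->.
    by [].
  under eq_bigr do rewrite zE.
  rewrite -mulr_suml normrM [`|2 * _|]ger0_norm; last lra.
  have := hb u; rewrite normrM ger0_norm; last lra.
  set s := `|_|; move=> hs.
  have : s <= eps * k%:R by nra.
  nra.
have -> : (\sum_(a <- l) d a u) / k%:R
    - ((\sum_(a <- l) mean_dist X a) / k%:R - mean_pdist) - mean_dist X u
    = (\sum_(a <- l) dcentered a u) / k%:R.
  rewrite /dcentered 2!big_split /= big_split /= !sumrN.
  rewrite !sum_const_seq sl.
  by field; rewrite gt_eqF.
by rewrite normrM normfV [`|k%:R|]ger0_norm ?ler_pdivrMr // ltW.
Qed.

(** The centred distances sum to zero over [X], so their sum over [Y] is minus their sum over the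
    removed points, each at most [2 * mean_dist X u]. Hence a profile drifts little, up to a
    constant, while few points leave the set. *)
Lemma mean_dist_stale (Y : {set T}) :
  Y \subset X -> (0 < #|Y|)%N ->
  exists c, forall u, `|mean_dist X u - mean_dist Y u - c|
      <= 2 * (#|X|%:R - #|Y|%:R) / #|Y|%:R * mean_dist X u.
Proof.
move=> YX Y0; have y0 : 0 < #|Y|%:R :> R by rewrite ltr0n.
exists (mean_pdist - (\sum_(o in Y) mean_dist X o) / #|Y|%:R) => u.
have -> : mean_dist X u - mean_dist Y u - (mean_pdist - (\sum_(o in Y) mean_dist X o) / #|Y|%:R)
   = (\sum_(o in X :\: Y) dcentered o u) / #|Y|%:R.
  have := dcentered_sum0 u; rewrite (big_setID Y) /= (finset.setIidPr YX) => h.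
  have -> : \sum_(o in X :\: Y) dcentered o u = - \sum_(o in Y) dcentered o u by lra.
  rewrite /dcentered 2!big_split /= big_split /= !sumrN !sum_const_set.
  have -> : mean_dist Y u = dsum Y u / #|Y|%:R by [].
  by rewrite -/(dsum Y u); field; rewrite gt_eqF.
rewrite normrM normfV [`|#|Y|%:R|]ger0_norm ?(ltW y0) // ler_pdivrMr //.
rewrite mulrAC mulfVK ?gt_eqF // .
apply: le_trans (ler_norm_sum _ _ _) _.
apply: (@le_trans _ _ (\sum_(o in X :\: Y) (2 * mean_dist X u))).
  by apply: ler_sum => o _; exact: dcentered_le.
rewrite sum_const_set cardsD (finset.setIidPr YX) natrB ?subset_leq_card //.
lra.
Qed.

(** Converts an error relative to the old profile into one relative to the current profile plus an
    additive term. The distance from [o] to [u] is bounded through each point of [Y], and the bounds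
    are averaged. *)
Lemma mean_dist_le_subset (Y O : {set T}) u :
  Y \subset X -> X \subset O -> (0 < #|Y|)%N ->
  mean_dist X u <= mean_dist Y u + dcross O O / #|Y|%:R ^+ 2.
Proof.
move=> YX XO Y0; have y0 : 0 < #|Y|%:R :> R by rewrite ltr0n.
have ym : #|Y|%:R <= m by rewrite ler_nat subset_leq_card.
have h : #|Y|%:R * dsum X u <= dcross X Y + m * dsum Y u.
  have -> : dcross X Y + m * dsum Y u = \sum_(w in Y) (dsum X w + m * d w u).
    by rewrite big_split /= -mulr_sumr.
  have -> : #|Y|%:R * dsum X u = \sum_(w in Y) dsum X u.
    by rewrite sum_const_set mulrC.
  apply: ler_sum => w wY.
  have -> : m * d w u = \sum_(o in X) d w u by rewrite sum_const_set mulrC.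
  by rewrite -big_split /=; apply: ler_sum => o _; exact: d_tri.
have h2 : dcross X Y <= dcross O O.
  by apply: dcross_subset => //; apply: (fintype.subset_trans YX XO).
have h3 := dcross_ge0 X Y.
have h4 : dcross X Y / (m * #|Y|%:R) <= dcross O O / #|Y|%:R ^+ 2.
  apply: ler_pM => //; first by rewrite invr_ge0 mulr_ge0 ?ltW.
  by rewrite lef_pV2 ?posrE ?mulr_gt0 ?exprn_gt0 // expr2 ler_pM2r.
have : mean_dist X u <= mean_dist Y u + dcross X Y / (m * #|Y|%:R).
  rewrite /mean_dist -/m ler_pdivrMr // mulrDl.
  rewrite [X in _ <= _ + X](_ : _ = dcross X Y / #|Y|%:R); last by field; rewrite !gt_eqF.
  by rewrite mulrAC -mulrDl ler_pdivlMr //; lra.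
lra.
Qed.

End Centered.

(** The list is fixed before [Y]: one sample serves all subsets that can arise during a round,
    although these depend on the sample. *)
Lemma sampled_profile_stale (O X : {set T}) (eps : R) (k : nat) :
  X \subset O -> (0 < #|X|)%N ->
  0 < eps <= 1 -> (0 < k)%N -> 8 * ln (2 * #|T|%:R) <= eps ^+ 2 * k%:R ->
  exists l : seq T, [/\ size l = k, all (fun a => a \in X) l &
    forall (Y : {set T}) (del : R), Y \subset X -> (0 < #|Y|)%N ->
      #|X|%:R - #|Y|%:R <= del * #|Y|%:R ->
      exists c, forall u,
      `|(\sum_(a <- l) d a u) / k%:R - c - mean_dist Y u|
        <= (2 * eps + 2 * del) * (mean_dist Y u + dcross O O / #|Y|%:R ^+ 2)].
Proof.
move=> XO X0 he k0 hk.
have [l [sl lX [c1 h1]]] := sampled_profile X0 he k0 hk.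
exists l; split => // Y del YX Y0 hd.
have [c2 h2] := mean_dist_stale X0 YX Y0.
have y0 : 0 < #|Y|%:R :> R by rewrite ltr0n.
exists (c1 + c2) => u.
have h3 := mean_dist_le_subset X0 u YX XO Y0.
have h4 := mean_dist_ge0 X u.
have hb : 2 * (#|X|%:R - #|Y|%:R) / #|Y|%:R <= 2 * del.
  by rewrite ler_pdivrMr //; lra.
have hxy : 0 <= #|X|%:R - #|Y|%:R :> R.
  by rewrite subr_ge0 ler_nat subset_leq_card.
have del0 : 0 <= del by rewrite -(pmulr_lge0 _ y0); lra.
case/andP: he => e0 _.
apply: (@le_trans _ _ ((2 * eps + 2 * del) * mean_dist X u)); last first.
  by rewrite ler_wpM2l //; lra.
have hb2 : 2 * (#|X|%:R - #|Y|%:R) / #|Y|%:R * mean_dist X u <= 2 * del * mean_dist X u.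
  by rewrite ler_wpM2r.
move: (h1 u) (h2 u) => /ler_normlP[a1 a2] /ler_normlP[b1 b2].
by apply/ler_normlP; split; lra.
Qed.

End Distances.

(** * The potential *)

Section PotentialAlgebra.
Variable R : realType.

(** Here a = d(S,S), g = d(S,Q), e = d(Q,Q), rs = d(S,v), rr = d(Q,v), D = d(O,O), and [y] is the
    shortfall of the f-part. For [v] outside O only [rho] changes, and the hypothesis divided by [m]
    is the required increase, except that [rho^2 - (rho - 1)^2] exceeds [2 (rho - 1)] by 1;
    [D / m ^+ 2] absorbs this. *)
Lemma quadratic_step_out (m rho a g e rs rr D eps y : R) :
  0 < m -> 1 <= rho -> 0 <= e <= D ->
  g + (rho - 1) / m * e - 4 * eps * D + m * y <= m * rs + (rho - 1) * rr ->
  a / 2 + rho / m * g + (rho / m) ^+ 2 * e / 2 + y - D / m ^+ 2 - 4 * eps * D / m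
  <= (a + 2 * rs) / 2 + (rho - 1) / m * (g + rr) + ((rho - 1) / m) ^+ 2 * e / 2.
Proof.
move=> m0 rho1 /andP[e0 eD] h; set q := m^-1.
have q0 : 0 < q by rewrite invr_gt0.
have mq : m * q = 1 by rewrite divff ?gt_eqF.
have h2 : q * (g + (rho - 1) / m * e - 4 * eps * D + m * y)
    <= q * (m * rs + (rho - 1) * rr) by rewrite ler_pM2l.
have h3 : q * (m * rs + (rho - 1) * rr) = rs + (rho - 1) * q * rr.
  by rewrite -[in RHS](mul1r rs) -mq; ring.
have h4 : q * (g + (rho - 1) / m * e - 4 * eps * D + m * y)
    = q * g + (rho - 1) * q ^+ 2 * e - 4 * eps * D * q + y.
  by rewrite -[in RHS](mul1r y) -mq -/q; ring.
rewrite h3 h4 in h2.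
have e2 : q ^+ 2 * e <= q ^+ 2 * D by rewrite ler_wpM2l ?sqr_ge0.
have e3 : 0 <= q ^+ 2 * e by rewrite mulr_ge0 ?sqr_ge0.
rewrite -exprVn -/q !exprMn; lra.
Qed.

(* Moving a point v from Q to S gains only the fraction 1 - th of what adding a
   point outside O with the same value gains; exponential_step, with
   lam = 1 - th, loses exactly the same fraction of the promised progress on f. *)
Lemma quadratic_step_in (m rho a g e rs rr D eps y th : R) :
  1 < m -> 1 <= rho <= m -> 0 <= e <= D -> 0 <= rr -> 0 <= eps ->
  g + (rho - 1) / m * e - 4 * eps * D + m * y <= m * rs + (rho - 1) * rr ->
  th = (rho - 1) / (m - 1) ->
  a / 2 + rho / m * g + (rho / m) ^+ 2 * e / 2 + (1 - th) * y
      - D / m ^+ 2 - 4 * eps * D / m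
  <= (a + 2 * rs) / 2 + th * (g - rs + rr) + th ^+ 2 * (e - 2 * rr) / 2.
Proof.
move=> m1 /andP[rho1 rhom] /andP[e0 eD] rr0 eps0 h thD.
have m0 : 0 < m by lra.
have m10 : 0 < m - 1 by lra.
have th0 : 0 <= th by rewrite thD divr_ge0 ?subr_ge0 // ltW.
have th1 : th <= 1 by rewrite thD ler_pdivrMr // mul1r lerD2r.
set q := m^-1.
have q0 : 0 < q by rewrite invr_gt0.
have mq : m * q = 1 by rewrite divff ?gt_eqF.
have rhoE : rho = th * (m - 1) + 1 by rewrite thD divfK ?gt_eqF //; lra.
have thE : rho / m = th + (1 - th) * q.
  have -> : rho / m = th * (m * q) + (1 - th) * q by rewrite -/q rhoE; ring.
  by rewrite mq mulr1.
have h2 : q * (g + (rho - 1) / m * e - 4 * eps * D + m * y)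
    <= q * (m * rs + (rho - 1) * rr) by rewrite ler_pM2l.
have h3 : q * (m * rs + (rho - 1) * rr) = rs + (rho / m - q) * rr.
  have -> : q * (m * rs + (rho - 1) * rr) = m * q * rs + (rho / m - q) * rr.
    by rewrite -/q; ring.
  by rewrite mq mul1r.
have h4 : q * (g + (rho - 1) / m * e - 4 * eps * D + m * y)
    = q * g + q * (rho / m - q) * e - 4 * eps * D * q + y.
  have -> : q * (g + (rho - 1) / m * e - 4 * eps * D + m * y)
    = q * g + q * (rho / m - q) * e - 4 * eps * D * q + m * q * y.
    by rewrite -/q; ring.
  by rewrite mq mul1r.
rewrite h3 h4 thE in h2; rewrite thE -exprVn -/q.
have D0 : 0 <= D by lra.
have h5 : (th + (1 - th) * q - q) * rr <= th * rr.
  by apply: ler_wpM2r => //; have : 0 <= th * q by [apply: mulr_ge0 => //; lra]; lra.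
have key : q * g + q * (th - th * q) * e - 4 * eps * D * q + y <= rs + th * rr.
  have -> : q * (th - th * q) * e = q * (th + (1 - th) * q - q) * e by ring.
  lra.
have key2 : (1 - th) * (q * g + q * (th - th * q) * e - 4 * eps * D * q + y)
    <= (1 - th) * (rs + th * rr) by rewrite ler_wpM2l //; lra.
have e2 : q ^+ 2 * e <= q ^+ 2 * D by rewrite ler_wpM2l ?sqr_ge0.
have e3 : 0 <= q ^+ 2 * e by rewrite mulr_ge0 ?sqr_ge0.
have e5 : 0 <= th * (eps * D * q).
  by apply: mulr_ge0 => //; apply: mulr_ge0; [apply: mulr_ge0|lra].
have e6 : 0 <= th ^+ 2 * (q ^+ 2 * e) by rewrite mulr_ge0 ?sqr_ge0.
have -> : (a + 2 * rs) / 2 + th * (g - rs + rr) + th ^+ 2 * (e - 2 * rr) / 2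
  = a / 2 + th * g + th ^+ 2 * e / 2 + (1 - th) * (rs + th * rr) by field.
apply: (@le_trans _ _ (a / 2 + th * g + th ^+ 2 * e / 2
    + (1 - th) * (q * g + q * (th - th * q) * e - 4 * eps * D * q + y))).
  lra.
by rewrite lerD2l.
Qed.

(** [expR (- th)] is [expR (- thn)] times a factor between [1 - lam / m] and 1. The lower estimate
    serves for [gam > 0], the upper one for [gam <= 0], which occurs once [f S] has reached [f O];
    hence the maximum with 0. *)
Lemma exponential_step (m th thn lam gam del : R) :
  0 < m -> 0 <= lam <= 1 -> 0 <= del -> thn = th - lam / m ->
  lam * (expR (- thn) * (del - Num.max gam 0 / m))
  <= expR (- th) * gam - expR (- thn) * (gam - del).
Proof.
move=> m0 /andP[l0 l1] del0 thE.
set w := expR (- thn); have w0 : 0 < w by rewrite expR_gt0.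
have -> : expR (- th) = w * expR (- (lam / m)).
  by rewrite /w -expRD thE; congr expR; ring.
have hx := expR_ge1Dx (- (lam / m)).
have lm : 0 <= lam / m by rewrite divr_ge0 // ltW.
have hx1 : expR (- (lam / m)) <= 1 by rewrite -expR0 ler_expR; lra.
have wd : lam * (w * del) <= w * del.
  by rewrite ler_piMl // mulr_ge0 // ltW.
have [g0|g0] := leP gam 0.
  rewrite mul0r subr0.
  have : 0 <= w * (1 - expR (- (lam / m))) * - gam.
    by apply: mulr_ge0; [apply: mulr_ge0|]; lra.
  lra.
have : 0 <= w * (expR (- (lam / m)) - (1 - lam / m)) * gam.
  by apply: mulr_ge0; [apply: mulr_ge0|]; lra.
have -> : lam * (w * (del - gam / m)) = lam * (w * del) - w * (lam / m) * gam.
  by field; rewrite gt_eqF.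
lra.
Qed.

End PotentialAlgebra.

(** * The potential along one greedy step *)

Section GreedyStep.
Variables (R : realType) (T : finType) (d : T -> T -> R) (f : {set T} -> R).
Hypotheses (d_ge0 : forall x y, 0 <= d x y) (d_xx : forall x, d x x = 0).
Hypotheses (d_sym : forall x y, d x y = d y x).
Hypotheses (f_ge0 : forall A, 0 <= f A).
Hypotheses (f_mono : forall A B : {set T}, A \subset B -> f A <= f B).
Hypotheses (f_sub : forall A B : {set T}, f (A :|: B) + f (A :&: B) <= f A + f B).

Lemma sum_marginals_ge (S X : {set T}) :
  f (S :|: X) - f S <= \sum_(o in X) (f (o |: S) - f S).
Proof.
have hl (l : seq T) : f (S :|: [set x in l]) - f S
    <= \sum_(o <- l) (f (o |: S) - f S).
  elim: l => [|a l IH].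
    rewrite big_nil (_ : S :|: _ = S) ?subrr //.
    by apply/setP => x; rewrite !inE orbF.
  rewrite big_cons.
  have -> : S :|: [set x in a :: l] = (a |: S) :|: (S :|: [set x in l]).
    by apply/setP => x; rewrite !inE; case: (x \in S); case: (x == a); rewrite ?orbT.
  have h := f_sub (a |: S) (S :|: [set x in l]).
  have : f S <= f ((a |: S) :&: (S :|: [set x in l])).
    by apply: f_mono; apply/fintype.subsetP => x; rewrite !inE => ->; rewrite orbT.
  lra.
have := hl (enum X); rewrite big_enum.
by rewrite (_ : [set x in enum X] = X) //; apply/setP => x; rewrite inE mem_enum.
Qed.

Variables (O : {set T}).

(** [dcross] runs over ordered pairs, hence the halves of the two terms in which both arguments
    agree. *)
Definition potential (S : {set T}) (rho : R) : R :=
  let Q := O :\: S in let th := rho / #|Q|%:R in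
  dcross d S S / 2 + th * dcross d S Q + th ^+ 2 * dcross d Q Q / 2
  + f O - expR (- th) * (f O - f S).

(** The value at [v] is at least the average value over Q. In this comparison the unknown [c]
    cancels, the profiles over Q sum to [dcross d Q Q / m], and submodularity bounds the sum of
    marginals below by the gap to [f O]. This is the common hypothesis of the two quadratic steps.
    [beta] bounds the distance of [w] from the exponential after the step, whose exponent depends on
    whether [v] is in O. *)
Lemma greedy_step (S : {set T}) (v : T) (rho : nat) (est : T -> R) (c eps w beta : R) :
  let Q := O :\: S in let m : R := #|Q|%:R in let D := dcross d O O in
  let val u := dsum d S u + rho%:R * ((1 + eps)^-1 * est u) + w * f (u |: S) in
  v \notin S -> (rho.+1 < #|Q|)%N -> 0 <= eps -> 0 <= w ->
  (forall u, `|est u - c - mean_dist d Q u| <= eps * (mean_dist d Q u + D / m ^+ 2)) ->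
  (forall u, u \notin S -> val u <= val v) ->
  `|w - expR (- (rho%:R / #|O :\: (v |: S)|%:R))| <= beta ->
  potential S rho.+1%:R <= potential (v |: S) rho%:R
    + beta * (f O / m + (f (v |: S) - f S)) + D / m ^+ 2 + 4 * eps * D / m.
Proof.
move=> Q m D val vS rhom eps0 w0 hest hmax hw.
have m1 : 1 < m by rewrite /m ltr1n; lia.
have m0 : 0 < m by lra.
have D0 : 0 <= D by exact: dcross_ge0.
set ka := (1 + eps)^-1; have ka0 : 0 < ka by rewrite invr_gt0; lra.
have kaE : ka * (1 + eps) = 1 by rewrite mulVf // gt_eqF; lra.
have ka1 : ka <= 1 by nra.
have kaE2 : 1 - 2 * eps <= ka * (1 - eps) by nra.
set e := dcross d Q Q; set g := dcross d S Q.
set rs := dsum d S v; set rr := dsum d Q v.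
set del := f (v |: S) - f S; set gam := f O - f S.
have del0 : 0 <= del by rewrite subr_ge0 f_mono // finset.subsetUr.
have e0 : 0 <= e by exact: dcross_ge0.
have eD : e <= D by apply: dcross_subset => //; rewrite finset.subsetDl.
have rr0 : 0 <= rr by exact: dsum_ge0.
pose r : R := rho%:R; have r0 : 0 <= r by rewrite ler0n.
have rm : r + 1 <= m by rewrite /r natr1 ler_nat; exact: ltnW.
have QS o : o \in Q -> o \notin S by rewrite inE => /andP[].
have avgE : \sum_(o in Q) mean_dist d Q o = e / m by rewrite -mulr_suml.
have sumest : m * c + (1 - eps) * (e / m) - eps * D / m <= \sum_(o in Q) est o.
  have -> : m * c + (1 - eps) * (e / m) - eps * D / m
     = \sum_(o in Q) (c + (1 - eps) * mean_dist d Q o - eps * D / m ^+ 2).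
    rewrite !big_split /= -mulr_sumr avgE !sum_const_set -/m.
    by field; rewrite gt_eqF.
  by apply: ler_sum => o oQ; move: (hest o) => /ler_normlP[]; lra.
have estv : est v <= c + (1 + eps) * (rr / m) + eps * D / m ^+ 2.
  by move: (hest v) => /ler_normlP[]; rewrite /mean_dist -/rr -/m; lra.
have sumf : Num.max gam 0 <= \sum_(o in Q) (f (o |: S) - f S).
  rewrite ge_max; apply/andP; split.
    apply: le_trans (sum_marginals_ge S Q); rewrite lerD2r f_mono //.
    by apply/fintype.subsetP => x xO; rewrite !inE xO andbT orbN.
  by apply: sumr_ge0 => o _; rewrite subr_ge0 f_mono // finset.subsetUr.
have hsum : \sum_(o in Q) val o <= m * val v.
  rewrite mulrC -sum_const_set; apply: ler_sum => o oQ; exact: hmax (QS o oQ).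
have sumE : \sum_(o in Q) val o
    = g + r * (ka * \sum_(o in Q) est o) + w * (\sum_(o in Q) (f (o |: S) - f S) + m * f S).
  rewrite /val !big_split /= -!mulr_sumr -/g; congr (_ + _ + w * _).
  by rewrite sumrN sum_const_set -/m; ring.
pose y := w * (Num.max gam 0 / m - del).
(* Because [ka * (1 + eps) = 1], the deflated estimate overrates [v] only by the additive term,
   while on Q it still keeps a fraction [1 - 2 * eps] of the profile. *)
have H : g + r / m * e - 4 * eps * D + m * y <= m * rs + r * rr.
  move: hsum; rewrite sumE /val -/rs -/ka.
  have h1 : r * (ka * est v) <= r * (ka * c + rr / m + eps * D / m ^+ 2).
    apply: ler_wpM2l => //.
    apply: (@le_trans _ _ (ka * (c + (1 + eps) * (rr / m) + eps * D / m ^+ 2))).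
      by rewrite ler_pM2l.
    have : 0 <= (1 - ka) * (eps * D / m ^+ 2).
      by apply: mulr_ge0; [lra|]; apply: divr_ge0; [exact: mulr_ge0|exact: sqr_ge0].
    have : ka * ((1 + eps) * (rr / m)) = rr / m by rewrite [LHS]mulrA kaE mul1r.
    lra.
  have h2 : r * (m * (ka * c) + (1 - 2 * eps) * (e / m) - eps * D / m)
      <= r * (ka * \sum_(o in Q) est o).
    apply: ler_wpM2l => //.
    apply: (@le_trans _ _ (ka * (m * c + (1 - eps) * (e / m) - eps * D / m))).
      have em : 0 <= e / m by rewrite divr_ge0 // ltW.
      have : 0 <= (1 - ka) * (eps * D / m).
        by apply: mulr_ge0; [lra|]; apply: divr_ge0; [exact: mulr_ge0|exact: ltW].
      have : (1 - 2 * eps) * (e / m) <= ka * (1 - eps) * (e / m) by rewrite ler_wpM2r.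
      lra.
    by rewrite ler_pM2l.
  have h3 : w * Num.max gam 0 <= w * \sum_(o in Q) (f (o |: S) - f S).
    by rewrite ler_wpM2l.
  have h4 : m * y = w * Num.max gam 0 - m * (w * del) by rewrite /y; field; rewrite gt_eqF.
  have fv : f (v |: S) = del + f S by rewrite /del; ring.
  have em : eps * (e / m) <= eps * (D / m).
    by rewrite ler_wpM2l // ler_wpM2r // invr_ge0 ltW.
  have h5 : r / m * (4 * eps * D) <= 1 * (4 * eps * D).
    apply: ler_wpM2r; last by rewrite ler_pdivrMr // mul1r; lra.
    by rewrite !mulr_ge0.
  have h6 : m * (r * (ka * c + rr / m + eps * D / m ^+ 2))
      = m * (r * (ka * c)) + r * rr + r / m * (eps * D) by field; rewrite gt_eqF.
  have h7 : m * (r * (ka * est v)) <= m * (r * (ka * c)) + r * rr + r / m * (eps * D).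
    by rewrite -h6 ler_pM2l.
  have h8 : r * (m * (ka * c) + (1 - 2 * eps) * (e / m) - eps * D / m)
     = m * (r * (ka * c)) + r / m * e - 2 * (r * (eps * (e / m))) - r / m * (eps * D).
    by field; rewrite gt_eqF.
  have h9 : r * (eps * (e / m)) <= r / m * (eps * D).
    have -> : r / m * (eps * D) = r * (eps * (D / m)) by field; rewrite gt_eqF.
    by rewrite ler_wpM2l.
  rewrite fv h4; lra.
have beta0 : 0 <= beta by apply: le_trans hw.
have maxO : Num.max gam 0 <= f O.
  by rewrite ge_max f_ge0 andbT /gam; have := f_ge0 S; lra.
have max0 : 0 <= Num.max gam 0 by rewrite le_max lexx orbT.
(* Replacing [w] by the true exponential costs the weight error times the difference of two
   nonnegative numbers, hence at most [beta] times their sum. [lam] is 1 for [v] outside O and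
   [1 - th] inside. *)
have final (lam wn : R) : 0 <= lam <= 1 -> `|w - wn| <= beta ->
    - (beta * (f O / m + del)) <= lam * y + lam * (wn * (del - Num.max gam 0 / m)).
  move=> /andP[l0 l1] hb.
  have -> : lam * y + lam * (wn * (del - Num.max gam 0 / m))
     = lam * ((w - wn) * (Num.max gam 0 / m - del)) by rewrite /y; ring.
  have gm : 0 <= Num.max gam 0 / m by rewrite divr_ge0 // ltW.
  have gm2 : Num.max gam 0 / m <= f O / m by rewrite ler_wpM2r // invr_ge0 ltW.
  apply: lerNnormlW; rewrite !normrM ger0_norm //.
  apply: (@le_trans _ _ (1 * (beta * `|Num.max gam 0 / m - del|))).
    by apply: ler_pM => //; exact: ler_wpM2r.
  rewrite mul1r ler_wpM2l //; apply/ler_normlP; split; lra.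
have [vO|vO] := boolP (v \in O); last first.
  have QE : O :\: (v |: S) = Q.
    apply/setP => x; rewrite !inE; case: eqP => [->|_] //=.
    by rewrite (negbTE vO) andbF.
  rewrite QE in hw.
  rewrite /potential QE -/Q -/m dcrossU1 // dcrossU1l // -/g -/rs -/rr -/e.
  have ex := @exponential_step R m (rho.+1%:R / m) (r / m) 1 gam del m0.

  have l1 : 0 <= (1 : R) <= 1 by rewrite ler01 lexx.
  have thE : r / m = rho.+1%:R / m - 1 / m by rewrite -natr1 -/r; ring.
  have {}ex := ex l1 del0 thE.
  have r1 : 1 <= r + 1 by lra.
  have eDD : 0 <= e <= D by rewrite e0.
  have H' : g + (r + 1 - 1) / m * e - 4 * eps * D + m * y <= m * rs + (r + 1 - 1) * rr.
    by rewrite addrK.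
  have qs := quadratic_step_out (dcross d S S) m0 r1 eDD H'.
  have fin := final 1 (expR (- (r / m))) l1 hw.
  have fv : f O - f (v |: S) = gam - del by rewrite /gam /del; ring.
  rewrite fv -/gam -/r; rewrite -natr1 -/r in ex *.
  rewrite addrK in qs; lra.
have vQ : v \in Q by rewrite inE vS.
have QE : O :\: (v |: S) = Q :\ v.
  by apply/setP => x; rewrite !inE negb_or andbA.
have cardE : #|Q :\ v|%:R = m - 1 :> R.
  by rewrite /m (cardsD1 v Q) vQ add1n -natr1 addrK.
rewrite QE cardE -/r in hw.
rewrite /potential QE -/Q cardE -/m dcrossU1 // dcrossU1l // dcrossD1r //.
rewrite dsumD1 // d_xx dcrossD1 // -/g -/rs -/rr -/e -/r.
pose th := r / (m - 1); rewrite -/th.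
have m10 : 0 < m - 1 by lra.
have th0 : 0 <= th by rewrite divr_ge0 // ltW.
have th1 : th <= 1 by rewrite ler_pdivrMr // mul1r; lra.
have l1 : 0 <= 1 - th <= 1 by lra.
(* When [v] leaves Q, [(rho + 1) / m] and [rho / (m - 1)] differ by exactly [(1 - th) / m], so the
   step counts as a fraction [1 - th] of an ordinary one. *)
have thE : th = rho.+1%:R / m - (1 - th) / m.
  by rewrite /th -natr1 -/r; field; rewrite !gt_eqF.
have ex := @exponential_step R m (rho.+1%:R / m) th (1 - th) gam del m0 l1 del0 thE.
have r1 : 1 <= r + 1 <= m by lra.
have eDD : 0 <= e <= D by rewrite e0.
have H' : g + (r + 1 - 1) / m * e - 4 * eps * D + m * y <= m * rs + (r + 1 - 1) * rr.
  by rewrite addrK.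
have thD : th = (r + 1 - 1) / (m - 1) by rewrite addrK.
have qs := quadratic_step_in (dcross d S S) m1 r1 eDD rr0 eps0 H' thD.
have fin := final (1 - th) (expR (- th)) l1 hw.
have fv : f O - f (v |: S) = gam - del by rewrite /gam /del; ring.
rewrite fv -/gam subr0; rewrite -natr1 -/r in ex *; lra.
Qed.

End GreedyStep.

(** * The greedy algorithm with guesses *)

Section Model.
Variables (R : realType) (n : nat) (d : 'I_n.+1 -> 'I_n.+1 -> R).
Variables (f : {set 'I_n.+1} -> R) (p a : nat).
Implicit Types (S : {set 'I_n.+1}).
Local Notation N := n.+1.

(** The initial pair is a dummy: for nonnegative values the first point outside [S] already replaces
    it. Ties go to the later point, as in the loop of the program. *)
Fixpoint pick_max S (val : 'I_N -> R) (i : nat) : 'I_N * R :=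
  if i is j.+1 then
    let b := pick_max S val j in
    if (inord j \notin S) && (b.2 <= val (inord j))
    then (inord j, val (inord j)) else b
  else (ord0, 0).

Lemma pick_maxP S (val : 'I_N -> R) :
  (forall u, 0 <= val u) -> (exists u, u \notin S) ->
  let v := (pick_max S val N).1 in
  v \notin S /\ forall u, u \notin S -> val u <= val v.
Proof.
move=> val0 [u0 u0S].
have key i : (i <= N)%N -> let b := pick_max S val i in
    (forall u : 'I_N, (u < i)%N -> u \notin S -> val u <= b.2) /\
    ((b.1 \notin S /\ b.2 = val b.1) \/
     (b.2 = 0 /\ forall u : 'I_N, (u < i)%N -> u \in S)).
  elim: i => [_|i IH iN] /=; first by split=> //; right.
  have [bmax bin] := IH (ltnW iN).
  have iE (u : 'I_N) : (u < i.+1)%N -> (u < i)%N \/ u = inord i.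
    rewrite ltnS leq_eqVlt => /orP[/eqP ui|]; last by left.
    by right; apply: val_inj; rewrite /= inordK.
  case: ifP => [/andP[iS bi]|hn] /=.
    split; last by left.
    by move=> u /iE[ui|->] // uS; apply: le_trans bi; exact: bmax.
  split.
    move=> u /iE[ui|uE] uS; first exact: bmax.
    by move: hn; rewrite -uE uS /= => /negbT; rewrite -ltNge => /ltW.
  case: bin => [|[b0 bS]]; first by left.
  right; split=> // u /iE[ui|->]; first exact: bS.
  by move: hn; rewrite b0 val0 andbT => /negbFE.
have [bmax [[bS bE]|[_ bS]]] := key N (leqnn _); last first.
  by move: u0S; rewrite bS // ltn_ord.
by split=> // u uS; rewrite -bE; exact: bmax.
Qed.

Definition digit (x : nat) : 'I_N := inord (x %% N).

(* The factor a / (a + 1) = 1 / (1 + 1 / a) turns an estimate E / k of relative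
   error 1 / a into an underestimate; z / N approximates e^(-th). *)
Definition greedy_value S (r k z : nat) (E : 'I_N -> R) (u : 'I_N) : R :=
  dsum d S u + r%:R * (E u * a%:R) / (k%:R * a.+1%:R)
  + z%:R * f (u |: S) / N%:R.

(** In order: current set, unread advice, steps to go, steps left in the round, sample sums not yet
    divided by [k], and the weight digit. *)
Record gstate := GState {
  gS : {set 'I_N}; gx : nat; gr : nat; glc : nat; gE : 'I_N -> R; gz : nat }.

Fixpoint sample_sum (k : nat) (E : 'I_N -> R) (x : nat) : ('I_N -> R) * nat :=
  if k is k'.+1 then sample_sum k' (fun u => E u + d (digit x) u) (x %/ N)%N
  else (E, x).

Definition refresh (L k : nat) (st : gstate) : gstate :=
  let s := sample_sum k (fun=> 0) (gx st %/ N)%N in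
  GState (gS st) s.2 (gr st) L s.1 (gx st %% N).

Definition greedy_pick S r k z E : 'I_N :=
  (pick_max S (greedy_value S r k z E) N).1.

(** The profile is weighted with the number of steps remaining after this one, in accordance with
    [greedy_step], where a step from [rho.+1] uses [rho]. *)
Definition select (k : nat) (st : gstate) : gstate :=
  let v := greedy_pick (gS st) (gr st).-1 k (gz st) (gE st) in
  GState (v |: gS st) (gx st) (gr st).-1 (glc st).-1 (gE st) (gz st).

Definition gstep (L k : nat) (st : gstate) : gstate :=
  select k (if glc st == 0%N then refresh L k st else st).

Fixpoint direct (b : nat) S (x : nat) : {set 'I_N} * nat :=
  if b is b'.+1 then direct b' (digit x |: S) (x %/ N)%N else (S, x).

Definition direct_start (x : nat) : {set 'I_N} * nat :=
  direct (minn (x %% N) p) finset.set0 (x %/ N)%N.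

Definition greedy_start (x : nat) : gstate :=
  let s := direct_start x in
  GState s.1 (s.2 %/ N %/ N %/ N)%N (s.2 %% N) 0 (fun=> 0) 0.

(** Every number is legal advice: the direct part yields at most [p] points, and greedy steps fill
    the set up to size [p], whatever parameters were read and even when the stream has run down to
    0. *)
Definition candidate (x : nat) : {set 'I_N} :=
  let st := greedy_start x in
  let x1 := (direct_start x).2 in
  gS (iter (p - #|gS st|) (gstep (x1 %/ N %% N) (x1 %/ N %/ N %% N)) st).

Hypotheses (d_ge0 : forall x y, 0 <= d x y) (f_ge0 : forall A, 0 <= f A).

(** * Every advice string yields a set of size p *)

Lemma greedy_value_ge0 S r k z E u :
  (forall u, 0 <= E u) -> 0 <= greedy_value S r k z E u.
Proof.
move=> E0; rewrite /greedy_value !addr_ge0 ?dsum_ge0 //.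
  by rewrite divr_ge0 ?mulr_ge0.
by rewrite divr_ge0 ?mulr_ge0.
Qed.

Lemma sample_sum_ge0 k E x :
  (forall u, 0 <= E u) -> forall u, 0 <= (sample_sum k E x).1 u.
Proof.
by elim: k E x => //= k IH E x E0 u; apply: IH => v; rewrite addr_ge0.
Qed.

Lemma exists_notin S : (#|S| < N)%N -> exists u, u \notin S.
Proof.
move=> hS; apply: contrapT => hn; move: hS.
rewrite (_ : S = [set: 'I_N]%SET) ?cardsT ?card_ord ?ltnn //.
apply/setP => u; rewrite inE; apply: contrapT => /negP uS; apply: hn; exists u.
by apply/negP => h; move/negP: uS; apply; rewrite h.
Qed.

Definition gvalid (st : gstate) := forall u, 0 <= gE st u.

Lemma gvalid_refresh L k st : gvalid (refresh L k st).
Proof. by apply: sample_sum_ge0. Qed.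

Lemma gvalid_gstep L k st : gvalid st -> gvalid (gstep L k st).
Proof.
by move=> h; rewrite /gstep /select; case: ifP => _ // u; exact: gvalid_refresh.
Qed.

Lemma greedy_pickP S r k z E :
  (forall u, 0 <= E u) -> (#|S| < N)%N ->
  let v := greedy_pick S r k z E in
  v \notin S /\ forall u, u \notin S ->
    greedy_value S r k z E u <= greedy_value S r k z E v.
Proof.
move=> E0 hS; apply: pick_maxP; last exact: exists_notin.
by move=> u; exact: greedy_value_ge0.
Qed.

Lemma card_gstep L k st : gvalid st -> (#|gS st| < N)%N ->
  #|gS (gstep L k st)| = #|gS st|.+1 /\ gS st \subset gS (gstep L k st).
Proof.
move=> h0 hc; rewrite /gstep /select.
case: ifP => _ /=; split; rewrite ?finset.subsetUr // cardsU1.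
  by have [-> _] := greedy_pickP (gr st).-1 k (gx st %% N) (gvalid_refresh L k st) hc.
by have [-> _] := greedy_pickP (gr st).-1 k (gz st) h0 hc.
Qed.

Lemma iter_gstep_card L k st j : gvalid st -> (#|gS st| + j <= N)%N ->
  let st' := iter j (gstep L k) st in
  [/\ gvalid st', #|gS st'| = (#|gS st| + j)%N & gS st \subset gS st'].
Proof.
move=> h0; elim: j => [_|j IH hc] /=; first by rewrite addn0.
have [h1 h2 h3] : [/\ gvalid (iter j (gstep L k) st),
    #|gS (iter j (gstep L k) st)| = (#|gS st| + j)%N
    & gS st \subset gS (iter j (gstep L k) st)].
  by apply: IH; rewrite addnS in hc; exact: ltnW.
have [|c1 c2] := card_gstep L k h1; first by rewrite h2; rewrite addnS in hc.
split; first exact: gvalid_gstep.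
  by rewrite c1 h2 addnS.
exact: fintype.subset_trans h3 c2.
Qed.

Lemma card_direct b S x : (#|(direct b S x).1| <= #|S| + b)%N.
Proof.
elim: b S x => [|b IH] S x /=; first by rewrite addn0.
apply: leq_trans (IH _ _) _; rewrite addnS -addSn leq_add2r cardsU1.
by case: (_ \notin _).
Qed.

Lemma card_direct_start x : (#|(direct_start x).1| <= p)%N.
Proof.
apply: leq_trans (card_direct _ _ _) _.
by rewrite cards0 add0n geq_minr.
Qed.

Lemma card_candidate x : (p <= N)%N -> #|candidate x| = p.
Proof.
move=> pN; have h := card_direct_start x.
have hv : gvalid (greedy_start x) by move=> u.
have hc : (#|gS (greedy_start x)| + (p - #|gS (greedy_start x)|) <= N)%N.
  by rewrite subnKC.
set x1 := (direct_start x).2.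
have [_ hS _] := iter_gstep_card (x1 %/ N %% N) (x1 %/ N %/ N %% N) hv hc.
by rewrite /candidate -/x1 hS subnKC.
Qed.

(** * Advice strings as base-N numbers *)

Definition encode (l : seq 'I_N) (y : nat) : nat :=
  foldr (fun (b : 'I_N) y => b + y * N)%N y l.

Lemma encode_lt l y j : (y < N ^ j)%N -> (encode l y < N ^ (size l + j))%N.
Proof.
move=> hy; elim: l => [|b l IH] //=; rewrite addSn expnS.
apply: (@leq_trans (N + encode l y * N)); first by rewrite ltn_add2r.
by rewrite -mulSn mulnC leq_mul2l IH orbT.
Qed.

Lemma modn_digit b y : (b < N)%N -> ((b + y * N) %% N = b)%N.
Proof. by move=> bN; rewrite addnC modnMDl modn_small. Qed.

Lemma divn_digit b y : (b < N)%N -> ((b + y * N) %/ N = y)%N.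
Proof. by move=> bN; rewrite addnC divnMDl // divn_small // addn0. Qed.

Lemma digit_ord (b : 'I_N) y : digit (b + y * N) = b.
Proof. by rewrite /digit modn_digit // inord_val. Qed.

Lemma direct_encode (l : seq 'I_N) S y :
  direct (size l) S (encode l y) = (S :|: [set x in l]%SET, y).
Proof.
elim: l S => [|b l IH] S /=.
  by congr pair; apply/setP => x; rewrite !inE orbF.
rewrite digit_ord divn_digit // IH; congr pair; apply/setP => x; rewrite !inE.
by rewrite orbCA orbA.
Qed.

Lemma sample_sum_encode l E y :
  sample_sum (size l) E (encode l y) = ((fun u => E u + \sum_(b <- l) d b u), y).
Proof.
elim: l E => [|b l IH] E /=.
  by congr pair; apply/funext => u; rewrite big_nil addr0.
rewrite digit_ord divn_digit // IH; congr pair; apply/funext => u.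
by rewrite big_cons addrA.
Qed.

Lemma direct_guess (O : {set 'I_N}) (K : nat) : (p <= N)%N -> (p < K)%N -> #|O| = p ->
  exists2 x, (x < N ^ K)%N & candidate x = O.
Proof.
move=> pN pK cO; have [pN'|pn] := ltnP p N; last first.
  (* [p = N] does not fit into a digit, but then every candidate is the full set and any advice
     works. *)
  have pE : p = N by apply/eqP; rewrite eqn_leq pN.
  exists 0%N; first by rewrite expn_gt0.
  have full (S : {set 'I_N}) : #|S| = p -> S = [set: 'I_N]%SET.
    move=> cS; apply/eqP; rewrite eqEcard finset.subsetT cardsT card_ord cS pE.
    by rewrite leqnn.
  by rewrite (full _ cO) (full (candidate 0)) // card_candidate.
have sz : size (enum O) = p by rewrite -cardE.
exists (p + encode (enum O) 0 * N)%N.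
  have := @encode_lt (Ordinal pN' :: enum O) 0 0 isT.
  rewrite /= sz addn0 => h; apply: (leq_trans h).
  by rewrite leq_pexp2l.
have dE : direct_start (p + encode (enum O) 0 * N) = (O, 0%N).
  rewrite /direct_start modn_digit // divn_digit // minnn -{1}sz direct_encode.
  by congr pair; apply/setP => x; rewrite !inE mem_enum.
by rewrite /candidate /greedy_start dE /= cO subnn.
Qed.

End Model.

(** * Analysis of the rounds *)

(* lia is slow in the presence of hypotheses about real numbers. *)
Ltac keep_nat_hyps :=
  repeat match goal with
  | H : ?P |- _ => lazymatch P with
      | is_true (leq _ _) => fail
      | @eq nat _ _ => fail
      | nat => fail
      | _ => clear H
      end
  end.
Ltac nlia := keep_nat_hyps; lia.
Ltac nnia := keep_nat_hyps; nia.

(** * Real estimates for the drift within a round *)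

Section RealFacts.
Variable R : realType.

Lemma expRN_lipschitz (x y : R) : 0 <= x -> 0 <= y ->
  `|expR (- x) - expR (- y)| <= `|x - y|.
Proof.
suff key (s t : R) : 0 <= s -> s <= t ->
    0 <= expR (- s) - expR (- t) /\ expR (- s) - expR (- t) <= t - s.
  move=> x0 y0; have [xy|/ltW yx] := leP x y.
    have [h1 h2] := key x y x0 xy.
    by rewrite ger0_norm // distrC ger0_norm // subr_ge0.
  have [h1 h2] := key y x y0 yx.
  by rewrite distrC ger0_norm // ger0_norm // subr_ge0.
move=> s0 st; have := expR_ge1Dx (- (t - s)).
have -> : expR (- t) = expR (- s) * expR (- (t - s)).
  by rewrite -expRD; congr expR; ring.
have e0 := expR_gt0 (- s).
have e1 : expR (- s) <= 1 by rewrite -expR0 ler_expR; lra.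
have e2 : expR (- (t - s)) <= 1 by rewrite -expR0 ler_expR; lra.
by move=> h; split; nra.
Qed.

(** Numerator and denominator fall by at most [L] each. The two effects have opposite signs and, the
    ratio being at most 1, each alone moves it by at most [L / m1]. *)
Lemma ratio_stable (r0 m0 r1 m1 L : R) :
  0 <= r1 <= r0 -> 0 < m1 <= m0 -> r0 <= m0 -> r0 - r1 <= L -> m0 - m1 <= L ->
  `|r0 / m0 - r1 / m1| <= L / m1.
Proof.
move=> /andP[r10 r1r0] /andP[m10 m1m0] r0m0 hr hm.
have m00 : 0 < m0 by lra.
have q : 0 < m1^-1 by rewrite invr_gt0.
have q01 : m0^-1 <= m1^-1 by rewrite lef_pV2 // posrE.
apply/ler_normlP; split.
  have h1 : r1 / m1 <= r0 / m1 by rewrite ler_wpM2r // ltW.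
  have h2 : r0 / m1 - r0 / m0 = r0 / m0 * ((m0 - m1) / m1).
    by field; rewrite !gt_eqF.
  have h3 : r0 / m0 <= 1 by rewrite ler_pdivrMr // mul1r.
  have h4 : 0 <= (m0 - m1) / m1 by rewrite mulr_ge0 ?(ltW q) // subr_ge0.
  have h5 : r0 / m0 * ((m0 - m1) / m1) <= (m0 - m1) / m1 by rewrite ler_piMl.
  have h6 : (m0 - m1) / m1 <= L / m1 by rewrite ler_wpM2r // ltW.
  lra.
have h1 : r0 / m0 <= r0 / m1 by rewrite ler_wpM2l //; lra.
have h2 : (r0 - r1) / m1 <= L / m1 by rewrite ler_wpM2r // ltW.
by rewrite mulrBl in h2; lra.
Qed.

Lemma exists_digit_near (N : nat) (w : R) : (0 < N)%N -> 0 <= w < 1 ->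
  exists2 z, (z < N)%N & `|z%:R / N%:R - w| <= N%:R^-1.
Proof.
move=> N0 /andP[w0 w1]; have n0 : 0 < N%:R :> R by rewrite ltr0n.
have wn : 0 <= w * N%:R by rewrite mulr_ge0.
have /andP[h1 h2] := truncn_itv wn.
exists (Num.truncn (w * N%:R)).
  rewrite -(ltr_nat R); apply: le_lt_trans h1 _.
  by rewrite gtr_pMl.
set z := Num.truncn _ in h1 h2 *.
have -> : z%:R / N%:R - w = (z%:R - w * N%:R) / N%:R by field; rewrite gt_eqF.
rewrite normrM [`|N%:R^-1|]gtr0_norm ?invr_gt0 // ler_piMl ?invr_ge0 //.
by rewrite -natr1 in h2; apply/ler_normlP; split; lra.
Qed.

(** The bookkeeping of one step: [s1] and [s2] are the loss by the inexact weight, charged to [f O]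
    and to the marginal gain, and [s3], [s4] are the losses of dispersion. *)
Lemma step_errors (P F X L i j ip ew fS fS' D t k1 k2 s1 s2 s3 s4 q : R) :
  s1 <= F * (q + L * (i - j)) -> s2 <= ew * (fS' - fS) ->
  s3 <= D * k1 -> s4 <= D * k2 ->
  P + (s1 + s2) + s3 + s4 + F * (X + L * (j - ip)) + ew * fS + D * (t * (k1 + k2))
  <= P + F * (X + q + L * (i - ip)) + ew * fS' + D * ((t + 1) * (k1 + k2)).
Proof. lra. Qed.

Lemma run_errors (th D F ex f0 w A fS X L i ip Y : R) :
  0 <= ex * f0 -> 0 <= w * f0 -> 0 <= w * (A / 2) -> 0 <= F * (L * ip) ->
  0 + 0 + th ^+ 2 * D / 2 + F - ex * (F - f0) + F * (0 + 0) + w * f0 + 0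
  <= A / 2 + 0 + 0 + F - (F - fS) + F * (X + L * (i - ip)) + w * fS + D * Y ->
  th ^+ 2 * (D / 2) + (1 - ex) * F
  <= (1 + w) * (A / 2 + fS) + F * (X + L * i) + D * Y.
Proof. lra. Qed.

End RealFacts.

Lemma card_setD_le (T : finType) (O S S' : {set T}) : S \subset S' ->
  (#|O :\: S| <= #|O :\: S'| + (#|S'| - #|S|))%N.
Proof.
move=> SS; rewrite -cardsDS //.
apply: (@leq_trans #|(O :\: S') :|: (S' :\: S)|); last by rewrite leq_card_setU.
apply: subset_leq_card; apply/fintype.subsetP => x; rewrite !inE.
by case: (x \in S); case: (x \in S'); case: (x \in O).
Qed.

(** * Rounds with frozen samples and weight *)

Section Rounds.
Variables (R : realType) (n : nat) (d : 'I_n.+1 -> 'I_n.+1 -> R).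
Variables (f : {set 'I_n.+1} -> R) (p a : nat).
Local Notation N := n.+1.
Hypotheses (d_ge0 : forall x y, 0 <= d x y) (d_xx : forall x, d x x = 0).
Hypotheses (d_sym : forall x y, d x y = d y x).
Hypotheses (d_tri : forall x y z, d x z <= d x y + d y z).
Hypotheses (f_ge0 : forall A, 0 <= f A).
Hypotheses (f_mono : forall A B : {set 'I_N}, A \subset B -> f A <= f B).
Hypotheses (f_sub : forall A B : {set 'I_N},
  f (A :|: B) + f (A :&: B) <= f A + f B).
Variables (O : {set 'I_N}) (p' L k : nat) (eps1 : R).
Hypotheses (pN : (p <= N)%N) (cO : #|O| = p) (p'p : (p' < p)%N).
Hypotheses (L0 : (0 < L)%N) (k0 : (0 < k)%N) (a0 : (0 < a)%N).
Hypotheses (eps1P : 0 < eps1 <= 1).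
Hypotheses (hk : 8 * ln (2 * N%:R) <= eps1 ^+ 2 * k%:R).

Let e : R := (p - p')%:R.
Let e0 : 0 < e. Proof. by rewrite /e ltr0n subn_gt0. Qed.

Hypotheses (heps : 2 * eps1 + 2 * (L%:R / e) <= a%:R^-1).

Let D := dcross d O O.
Let D0 : 0 <= D. Proof. exact: dcross_ge0. Qed.

(* The potential after t steps plus the losses that these steps may have caused;
   the term (p - t)^-1 telescopes. *)
Definition run_potential (S : {set 'I_N}) (t : nat) : R :=
  potential d f O S (p' - t)%:R
  + f O * (t%:R / (N%:R * e) + L%:R * ((p - t)%:R^-1 - p%:R^-1))
  + (N%:R^-1 + L%:R / e) * f S
  + D * (t%:R * (e^-1 ^+ 2 + 4 * a%:R^-1 / e)).

Definition good_samples (S0 : {set 'I_N}) (l : seq 'I_N) :=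
  forall (Y : {set 'I_N}) (del : R), Y \subset O :\: S0 -> (0 < #|Y|)%N ->
      #|O :\: S0|%:R - #|Y|%:R <= del * #|Y|%:R ->
      exists c, forall u,
      `|(\sum_(b <- l) d b u) / k%:R - c - mean_dist d Y u|
        <= (2 * eps1 + 2 * del) * (mean_dist d Y u + D / #|Y|%:R ^+ 2).

(** [S0] is the set at the start of the round, whose samples and weight are still in use. At most
    [L] points were added since, so Q has lost at most [L / e] times its present size and [th] has
    moved by at most [L / m1]. With the rounding [1 / N] of the digit this gives [beta]. *)
Lemma round_step (S0 S : {set 'I_N}) (z : nat) (l : seq 'I_N) :
  S0 \subset S -> (#|S| < p')%N -> (#|S| < #|S0| + L)%N ->
  good_samples S0 l ->
  `|z%:R / N%:R - expR (- ((p' - #|S0|)%:R / #|O :\: S0|%:R))| <= N%:R^-1 :> R ->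
  let v := greedy_pick d f a S (p' - #|S|).-1 k z (fun u => \sum_(b <- l) d b u) in
  v \notin S /\ run_potential S #|S| <= run_potential (v |: S) #|S|.+1.
Proof.
move=> S0S Sp' SL hl hz.
set E := (fun u => \sum_(b <- l) d b u).
set t := #|S| in Sp' SL *; set rho := (p' - t).-1; move=> v.
have E0 u : 0 <= E u by apply: sumr_ge0.
have SN : (#|S| < N)%N by rewrite -/t; nlia.
have [vS vmax] := greedy_pickP a d_ge0 f_ge0 rho k z E0 SN.
rewrite -/v in vS vmax; split => //.
have rhoE : (p' - t)%N = rho.+1 by rewrite /rho; nlia.
have tS0 : (#|S0| <= t)%N by exact: subset_leq_card.
have cm : (p - t <= #|O :\: S|)%N.
  by rewrite cardsD cO leq_sub2l // subset_leq_card // finset.subsetIr.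
have cvS : #|v |: S| = t.+1 by rewrite cardsU1 vS.
have cm1 : (p - t.+1 <= #|O :\: (v |: S)|)%N.
  by rewrite cardsD cO leq_sub2l // -cvS subset_leq_card // finset.subsetIr.
have cst : (#|O :\: S0| <= #|O :\: S| + (t - #|S0|))%N by exact: card_setD_le.
have cst1 : (#|O :\: S0| <= #|O :\: (v |: S)| + (t.+1 - #|S0|))%N.
  rewrite -cvS; apply: card_setD_le.
  by apply: fintype.subset_trans S0S _; rewrite finset.subsetUr.
have cle1 : (#|O :\: (v |: S)| <= #|O :\: S0|)%N.
  apply: subset_leq_card; rewrite finset.setDS //.
  by apply: fintype.subset_trans S0S _; rewrite finset.subsetUr.
have cm0 : (p - #|S0| <= #|O :\: S0|)%N.
  by rewrite cardsD cO leq_sub2l // subset_leq_card // finset.subsetIr.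
pose m : R := #|O :\: S|%:R.
have em : e <= m by rewrite /e /m ler_nat; nlia.
have m0 : 0 < m := lt_le_trans e0 em.
have QY : O :\: S \subset O :\: S0 by rewrite finset.setDS.
have Q0 : (0 < #|O :\: S|)%N by nlia.
have hdel : #|O :\: S0|%:R - #|O :\: S|%:R <= L%:R / e * #|O :\: S|%:R.
  apply: (@le_trans _ _ L%:R); first by rewrite lerBlDr -natrD ler_nat; nlia.
  rewrite mulrAC ler_pdivlMr // ler_wpM2l //.
have [c hc] := hl _ _ QY Q0 hdel.
set w := z%:R / N%:R in hz.
have w0 : 0 <= w by rewrite divr_ge0.
have ai0 : 0 < a%:R^-1 :> R by rewrite invr_gt0 ltr0n.
have hc' u : `|E u / k%:R - c - mean_dist d (O :\: S) u|
    <= a%:R^-1 * (mean_dist d (O :\: S) u + D / #|O :\: S|%:R ^+ 2).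
  apply: le_trans (hc u) _; apply: ler_wpM2r => //.
  by rewrite addr_ge0 ?mean_dist_ge0 // divr_ge0 // sqr_ge0.
have vE u : greedy_value d f a S rho k z E u =
    dsum d S u + rho%:R * ((1 + a%:R^-1)^-1 * (E u / k%:R)) + w * f (u |: S).
  have an : a%:R != 0 :> R by rewrite pnatr_eq0 -lt0n.
  have kn : k%:R != 0 :> R by rewrite pnatr_eq0 -lt0n.
  have a1n : a.+1%:R != 0 :> R by rewrite pnatr_eq0.
  have -> : 1 + a%:R^-1 = a.+1%:R / a%:R :> R by rewrite -natr1 mulrDl divff // mul1r.
  rewrite invf_div.
  rewrite /greedy_value /w; congr (_ + _ + _); last by ring.
  by move: (a.+1%:R : R) a1n => A An; field; rewrite An kn.
have hmax u : u \notin S ->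
    dsum d S u + rho%:R * ((1 + a%:R^-1)^-1 * (E u / k%:R)) + w * f (u |: S)
  <= dsum d S v + rho%:R * ((1 + a%:R^-1)^-1 * (E v / k%:R)) + w * f (v |: S).
  by move=> uS; rewrite -!vE; exact: vmax.
have rm : (rho.+1 < #|O :\: S|)%N by nlia.
pose m1 : R := (p - t.+1)%:R.
have em1 : e <= m1 by rewrite /e /m1 ler_nat; nlia.
have m10 : 0 < m1 := lt_le_trans e0 em1.
have m1m : m1 + 1 <= m by rewrite /m1 /m natr1 ler_nat; nlia.
have pt : (p - t)%:R = m1 + 1 by rewrite /m1 natr1; congr _%:R; nlia.
pose beta : R := N%:R^-1 + L%:R / m1.
have hbeta : `|w - expR (- (rho%:R / #|O :\: (v |: S)|%:R))| <= beta.
  set x0 := (p' - #|S0|)%:R / _ in hz; set x1 := rho%:R / _.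
  have h1 : `|expR (- x0) - expR (- x1)| <= `|x0 - x1|.
    by apply: expRN_lipschitz; rewrite divr_ge0.
  have M1 : 0 < #|O :\: (v |: S)|%:R :> R by rewrite ltr0n; nlia.
  have h2 : `|x0 - x1| <= L%:R / #|O :\: (v |: S)|%:R.
    have n1 : (rho <= p' - #|S0|)%N by nlia.
    have n2 : (p' - #|S0| <= #|O :\: S0|)%N by nlia.
    have n3 : (p' - #|S0| <= L + rho)%N by nlia.
    have n4 : (#|O :\: S0| <= L + #|O :\: (v |: S)|)%N by nlia.
    apply: ratio_stable; rewrite ?ler0n ?M1 ?ler_nat ?n1 ?cle1 //.
      by rewrite lerBlDr -natrD ler_nat.
    by rewrite lerBlDr -natrD ler_nat.
  have h3 : L%:R / #|O :\: (v |: S)|%:R <= L%:R / m1.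
    by rewrite ler_wpM2l // lef_pV2 ?posrE // ler_nat.
  apply: le_trans (ler_distD (expR (- x0)) _ _) _; apply: lerD => //.
  exact: le_trans h1 (le_trans h2 h3).
have step := @greedy_step R _ d f d_ge0 d_xx d_sym f_ge0 f_mono f_sub O S v rho
  (fun u => E u / k%:R) c a%:R^-1 w beta vS rm (ltW ai0) w0 hc' hmax hbeta.
rewrite -/D -/m in step.
rewrite /run_potential rhoE (_ : (p' - t.+1)%N = rho); last by nlia.
rewrite pt -/m1.
apply: le_trans (lerD (lerD (lerD step (lexx _)) (lexx _)) (lexx _)) _.
set del := f (v |: S) - f S.
have del0 : 0 <= del by rewrite subr_ge0 f_mono // finset.subsetUr.
have m11 : 0 < m1 + 1 by rewrite addr_gt0.
have i1 : m^-1 <= (m1 + 1)^-1 by rewrite lef_pV2 ?posrE.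
have i2 : (m1 + 1)^-1 <= e^-1.
  by rewrite lef_pV2 ?posrE //; apply: le_trans em1 _; rewrite lerDl.
have i3 : m1^-1 <= e^-1 by rewrite lef_pV2 ?posrE.
have i4 : m^-1 <= e^-1 := le_trans i1 i2.
have i0 : 0 <= m^-1 by rewrite invr_ge0 ltW.
have ei0 : 0 <= e^-1 by rewrite invr_ge0 ltW.
have ni0 : 0 <= N%:R^-1 :> R by rewrite invr_ge0.
rewrite [beta * _]mulrDr -[t.+1%:R]natr1 [(t%:R + 1) / _]mulrDl div1r [(N%:R * e)^-1]invfM.
apply: step_errors.
(* Over the run these terms telescope to at most [L / e]. Bounding each by [L / e ^+ 2] would cost a
   further factor [p' / e] of order [H], too much for the f-part. *)
- have -> : m1^-1 - (m1 + 1)^-1 = m1^-1 * (m1 + 1)^-1.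
    by field; rewrite !gt_eqF.
  rewrite mulrCA ler_wpM2l // /beta mulrDl; apply: lerD.
    by rewrite ler_wpM2l.
  by rewrite -mulrA ler_wpM2l // ler_wpM2l // invr_ge0 ltW.
- by rewrite ler_wpM2r // lerD2l ler_wpM2l.
- by rewrite -exprVn ler_wpM2l // ler_pXn2r ?nnegrE.
- rewrite mulrAC [leLHS]mulrC; apply: ler_wpM2l => //.
  by apply: ler_wpM2l => //; rewrite mulr_ge0 // ltW.
Qed.


Lemma iter_gstep_select st j : (j <= glc st)%N ->
  glc (iter j (select d f a k) st) = (glc st - j)%N /\
  iter j (gstep d f a L k) st = iter j (select d f a k) st.
Proof.
elim: j => [_|j IH hj] /=; first by rewrite subn0.
have [h1 h2] := IH (ltnW hj); rewrite h2; split.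
  by rewrite h1 subnS.
by rewrite /gstep h1 ifN // -lt0n subn_gt0.
Qed.

(** [select] never reads the stream, so the set reached at the end of a round does not depend on the
    advice for later rounds. *)
Definition set_stream (x : nat) (st : gstate R n) : gstate R n :=
  GState (gS st) x (gr st) (glc st) (gE st) (gz st).

Lemma iter_select_stream x j st :
  iter j (select d f a k) (set_stream x st) = set_stream x (iter j (select d f a k) st).
Proof. by elim: j => //= j ->. Qed.

Lemma select_rounds (S0 : {set 'I_N}) (z x : nat) (l : seq 'I_N) (j : nat) :
  (#|S0| + L <= p')%N -> (j <= L)%N -> good_samples S0 l ->
  `|z%:R / N%:R - expR (- ((p' - #|S0|)%:R / #|O :\: S0|%:R))| <= N%:R^-1 :> R ->
  let st := iter j (select d f a k)
    (GState S0 x (p' - #|S0|) L (fun u => \sum_(b <- l) d b u) z) in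
  [/\ S0 \subset gS st, #|gS st| = (#|S0| + j)%N & gr st = (p' - (#|S0| + j))%N] /\
  [/\ gE st = (fun u => \sum_(b <- l) d b u), gz st = z &
  run_potential S0 #|S0| <= run_potential (gS st) (#|S0| + j)].
Proof.
move=> hS hj hl hz; elim: j hj => [_|j IH hj] /=; first by rewrite addn0.
have [[h1 h2 h3] [h4 h5 h6]] := IH (ltnW hj).
set st := iter j _ _ in h1 h2 h3 h4 h5 h6 *.
have g1 : (#|gS st| < p')%N by rewrite h2; nlia.
have g2 : (#|gS st| < #|S0| + L)%N by rewrite h2 ltn_add2l.
have [v1 v2] := round_step h1 g1 g2 hl hz.
rewrite h3 h4 h5 -h2; split; split => //.
- by apply: fintype.subset_trans h1 _; rewrite finset.subsetUr.
- by rewrite cardsU1 v1 add1n h2 addnS.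
- by rewrite h2 addnS subnS.
- by apply: le_trans h6 _; rewrite addnS -h2.
Qed.

(** [S1] comes before the continuation [y], because later advice is chosen in view of [S1]; strings
    are thus assembled from the last round backwards. [E0] and [z0] are leftovers of the previous
    round, overwritten by the refresh. *)
Lemma round_exists (S0 : {set 'I_N}) : (#|S0| + L <= p')%N ->
  exists S1 : {set 'I_N}, [/\ #|S1| = (#|S0| + L)%N,
    run_potential S0 #|S0| <= run_potential S1 #|S1| &
    forall y j, (y < N ^ j)%N -> exists2 x, (x < N ^ (k.+1 + j))%N &
    forall E0 z0, exists E1 z1,
      iter L (gstep d f a L k) (GState S0 x (p' - #|S0|) 0 E0 z0)
      = GState S1 y (p' - #|S1|) 0 E1 z1].
Proof.
move=> hS.
have cm0 : (p - #|S0| <= #|O :\: S0|)%N.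
  by rewrite cardsD cO leq_sub2l // subset_leq_card // finset.subsetIr.
have Q0 : (0 < #|O :\: S0|)%N by nlia.
have hk' : 8 * ln (2 * #|{: 'I_N}|%:R) <= eps1 ^+ 2 * k%:R by rewrite card_ord.
have [l [sl lQ hl]] := sampled_profile_stale d_ge0 d_sym d_tri
  (finset.subsetDl O S0) Q0 eps1P k0 hk'.
have w1 : 0 <= expR (- ((p' - #|S0|)%:R / #|O :\: S0|%:R) : R) < 1.
  apply/andP; split; first exact: expR_ge0.
  (* Strictness comes from the steps still to be made; a weight equal to 1 would be truncated to
     [N], which is no digit. *)
  rewrite -[ltRHS](@expR0 R) ltr_expR oppr_lt0 divr_gt0 ?ltr0n //.
  by nlia.
have [z zN hz] := exists_digit_near (ltn0Sn n) w1.
have sel x := select_rounds x hS (leqnn L) hl hz.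
set E := (fun u => \sum_(b <- l) d b u) in sel.
pose st1 := iter L (select d f a k) (GState S0 0 (p' - #|S0|) L E z).
have [[_ c1 r1] [_ _ p1]] := sel 0%N.
exists (gS st1); rewrite -/st1 in c1 r1 p1; split => //; first by rewrite c1.
move=> y j yj; exists (z + encode l y * N)%N.
  have := @encode_lt n (Ordinal zN :: l) y j yj; by rewrite /= sl.
move=> E0 z0; exists (gE st1), (gz st1).
set st := GState S0 _ _ _ _ _.
have refE : refresh d L k st = set_stream y (GState S0 0 (p' - #|S0|) L E z).
  rewrite /refresh /st /= divn_digit // modn_digit // -sl sample_sum_encode /=.
  by rewrite /set_stream /=; congr GState; apply/funext => u; rewrite add0r.
(* After a refresh the round counter is [L > 0], so refreshing beforehand does not change the first
   step. *)
have stepE : gstep d f a L k st = gstep d f a L k (refresh d L k st).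
  by rewrite {2}/gstep ifN // -lt0n.
have iterE i : (0 < i)%N ->
    iter i (gstep d f a L k) st = iter i (gstep d f a L k) (refresh d L k st).
  by case: i => // i _; rewrite !iterSr stepE.
have [gl1 gl2] := @iter_gstep_select (refresh d L k st) L (leqnn _).
rewrite iterE // gl2 refE iter_select_stream -/st1 /set_stream c1 r1.
move: gl1; rewrite refE iter_select_stream -/st1 /= subnn => ->.
by [].
Qed.

Lemma rounds_exist (q : nat) (S : {set 'I_N}) : (#|S| + q * L = p')%N ->
  exists S' : {set 'I_N}, run_potential S #|S| <= run_potential S' p' /\
  exists2 y, (y < N ^ (q * k.+1))%N & forall E0 z0,
    gS (iter (q * L) (gstep d f a L k) (GState S y (p' - #|S|) 0 E0 z0)) = S'.
Proof.
elim: q S => [|q IH] S hS.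
  exists S; rewrite mul0n addn0 in hS; split; first by rewrite hS.
  by exists 0%N; rewrite ?expn_gt0.
have hS1 : (#|S| + L <= p')%N by rewrite -hS mulSn addnA leq_addr.
have [S1 [c1 p1 run1]] := round_exists hS1.
have hS2 : (#|S1| + q * L = p')%N by rewrite c1 -addnA -mulSn.
have [S' [p2 [y yb run2]]] := IH S1 hS2.
exists S'; split; first exact: le_trans p1 p2.
have [x xb runx] := run1 y _ yb.
exists x; first by rewrite mulSn.
move=> E0 z0; have [E1 [z1 h]] := runx E0 z0.
by rewrite mulSn addnC iterD h run2.
Qed.

(** The four leading digits are 0, for no direct points, then [p'], [L] and [k]. The run starts from
    the empty set with [th = p' / p]; at the end [th = 0] and the potential is the dispersion of
    [S'] plus [f S']. Only inclusion in the candidate is claimed, as the last [p - p'] points are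
    arbitrary. *)
Lemma greedy_guess (q : nat) : (q * L = p')%N -> (L < N)%N -> (k < N)%N ->
  exists2 x, (x < N ^ (4 + q * k.+1))%N & exists2 S' : {set 'I_N},
    S' \subset candidate d f p a x &
    (p'%:R / p%:R) ^+ 2 * (D / 2) + (1 - expR (- (p'%:R / p%:R))) * f O
    <= (1 + (N%:R^-1 + L%:R / e)) * (dcross d S' S' / 2 + f S')
       + f O * (p'%:R / (N%:R * e) + L%:R / e)
       + D * (p'%:R * (e^-1 ^+ 2 + 4 * a%:R^-1 / e)).
Proof.
move=> qL LN kN.
have c0 : #|finset.set0 : {set 'I_N}| = 0%N by rewrite cards0.
have h0 : (#|finset.set0 : {set 'I_N}| + q * L = p')%N by rewrite c0.
have [S' [hp [y yb run]]] := rounds_exist h0.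
have p'N : (p' < N)%N by nlia.
pose x1 := (p' + (L + (k + y * N) * N) * N)%N.
exists (0 + x1 * N)%N.
  have := @encode_lt n [:: ord0; Ordinal p'N; Ordinal LN; Ordinal kN] y _ yb.
  by [].
have dE : direct_start n p (0 + x1 * N) = (finset.set0, x1).
  by rewrite /direct_start modn_digit // divn_digit // min0n.
exists S'.
  rewrite /candidate /greedy_start dE /= c0 subn0 /x1.
  rewrite !(divn_digit _ p'N, divn_digit _ LN, divn_digit _ kN).
  rewrite !(modn_digit _ p'N, modn_digit _ LN, modn_digit _ kN).
  set st := GState _ _ _ _ _ _.
  (* [iterD] executes the right summand first, so the analysed steps precede the filling ones. *)
  have -> : p = ((p - p') + p')%N by nlia.
  rewrite iterD.
  have sv : gvalid st by [].
  have sc : (#|gS st| + p' <= N)%N by rewrite c0; nlia.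
  have [v1 v2 _] := iter_gstep_card a d_ge0 f_ge0 L k sv sc.
  have runE : gS (iter p' (gstep d f a L k) st) = S'.
    by rewrite -[X in iter X]qL -(run (fun=> 0) 0%N) c0 subn0.
  rewrite -{1}runE.
  have sc2 : (#|gS (iter p' (gstep d f a L k) st)| + (p - p') <= N)%N.
    by rewrite v2 c0; nlia.
  by have [_ _ h3] := iter_gstep_card a d_ge0 f_ge0 L k v1 sc2.
move: hp; rewrite /run_potential /potential c0 !subn0 subnn finset.setD0 cO.
have -> : dcross d finset.set0 finset.set0 = 0 by rewrite /dcross big_set0.
have -> : dcross d finset.set0 O = 0.
  by rewrite /dcross big1 // => o _; rewrite /dsum big_set0.
rewrite -/D -/e !mul0r oppr0 expR0 expr0n /= !mul0r subrr !mulr0 !mul1r.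
have := f_ge0 finset.set0; set f0 := f finset.set0.
have ex := expR_ge0 (- (p'%:R / p%:R) : R).
have ew : 0 <= N%:R^-1 + L%:R / e by rewrite addr_ge0 ?divr_ge0 ?invr_ge0 ?(ltW e0).
have fO := f_ge0 O.
have h3 : 0 <= f O * (L%:R * p%:R^-1) by rewrite !mulr_ge0 ?invr_ge0.
have dS := dcross_ge0 d_ge0 S' S'.
set th := p'%:R / p%:R in ex *; set w := N%:R^-1 + _ in ew *.
move=> f00 hp.
have h4 : 0 <= expR (- th) * f0 by rewrite mulr_ge0.
have h5 : 0 <= w * f0 by rewrite mulr_ge0.
have h6 : 0 <= w * (dcross d S' S' / 2) by rewrite mulr_ge0 // divr_ge0.
by apply: run_errors hp.
Qed.

End Rounds.

(** * Choice of the parameters *)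

Lemma disp_dcross (R : realType) (n : nat) (d : 'I_n -> 'I_n -> R) (S : {set 'I_n}) :
  (forall x, d x x = 0) -> (forall x y, d x y = d y x) ->
  disp d S = dcross d S S / 2.
Proof.
move=> dxx dsym.
suff -> : dcross d S S = disp d S + disp d S by field.
rewrite {2}/disp.
have -> : \sum_(i in S) \sum_(j in S | (i < j)%N) d i j
    = \sum_(i in S) \sum_(j in S | (j < i)%N) d i j.
  rewrite (exchange_big_dep (mem S)) /=; last by move=> i j iS /andP[].
  by apply: eq_bigr => j jS; apply: eq_big => [i|i _]; rewrite ?jS ?andbT.
rewrite /disp -big_split /=; apply: eq_bigr => i iS.
rewrite /dsum (bigID (fun j : 'I_n => (i < j)%N)) /=; congr (_ + _).
  by apply: eq_bigr => j _; rewrite dsym.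
rewrite (bigD1 i) /=; last by rewrite iS ltnn.
rewrite dxx add0r; apply: eq_big => [j|j _]; last by rewrite dsym.
by case: (j \in S) => //=; rewrite -leqNgt ltn_neqAle andbC.
Qed.

Section Constants.
Variable R : realType.

(* Four digits for the parameters, then 400 H (H - 1) rounds of one digit for
   the weight and 16 (400 H)^2 l digits for the samples, where 2 ^ l >= n. *)
Definition digits_factor (H : nat) : nat :=
  4 + 400 * H * (H - 1) * (16 * (400 * H) ^ 2).+1.

Lemma ln_le_log2 (N l : nat) : (0 < N)%N -> (N <= 2 ^ l)%N -> (0 < l)%N ->
  ln (2 * N%:R) <= 2 * l%:R :> R.
Proof.
move=> N0 Nl l0.
have h2 : ln (2 : R) <= 1.
  by have := @le_ln1Dx R 1; rewrite (_ : 1 + 1 = 2) //; apply; lra.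
apply: (@le_trans _ _ (ln (2 ^+ l.+1))).
  rewrite ler_ln ?posrE ?exprn_gt0 ?mulr_gt0 ?ltr0n //.
  by rewrite exprS ler_pM2l ?ltr0n // -natrX ler_nat.
rewrite lnXn // -[_ *+ l.+1]mulr_natr.
have l1 : 1 <= l%:R :> R by rewrite ler1n.
have : ln (2 : R) * l.+1%:R <= 1 * l.+1%:R by rewrite ler_wpM2r.
by rewrite -natr1; lra.
Qed.

Lemma expRN1_bounds : 4^-1 <= (expR 1 : R)^-1 <= 2^-1.
Proof.
have h1 := @expR_ge1Dx R 1; have h2 := @expR_ge1Dx R (- 2^-1).
apply/andP; split.
  rewrite -expRN (_ : -1 = - 2^-1 + - 2^-1) ?expRD; last by lra.
  by nra.
by rewrite lef_pV2 ?posrE ?expR_gt0 //; lra.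
Qed.


Variables (n : nat) (d : 'I_n.+1 -> 'I_n.+1 -> R) (f : {set 'I_n.+1} -> R) (p : nat).
Local Notation N := n.+1.
Hypotheses (dm : is_metric d) (f_ge0 : forall A, 0 <= f A).
Hypotheses (f_mono : set_monotone f) (f_sub : submodular f).

Lemma metric_facts :
  [/\ forall x y, 0 <= d x y, forall x, d x x = 0, forall x y, d x y = d y x
    & forall x y z, d x z <= d x y + d y z].
Proof. by case: dm => h1 h2 h3 h4; split=> // x; apply/h2. Qed.

Lemma divers_subset (A B : {set 'I_N}) : A \subset B -> divers d f A <= divers d f B.
Proof.
have [d0 dxx dsym _] := metric_facts.
move=> AB; rewrite /divers !disp_dcross // lerD ?f_mono //.
by rewrite ler_wpM2r // dcross_subset.
Qed.

(** The dispersion keeps at least [84/100 - 9/100 = 3/4], which is enough since [c >= 1/4]. The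
    f-part loses [2 / h] because [th] is below 1, and less than [1 / h] through [X]. Removing the
    factor [1 + w] costs another [1 / h] if [V <= Z]; otherwise the claim is immediate. *)
Lemma combine_bounds (h c th w V Dh F X Y : R) :
  40 <= h -> 4^-1 <= c <= 2^-1 -> 1 - 2 / h <= th <= 1 -> 0 <= w <= h^-1 / 200 ->
  0 <= Dh -> 0 <= F -> X <= h^-1 / 200 -> Y <= 9 / 100 ->
  th ^+ 2 * Dh + (1 - expR (- th)) * F <= (1 + w) * V + F * X + Dh * Y ->
  c = expR (-1) ->
  (1 - c - 4 / h) * (Dh + F) <= V.
Proof.
move=> h40 /andP[c1 c2] /andP[th1 th2] /andP[w0 w1] D0 F0 hX hY hV cE.
have i0 : 0 < h^-1 by rewrite invr_gt0; lra.
have i1 : h^-1 <= 40^-1 by rewrite lef_pV2 ?posrE //; lra.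
set i := h^-1 in th1 w1 hX i0 i1 *.
have t0 : 0 <= th by lra.
have he : expR (- th) - c <= 2 * i.
  have := @expRN_lipschitz R th 1 t0 ler01.
  rewrite -cE => /ler_normlP[_ h1]; rewrite distrC ger0_norm in h1; lra.
have b1 : (1 - c - 2 * i) * F <= (1 - expR (- th)) * F by apply: ler_wpM2r => //; lra.
have b2 : F * X <= F * (i / 200) by apply: ler_wpM2l.
have b3 : Dh * Y <= Dh * (9 / 100) by apply: ler_wpM2l.
have b4 : (84 / 100) * Dh <= th ^+ 2 * Dh by apply: ler_wpM2r => //; nra.
pose Z := Dh + F.
have key : (1 - c - 3 * i) * Z <= (1 + w) * V.
  rewrite /Z; have : 0 <= i * Dh by rewrite mulr_ge0 // ltW.
  have : 0 <= i * F by rewrite mulr_ge0 // ltW.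
  have : 0 <= (c - 4^-1) * Dh by apply: mulr_ge0; lra.
  lra.
have Z0 : 0 <= Z by rewrite /Z; lra.
have [V0|V0] := leP 0 V; last by have := mulr_ge0 (_ : 0 <= 1 - c - 3 * i) Z0; nra.
have [VZ|ZV] := leP V Z; last first.
  apply: le_trans (ltW ZV); rewrite -/Z ler_piMl //; lra.
have b5 : w * V <= i * Z by apply: ler_pM => //; lra.
rewrite -/Z; lra.
Qed.

(** Read [P = p], [A = 400], [q = p']. Rounds have length about [P / (A h^2)] and [A h (h - 1)] of
    them are made, which leaves between [P / h] and [2 P / h] points. The condition [A h^3 <= P]
    keeps the loss by rounding [L] below [P / h]. *)
Lemma parameter_bounds (A h P L e q : R) : 0 < A ->
  40 <= h -> 0 <= L -> L * (A * h * h) <= P -> P <= (L + 1) * (A * h * h) ->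
  A * h * h * h <= P -> q = A * h * (h - 1) * L -> e = P - q ->
  [/\ 0 < e, e^-1 <= h / P & L / e <= h^-1 / A] /\
  [/\ h / P <= h^-1 ^+ 2 / A, 1 - 2 / h <= q / P <= 1 & q / e <= h].
Proof.
move=> A0 h40 L0 LP PL hP qE eE; have h0 : 0 < h by lra.
have P0 : 0 < P by apply: lt_le_trans hP; rewrite mulr_gt0 // mulr_gt0 // mulr_gt0.
have i0 : 0 < h^-1 by rewrite invr_gt0.
have eh : P <= e * h by rewrite eE qE; nra.
have e0 : 0 < e by rewrite -(pmulr_lgt0 _ h0); exact: lt_le_trans eh.
have q0 : 0 <= q.
  rewrite qE mulr_ge0 // mulr_ge0; [by []|by rewrite mulr_ge0 // ltW|].
  by rewrite subr_ge0; lra.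
have An : A != 0 by rewrite gt_eqF.
have hn : h != 0 by rewrite gt_eqF.
have qP : q <= P by rewrite -subr_ge0 -eE ltW.
split; split => //.
- by rewrite ler_pdivlMr // mulrC ler_pdivrMr // mulrC.
- rewrite ler_pdivrMr //.
  have -> : L = h^-1 / A * (L * (A * h * h) / h) by field; rewrite ?An ?hn.
  by rewrite ler_pM2l ?divr_gt0 // ler_pdivrMr //; exact: le_trans eh.
- rewrite ler_pdivrMr //.
  have {1}-> : h = h^-1 ^+ 2 / A * (A * h * h * h) by field; rewrite ?An ?hn.
  by rewrite ler_pM2l // divr_gt0 // exprn_gt0.
- apply/andP; split; last by rewrite ler_pdivrMr // mul1r.
  rewrite ler_pdivlMr // qE.
  have -> : (1 - 2 / h) * P = P - 2 * (P / h) by ring.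
  have h1 : A * h * h <= P / h by rewrite ler_pdivlMr.
  have h2 : (P - A * h * h) * (1 - h^-1) <= A * h * (h - 1) * L.
    have -> : A * h * (h - 1) * L = (L * (A * h * h)) * (1 - h^-1).
      by field; rewrite ?An ?hn.
    apply: ler_wpM2r; last by lra.
    by rewrite subr_ge0 invf_le1 //; lra.
  have h3 : (P - A * h * h) * (1 - h^-1) = P - P / h - A * h * h + A * h.
    by field; rewrite ?An ?hn.
  have h4 : 0 < A * h by rewrite mulr_gt0.
  lra.
- by rewrite ler_pdivrMr // mulrC; exact: le_trans eh.
Qed.

(** The errors of the f-part are of order [1 / h]. The dispersion error is a constant: the relative
    profile error [1 / (100 h)] accumulates over [q / e <= h] to [8 / 100], and the terms [e^-2] fit
    into the rest. *)
Lemma error_bounds (h P L e q N : R) :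
  40 <= h -> 0 <= L -> 0 <= q -> 0 < P <= N -> 0 < e -> e^-1 <= h / P ->
  L / e <= h^-1 / 400 -> h / P <= h^-1 ^+ 2 / 400 -> q <= P -> q / e <= h ->
  [/\ 0 <= N^-1 + L / e <= h^-1 / 200, q / (N * e) + L / e <= h^-1 / 200 &
   2 * (q * (e^-1 ^+ 2 + 4 * (100 * h)^-1 / e)) <= 9 / 100].
Proof.
move=> h40 L0 q0 /andP[P0 PN] e0 ei Le hP qP qe.
have h0 : 0 < h by lra.
have hi0 : 0 < h^-1 by rewrite invr_gt0.
have hi1 : h^-1 <= 40^-1 by rewrite lef_pV2 ?posrE //; lra.
have hi2 : h^-1 ^+ 2 <= h^-1 * 40^-1 by rewrite expr2 ler_pM2l.
have N0 : 0 < N := lt_le_trans P0 PN.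
have ei0 : 0 < e^-1 by rewrite invr_gt0.
have Ni : N^-1 <= P^-1 by rewrite lef_pV2 ?posrE.
have Pi : P^-1 <= h / P by rewrite ler_peMl ?invr_ge0 ?ltW //; lra.
have Ni0 : 0 < N^-1 by rewrite invr_gt0.
have Le0 : 0 <= L / e by rewrite divr_ge0 // ltW.
split.
- by apply/andP; split; lra.
- have : q / (N * e) <= e^-1.
    rewrite invfM mulrA ler_piMl ?(ltW ei0) // ler_pdivrMr // mul1r.
    exact: le_trans PN.
  lra.
have h1 : q * e^-1 ^+ 2 <= h * (h / P).
  have -> : q * e^-1 ^+ 2 = (q / e) * e^-1 by rewrite expr2 mulrA.
  apply: ler_pM => //; last exact: ltW.
  by rewrite divr_ge0 // ltW.
have h2 : h * (h / P) <= h^-1 / 400.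
  apply: le_trans (ler_wpM2l (ltW h0) hP) _.
  by rewrite (_ : h * _ = h^-1 / 400) //; field; rewrite gt_eqF.
have h3 : q * (4 * (100 * h)^-1 / e) <= 4 / 100.
  have -> : q * (4 * (100 * h)^-1 / e) = (q / e) * (4 / (100 * h)).
    by field; rewrite !gt_eqF.
  have h4 : 0 <= 4 / (100 * h) by rewrite divr_ge0 ?ler0n ?mulr_ge0 ?ler0n ?(ltW h0).
  apply: le_trans (ler_wpM2r h4 qe) _.
  by rewrite (_ : h * _ = 4 / 100) //; field; rewrite gt_eqF.
rewrite [_ * (_ + _)]mulrDr; lra.
Qed.

(** [K] digits suffice in both regimes. For [p < K] the optimum is spelled out; for [K <= p] rounds
    have positive length and all parameters fit into digits. *)
Lemma guess_exists (H l : nat) (O : {set 'I_N}) (eps : R) :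
  (40 <= H)%N -> 4 / H%:R <= eps -> (2 <= p <= N)%N -> #|O| = p ->
  (N <= 2 ^ l)%N -> (0 < l)%N ->
  exists2 x, (x < N ^ (digits_factor H * l))%N &
    (1 - (expR 1)^-1 - eps) * divers d f O
    <= divers d f (candidate d f p (100 * H) x).
Proof.
move=> H40 Heps /andP[p2 pN] cO Nl l0.
have [d0 dxx dsym dtri] := metric_facts.
have div0 A : 0 <= divers d f A.
  by rewrite /divers disp_dcross // addr_ge0 // divr_ge0 // dcross_ge0.
set K := (digits_factor H * l)%N.
have /andP[c1 c2] := expRN1_bounds.
have eps0 : 0 < eps by apply: lt_le_trans Heps; rewrite divr_gt0 ?ltr0n //; nlia.
have [pK|Kp] := ltnP p K.
  have [x xK xE] := @direct_guess R n d f p (100 * H) d0 f_ge0 O K pN pK cO.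
  by exists x => //; rewrite xE ler_piMl //; lra.
(* [1 / G] is the sampling accuracy [eps1] and also bounds the drift [L / e], so that twice their
   sum is at most [4 / G = 1 / (100 H)], the accuracy built into the program. The factor 16 in [B]
   covers [8 * ln (2 N)], as [ln (2 N) <= 2 l]. *)
pose G := (400 * H)%N; pose B := (16 * G ^ 2)%N; pose q := (G * (H - 1))%N.
pose M := (G * H)%N; pose L := (p %/ M)%N; pose k := (B * l)%N; pose p' := (q * L)%N.
have G0 : (0 < G)%N by rewrite /G; nlia.
have M0 : (0 < M)%N by rewrite /M muln_gt0 G0; nlia.
have B0 : (0 < B)%N by rewrite /B muln_gt0 /= expn_gt0 G0.
have qB : (q * B.+1 * l <= K)%N.
  by rewrite /K /digits_factor -/G -/B -/q leq_mul2r leq_addl orbT.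
have q0 : (0 < q)%N by rewrite /q muln_gt0 G0; nlia.
have kK : (4 + q * k.+1 <= K)%N.
  rewrite /K /digits_factor -/G -/B -/q /k mulnDl leq_add //; first by nlia.
  by rewrite -mulnA leq_mul2l; apply/orP; right; rewrite mulSn -add1n leq_add2r.
have kN : (k < N)%N.
  apply: leq_trans pN; apply: leq_trans Kp; apply: leq_trans kK.
  by apply: leq_trans (leq_addl _ _); exact: leq_pmull.
have MHp : (M * H <= p)%N.
  apply: leq_trans Kp; apply: leq_trans qB.
  apply: (@leq_trans (q * B)); last first.
    by rewrite -mulnA leq_mul2l; apply/orP; right; apply: (@leq_trans B.+1) => //; rewrite leq_pmulr.
  have h1 : (H <= 16 * G)%N by rewrite /G; nlia.
  have h2 : (H <= (H - 1) * G)%N by rewrite /G; nnia.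
  rewrite /M /q /B expnS expn1.
  have h3 := leq_mul (leqnn G) (leq_mul h1 h2).
  rewrite -[(G * H * H)%N]mulnA; apply: (leq_trans h3); rewrite eq_leq //.
  by move: (H - 1)%N => H1; ring.
have L0 : (0 < L)%N.
  by rewrite /L divn_gt0 //; apply: leq_trans MHp; rewrite leq_pmulr //; nlia.
have LM : (L * M <= p)%N by exact: leq_divM.
have LM2 : (p < (L.+1) * M)%N by rewrite ltn_ceil.
have p'p : (p' < p)%N.
  apply: leq_trans LM; rewrite /p' mulnC ltn_mul2l L0 /q /M ltn_mul2l G0; nlia.
have LN : (L < N)%N.
  by apply: leq_trans pN; rewrite /L ltn_Pdiv //; rewrite /M /G; nnia.
have a0 : (0 < 100 * H)%N by nlia.
have k0 : (0 < k)%N by rewrite /k muln_gt0 B0.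
pose h : R := H%:R.
have h40 : 40 <= h by rewrite /h (ler_nat R 40).
have h0 : 0 < h by lra.
have c400 : 0 < 400 :> R by rewrite ltr0n.
pose eps1 : R := (400 * h)^-1.
have eps1P : 0 < eps1 <= 1 by rewrite /eps1 invr_gt0 invf_le1; lra.
have GE : G%:R = 400 * h :> R by rewrite /G natrM.
have hk : 8 * ln (2 * N%:R) <= eps1 ^+ 2 * k%:R.
  have := @ln_le_log2 N l (ltn0Sn n) Nl l0.
  have -> : eps1 ^+ 2 * k%:R = 16 * l%:R.
    rewrite /k /B !natrM /eps1 -/h; field.
    by rewrite gt_eqF.
  lra.
pose e : R := (p - p')%:R.
have P0 : 0 < p%:R :> R by rewrite ltr0n; nlia.
have ME : M%:R = 400 * h * h :> R by rewrite /M natrM GE.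
have LMr : L%:R * (400 * h * h) <= p%:R by rewrite -ME -natrM ler_nat.
have LMr2 : p%:R <= (L%:R + 1) * (400 * h * h).
  by rewrite -ME natr1 -natrM ler_nat ltnW.
have qE : q%:R = 400 * h * (h - 1) :> R.
  by rewrite /q natrM GE natrB //; nlia.
have p'E : p'%:R = 400 * h * (h - 1) * L%:R :> R by rewrite /p' natrM qE.
have eE : e = p%:R - p'%:R by rewrite /e natrB // ltnW.
have MHr : 400 * h * h * h <= p%:R by rewrite -ME -natrM ler_nat.
have [[e0 ei Le] [pip thP p'e]] := parameter_bounds c400 h40 (ler0n R L) LMr LMr2 MHr p'E eE.
have heps : 2 * eps1 + 2 * (L%:R / (p - p')%:R) <= (100 * H)%:R^-1.
  rewrite -/e natrM -/h /eps1; move: Le; rewrite !invfM; clear; lra.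
have hg := @greedy_guess R n d f p (100 * H) d0 dxx dsym dtri f_ge0 f_mono f_sub O p' L k
  eps1 pN cO p'p L0 k0 a0 eps1P hk heps q erefl LN kN.
case: hg => x xb [S' S'x hS'].
exists x; first by apply: leq_trans xb _; rewrite leq_pexp2l.
apply: le_trans (divers_subset S'x).
rewrite /divers !disp_dcross //.
set Dh := dcross d O O / 2 in hS' *; set V := _ / 2 + f S' in hS' *.
have Dh0 : 0 <= Dh by rewrite divr_ge0 ?dcross_ge0.
have DhF : 0 <= Dh + f O by rewrite addr_ge0.
have DE : dcross d O O = Dh * 2 by rewrite /Dh divfK ?pnatr_eq0.
apply: (@le_trans _ _ ((1 - (expR 1)^-1 - 4 / h) * (Dh + f O))).
  by apply: ler_wpM2r => //; rewrite lerD2l lerN2.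
rewrite -/e DE -[Dh * 2 * _]mulrA in hS'.
have pp' : p'%:R <= p%:R :> R by rewrite ler_nat ltnW.
have pN' : 0 < (p%:R : R) <= N%:R by rewrite P0 ler_nat.
have [b1 b2 b3] := error_bounds h40 (ler0n R L) (ler0n R p') pN' e0 ei Le pip pp' p'e.
apply: (combine_bounds h40 _ thP b1 Dh0 (f_ge0 O) b2 _ hS').
- by rewrite c1.
- by rewrite natrM.
- by rewrite expRN.
Qed.

End Constants.

(** * A program logic *)

(* Natural cells: the output at 0, the current set at n, scalars from 2n on.
   Real cells: scalars below 16, then two arrays of length n. *)
Definition sA (j : nat) : nexp := NAdd (NAdd NSize NSize) (NConst j).
Definition sC (j : nat) : nexp := NCell (sA j).
Definition cA (e : nexp) : nexp := NAdd NSize e.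
Definition dA (e : nexp) : nexp := NAdd (NConst 16) e.
Definition eA (e : nexp) : nexp := NAdd (NAdd NSize (NConst 16)) e.

(** The memory split into disjoint regions, each indexed from 0, which confines address arithmetic
    to the lemmas about [conc]. *)
Record view (R : Type) := View {
  vo : nat -> nat; vc : nat -> nat; vs : nat -> nat;
  vr : nat -> R; vD : nat -> R; vE : nat -> R }.

Section Views.
Variable R : Type.
Implicit Types (V : view R).
Definition putO V i v := View (upd (vo V) i v) (vc V) (vs V) (vr V) (vD V) (vE V).
Definition putC V i v := View (vo V) (upd (vc V) i v) (vs V) (vr V) (vD V) (vE V).
Definition putS V i v := View (vo V) (vc V) (upd (vs V) i v) (vr V) (vD V) (vE V).
Definition putR V i v := View (vo V) (vc V) (vs V) (upd (vr V) i v) (vD V) (vE V).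
Definition putD V i v := View (vo V) (vc V) (vs V) (vr V) (upd (vD V) i v) (vE V).
Definition putE V i v := View (vo V) (vc V) (vs V) (vr V) (vD V) (upd (vE V) i v).
End Views.

Section Logic.
Variables (R : realType) (n p : nat) (d : 'I_n -> 'I_n -> R) (f : {set 'I_n} -> R).
Implicit Types (V : view R) (Q : view R -> Prop).

Definition conc V (w : seq bool) : state R := State
  (fun a => if (a < n)%N then vo V a else
            if (a < n + n)%N then vc V (a - n) else vs V (a - (n + n)))
  (fun a => if (a < 16)%N then vr V a else
            if (a < 16 + n)%N then vD V (a - 16) else vE V (a - (n + 16)))
  w.

Definition nev V e := neval n p (conc V [::]) e.
Definition rval V e := reval p d (conc V [::]) e.
Definition bev V b := beval p d (conc V [::]) b.

Lemma neval_conc V w e : neval n p (conc V w) e = nev V e.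
Proof. by rewrite /nev; elim: e => //= [e ->|? -> ? ->|? -> ? ->]. Qed.

Lemma reval_conc V w e : reval p d (conc V w) e = rval V e.
Proof.
by rewrite /rval; elim: e => //= [e|e|e e'|? -> ? ->|? -> ? ->|? -> ? ->|? -> ? ->];
  rewrite ?neval_conc.
Qed.

Lemma beval_conc V w b : beval p d (conc V w) b = bev V b.
Proof.
rewrite /bev; elim: b => //= [e e'|e e'|? ->|? -> ? ->] //;
  by rewrite ?neval_conc ?reval_conc.
Qed.

Lemma nev_sC V j : nev V (sC j) = vs V j.
Proof. by rewrite /nev /= !ifF; [congr vs|..]; lia. Qed.

Lemma nev_vc V e : (nev V e < n)%N -> nev V (NCell (cA e)) = vc V (nev V e).
Proof.
rewrite /nev /= => h; rewrite ifF ?ifT; first by congr vc; lia.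
  by lia.
by lia.
Qed.

Lemma rval_vr V j : (j < 16)%N -> rval V (RCell (NConst j)) = vr V j.
Proof. by rewrite /rval /= => ->. Qed.

Lemma rval_vD V e : (nev V e < n)%N -> rval V (RCell (dA e)) = vD V (nev V e).
Proof.
move=> h; have -> : rval V (RCell (dA e)) = rmem (conc V [::]) (16 + nev V e)%N by [].
move: (nev V e) h => a h; rewrite /conc; cbv beta iota delta [rmem].
by case: ifP => [_|h1]; [rewrite addKn|lia].
Qed.

Lemma rval_vE V e : rval V (RCell (eA e)) = vE V (nev V e).
Proof.
have -> : rval V (RCell (eA e)) = rmem (conc V [::]) (n + 16 + nev V e)%N by [].
move: (nev V e) => a; rewrite /conc; cbv beta iota delta [rmem].
do 2!(case: ifP => [h1|_]; first by lia).
by congr vE; lia.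
Qed.

Lemma rval_dist V e e' : rval V (RDist e e') = dist_entry d (nev V e) (nev V e').
Proof. by []. Qed.

Lemma rval_nat V e : rval V (RNat e) = (nev V e)%:R.
Proof. by []. Qed.

(** Total correctness with a time bound, on every tape; the tape is handed back unread. *)
Definition runs (c : com) V (t : nat) Q : Prop := forall w, exists k V',
  [/\ exec p d f c (conc V w) k (conc V' w), (k <= t)%N & Q V'].

Lemma runs_le c V t t' Q : runs c V t' Q -> (t' <= t)%N -> runs c V t Q.
Proof.
move=> h le w; have [k [V' [h1 h2 h3]]] := h w.
by exists k, V'; split => //; exact: leq_trans le.
Qed.

Lemma runs_post c V t Q' Q : runs c V t Q' -> (forall V', Q' V' -> Q V') -> runs c V t Q.
Proof.
move=> h le w; have [k [V' [h1 h2 h3]]] := h w.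
by exists k, V'; split => //; exact: le.
Qed.

Lemma runs_skip V Q : Q V -> runs Skip V 1 Q.
Proof. by move=> h w; exists 1%N, V; split => //; exact: exec_Skip. Qed.

Lemma runs_seq c1 c2 V t1 t2 Q :
  runs c1 V t1 (fun V1 => runs c2 V1 t2 Q) -> runs (Seq c1 c2) V (t1 + t2).+1 Q.
Proof.
move=> h w; have [k1 [V1 [e1 b1 h1]]] := h w; have [k2 [V2 [e2 b2 q2]]] := h1 w.
exists (k1 + k2).+1, V2; split => //; first exact: exec_Seq e1 e2.
by rewrite ltnS leq_add.
Qed.

Lemma runs_if b c1 c2 V t Q :
  (bev V b -> runs c1 V t Q) -> (~~ bev V b -> runs c2 V t Q) ->
  runs (If b c1 c2) V (bcost b + t).+1 Q.
Proof.
move=> h1 h2 w; have [hb|hb] := boolP (bev V b).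
  have [k [V' [e1 e2 e3]]] := h1 hb w; exists (bcost b + k).+1, V'.
  by split; rewrite ?ltnS ?leq_add2l //; apply: exec_IfT; rewrite ?beval_conc.
have [k [V' [e1 e2 e3]]] := h2 hb w; exists (bcost b + k).+1, V'.
by split; rewrite ?ltnS ?leq_add2l //; apply: exec_IfF; rewrite ?beval_conc.
Qed.

Lemma exec_eq c s k s' s'' : exec p d f c s k s' -> s' = s'' -> exec p d f c s k s''.
Proof. by move=> h <-. Qed.

Lemma runs_putS j e V Q : Q (putS V j (nev V e)) -> runs (NSet (sA j) e) V (6 + ncost e) Q.
Proof.
move=> h w; exists (6 + ncost e)%N, (putS V j (nev V e)); split => //.
apply: exec_eq (exec_NSet _ _ _ _ _ _) _.
rewrite !neval_conc (_ : nev V (sA j) = n + n + j)%N // /conc /=; congr State.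
apply/funext => a; rewrite /upd; case: eqP => [->|ha].
  have -> : (n + n + j < n)%N = false by lia.
  have -> : (n + n + j < n + n)%N = false by lia.
  by rewrite addKn eqxx.
case: ifP => // h1; case: ifP => // h2.
by have -> : (a - (n + n) == j)%N = false by lia.
Qed.

Lemma runs_putC a e V Q : (nev V a < n)%N ->
  Q (putC V (nev V a) (nev V e)) -> runs (NSet (cA a) e) V (3 + ncost a + ncost e) Q.
Proof.
move=> ha h w; exists (3 + ncost a + ncost e)%N, (putC V (nev V a) (nev V e)); split => //.
apply: exec_eq (exec_NSet _ _ _ _ _ _) _.
rewrite !neval_conc (_ : nev V (cA a) = n + nev V a)%N // /conc /=; congr State.
apply/funext => x; rewrite /upd.
case: eqP => [->|hx].
  case: ifP => [h1|_]; first by lia.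
  by case: ifP => [_|h1]; [rewrite addKn eqxx|lia].
case: ifP => // h1; case: ifP => // h2; rewrite ifF //; lia.
Qed.

Lemma runs_putO a e V Q : (nev V a < n)%N ->
  Q (putO V (nev V a) (nev V e)) -> runs (NSet a e) V (1 + ncost a + ncost e) Q.
Proof.
move=> ha h w; exists (1 + ncost a + ncost e)%N, (putO V (nev V a) (nev V e)); split => //.
apply: exec_eq (exec_NSet _ _ _ _ _ _) _.
rewrite !neval_conc /conc /=; congr State; apply/funext => x; rewrite /upd.
case: eqP => [->|hx]; first by rewrite ha.
by case: ifP.
Qed.

Lemma runs_putR j e V Q : (j < 16)%N ->
  Q (putR V j (rval V e)) -> runs (RSet (NConst j) e) V (2 + rcost e) Q.
Proof.
move=> hj h w; exists (2 + rcost e)%N, (putR V j (rval V e)); split => //.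
apply: exec_eq (exec_RSet _ _ _ _ _ _) _.
rewrite reval_conc /conc /=; congr State; apply/funext => a; rewrite /upd.
by case: eqP => [->|ha]; [rewrite hj|case: ifP].
Qed.

Lemma runs_putD a e V Q : (nev V a < n)%N ->
  Q (putD V (nev V a) (rval V e)) -> runs (RSet (dA a) e) V (3 + ncost a + rcost e) Q.
Proof.
move=> ha h w; exists (3 + ncost a + rcost e)%N, (putD V (nev V a) (rval V e)); split => //.
apply: exec_eq (exec_RSet _ _ _ _ _ _) _.
rewrite neval_conc reval_conc (_ : nev V (dA a) = 16 + nev V a)%N // /conc /=.
congr State; apply/funext => x; rewrite /upd.
case: eqP => [->|hx].
  have -> : (16 + nev V a < 16)%N = false by lia.
  have -> : (16 + nev V a < 16 + n)%N = true by lia.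
  by rewrite addKn eqxx.
case: ifP => // h1; case: ifP => // h2.
by have -> : (x - 16 == nev V a)%N = false by lia.
Qed.

Lemma runs_putE a e V Q :
  Q (putE V (nev V a) (rval V e)) -> runs (RSet (eA a) e) V (5 + ncost a + rcost e) Q.
Proof.
move=> h w; exists (5 + ncost a + rcost e)%N, (putE V (nev V a) (rval V e)); split => //.
apply: exec_eq (exec_RSet _ _ _ _ _ _) _.
rewrite neval_conc reval_conc (_ : nev V (eA a) = n + 16 + nev V a)%N // /conc /=.
congr State; apply/funext => x; rewrite /upd.
case: eqP => [->|hx].
  have -> : (n + 16 + nev V a < 16)%N = false by lia.
  have -> : (n + 16 + nev V a < 16 + n)%N = false by lia.
  by rewrite addKn eqxx.
case: ifP => // h1; case: ifP => // h2.
by have -> : (x - (n + 16) == nev V a)%N = false by lia.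
Qed.

Lemma runs_query j V Q : (j < 16)%N ->
  Q (putR V j (f (stored_set n (vc V) 0))) -> runs (Query (NConst j) NSize) V 3 Q.
Proof.
move=> hj h w; exists 3%N, (putR V j (f (stored_set n (vc V) 0))); split => //.
apply: exec_eq (exec_Query _ _ _ _ _ _) _.
rewrite /conc /=; congr State; apply/funext => a; rewrite /upd.
case: eqP => [->|ha]; last by case: ifP.
rewrite hj; congr f; apply/setP => i; rewrite !inE.
rewrite ifF ?ifT; first by rewrite addKn.
  by have := ltn_ord i; lia.
by lia.
Qed.

(** The invariant is indexed by completed iterations, whose total is known in advance; the induction
    is on those that are left. *)
Lemma runs_while (I : nat -> view R -> Prop) m b c tc V0 Q :
  I 0%N V0 ->
  (forall i V, (i < m)%N -> I i V -> bev V b /\ runs c V tc (I i.+1)) ->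
  (forall V, I m V -> ~~ bev V b /\ Q V) ->
  runs (While b c) V0 (m * (bcost b + tc).+1 + (bcost b).+1) Q.
Proof.
move=> I0 hb hq w.
suff key j V : (j <= m)%N -> I (m - j)%N V -> exists k V',
    [/\ exec p d f (While b c) (conc V w) k (conc V' w),
     (k <= j * (bcost b + tc).+1 + (bcost b).+1)%N & Q V'].
  by apply: key => //; rewrite subnn.
elim: j V => [|j IH] V hj hI.
  rewrite subn0 in hI; have [nb qV] := hq _ hI.
  exists (bcost b).+1, V; split => //.
  by apply: exec_WhileF; rewrite beval_conc.
have hlt : (m - j.+1 < m)%N by lia.
have [bV hx] := hb _ _ hlt hI.
have [k1 [V1 [e1 b1 h1]]] := hx w.
have hI1 : I (m - j)%N V1 by rewrite (_ : (m - j)%N = (m - j.+1).+1) //; lia.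
have [k2 [V2 [e2 b2 h2]]] := IH _ (ltnW hj) hI1.
exists (bcost b + k1 + k2).+1, V2; split => //.
  by apply: exec_WhileT e1 e2; rewrite beval_conc.
by rewrite mulSn; lia.
Qed.

Definition For (j : nat) (e : nexp) (c : com) : com :=
  Seq (NSet (sA j) (NConst 0))
    (While (BNLe (NAdd (sC j) (NConst 1)) e)
       (Seq c (NSet (sA j) (NAdd (sC j) (NConst 1))))).

Lemma runs_for (I : nat -> view R -> Prop) j e c m tc V0 Q :
  (forall V, nev V e = m) ->
  I 0%N (putS V0 j 0) ->
  (forall i V, (i < m)%N -> vs V j = i -> I i V ->
    runs c V tc (fun V' => vs V' j = i /\ I i.+1 (putS V' j i.+1))) ->
  (forall V, vs V j = m -> I m V -> Q V) ->
  runs (For j e c) V0 (m * (tc + ncost e + 26) + ncost e + 18) Q.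
Proof.
move=> he I0 hb hq; apply: runs_le.
  apply: runs_seq; apply: runs_putS.
  apply: (@runs_while (fun i V => vs V j = i /\ I i V) m _ _ (tc + 15).+1).
  - by split; rewrite /= /upd ?eqxx.
  - move=> i V im [Vj IV]; split.
      have : nev V (sC j) = i by rewrite nev_sC.
      by have := he V; rewrite /bev /nev /= => -> ->; rewrite addn1.
    apply: runs_seq; apply: runs_post (hb i V im Vj IV) _ => V' [V'j IV'].
    apply: (@runs_le _ _ _ (6 + ncost (NAdd (sC j) (NConst 1)))); last by [].
    apply: runs_putS; have -> : nev V' (NAdd (sC j) (NConst 1)) = i.+1.
      have -> : nev V' (NAdd (sC j) (NConst 1)) = (nev V' (sC j) + 1)%N by [].
      by rewrite nev_sC V'j addn1.
    by split => //; rewrite /= /upd eqxx.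
  move=> V [Vj IV]; split; last exact: hq.
  have : nev V (sC j) = m by rewrite nev_sC.
  by have := he V; rewrite /bev /nev /= => -> ->; rewrite addn1 ltnn.
by rewrite /=; nia.
Qed.

Definition Down (j : nat) (c : com) : com :=
  While (BNLe (NConst 1) (sC j)) (Seq c (NSet (sA j) (NSub (sC j) (NConst 1)))).

Lemma runs_down (I : nat -> view R -> Prop) j c m tc V0 Q :
  vs V0 j = m -> I 0%N V0 ->
  (forall i V, (i < m)%N -> vs V j = (m - i)%N -> I i V ->
    runs c V tc (fun V' => vs V' j = (m - i)%N /\ I i.+1 (putS V' j (m - i.+1)))) ->
  (forall V, vs V j = 0%N -> I m V -> Q V) ->
  runs (Down j c) V0 (m * (tc + 26) + 9) Q.
Proof.
move=> V0j I0 hb hq; apply: runs_le.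
  apply: (@runs_while (fun i V => vs V j = (m - i)%N /\ I i V) m _ _ (tc + 15).+1).
  - by split => //; rewrite subn0.
  - move=> i V im [Vj IV]; split.
      have : nev V (sC j) = (m - i)%N by rewrite nev_sC.
      by rewrite /bev /nev /= => ->; lia.
    apply: runs_seq; apply: runs_post (hb i V im Vj IV) _ => V' [V'j IV'].
    apply: (@runs_le _ _ _ (6 + ncost (NSub (sC j) (NConst 1)))); last by [].
    apply: runs_putS; have -> : nev V' (NSub (sC j) (NConst 1)) = (m - i.+1)%N.
      have -> : nev V' (NSub (sC j) (NConst 1)) = (nev V' (sC j) - 1)%N by [].
      by rewrite nev_sC V'j; lia.
    by split => //; rewrite /= /upd eqxx.
  move=> V []; rewrite subnn => Vj IV; split; last exact: hq.
  have : nev V (sC j) = 0%N by rewrite nev_sC.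
  by rewrite /bev /nev /= => ->.
by rewrite /=; nia.
Qed.

End Logic.

(** * The program *)

Notation "c1 ;; c2" := (Seq c1 c2) (at level 90, right associativity).

(* Scalars: 0 main counter, 1 guess stream, 2 quotient, 3 last digit or chosen
   point, 4 loop count, 5 remaining steps r, 6 round length L, 7 sample size k,
   8 steps left in the round, 9 weight z, 10 cardinality, 11 and 12 loop indices,
   13 power of two, 14 number of guesses, 15 product.
   Real scalars: 0 dispersion, 1 best value, 2 value, 3 best diversity. *)
Definition Pop : com :=
  NSet (sA 2) (NConst 0) ;;
  While (BNLe NSize (sC 1))
    (NSet (sA 1) (NSub (sC 1) NSize) ;; NSet (sA 2) (NAdd (sC 2) (NConst 1))) ;;
  NSet (sA 3) (sC 1) ;;
  NSet (sA 1) (sC 2).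

(** The guard makes a repeated digit of the direct part harmless. *)
Definition Add : com :=
  If (BNLe (NCell (cA (sC 3))) (NConst 0))
    (RSet (NConst 0) (RAdd (RCell (NConst 0)) (RCell (dA (sC 3)))) ;;
     NSet (cA (sC 3)) (NConst 1) ;;
     NSet (sA 10) (NAdd (sC 10) (NConst 1)) ;;
     For 11 NSize
       (RSet (dA (sC 11)) (RAdd (RCell (dA (sC 11))) (RDist (sC 3) (sC 11)))))
    Skip.

(** The round counter 0 forces a refresh in the first greedy step, which then sets up the samples
    and the weight. *)
Definition Init : com :=
  For 11 NSize
    (NSet (cA (sC 11)) (NConst 0) ;; RSet (dA (sC 11)) (RNat (NConst 0))) ;;
  RSet (NConst 0) (RNat (NConst 0)) ;;
  NSet (sA 10) (NConst 0) ;;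
  NSet (sA 8) (NConst 0).

Definition Direct : com :=
  Pop ;;
  If (BNLe NCard (sC 3)) (NSet (sA 4) NCard) (NSet (sA 4) (sC 3)) ;;
  Down 4 (Pop ;; Add).

Definition Params : com :=
  Pop ;; NSet (sA 5) (sC 3) ;; Pop ;; NSet (sA 6) (sC 3) ;; Pop ;; NSet (sA 7) (sC 3).

Definition Refresh : com :=
  Pop ;; NSet (sA 9) (sC 3) ;;
  For 11 NSize (RSet (eA (sC 11)) (RNat (NConst 0))) ;;
  NSet (sA 4) (sC 7) ;;
  Down 4
    (Pop ;;
     For 11 NSize
       (RSet (eA (sC 11)) (RAdd (RCell (eA (sC 11))) (RDist (sC 3) (sC 11))))) ;;
  NSet (sA 8) (sC 6).

Definition Value (a : nat) : rexp :=
  RAdd (RAdd (RCell (dA (sC 11)))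
    (RDiv (RMul (RNat (sC 5)) (RMul (RCell (eA (sC 11))) (RNat (NConst a))))
          (RMul (RNat (sC 7)) (RNat (NConst a.+1)))))
    (RDiv (RMul (RNat (sC 9)) (RCell (NConst 2))) (RNat NSize)).

(** The oracle reads its argument from memory, so the tested point is switched on for the query and
    off again. *)
Definition Pick (a : nat) : com :=
  RSet (NConst 1) (RNat (NConst 0)) ;;
  NSet (sA 3) (NConst 0) ;;
  For 11 NSize
    (If (BNLe (NCell (cA (sC 11))) (NConst 0))
       (NSet (cA (sC 11)) (NConst 1) ;;
        Query (NConst 2) NSize ;;
        NSet (cA (sC 11)) (NConst 0) ;;
        RSet (NConst 2) (Value a) ;;
        If (BRLe (RCell (NConst 1)) (RCell (NConst 2)))
          (RSet (NConst 1) (RCell (NConst 2)) ;; NSet (sA 3) (sC 11))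
          Skip)
       Skip).

Definition Step (a : nat) : com :=
  If (BNLe (sC 8) (NConst 0)) Refresh Skip ;;
  NSet (sA 8) (NSub (sC 8) (NConst 1)) ;;
  NSet (sA 5) (NSub (sC 5) (NConst 1)) ;;
  Pick a ;; Add.

Definition Greedy (a : nat) : com :=
  While (BNLe (NAdd (sC 10) (NConst 1)) NCard) (Step a).

(** The comparison is not strict: with initial record 0 and nonnegative diversities, the first
    candidate is always copied to the output. *)
Definition Finish : com :=
  Query (NConst 2) NSize ;;
  RSet (NConst 2) (RAdd (RCell (NConst 0)) (RCell (NConst 2))) ;;
  If (BRLe (RCell (NConst 3)) (RCell (NConst 2)))
    (RSet (NConst 3) (RCell (NConst 2)) ;;
     For 11 NSize (NSet (sC 11) (NCell (cA (sC 11)))))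
    Skip.

(** Computes [N ^ (c * up_log 2 N)] by additions only: scalar 13 doubles until it reaches [N], and
    each doubling multiplies scalar 14 by [N], [c] times. *)
Definition CountGuesses (c : nat) : com :=
  NSet (sA 14) (NConst 1) ;; NSet (sA 13) (NConst 1) ;;
  While (BNLe (NAdd (sC 13) (NConst 1)) NSize)
    (NSet (sA 13) (NAdd (sC 13) (sC 13)) ;;
     For 12 (NConst c)
       (NSet (sA 15) (NConst 0) ;;
        For 11 NSize (NSet (sA 15) (NAdd (sC 15) (sC 14))) ;;
        NSet (sA 14) (sC 15))).

Definition Main (c a : nat) : com :=
  CountGuesses c ;;
  NSet (sA 0) (sC 14) ;;
  Down 0
    (NSet (sA 1) (NSub (sC 0) (NConst 1)) ;;
     Init ;; Direct ;; Params ;; Greedy a ;; Finish).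

(** * Specifications of the parts of the program *)

Section Specs.
Variables (R : realType) (n p a : nat).
Variables (d : 'I_n.+1 -> 'I_n.+1 -> R) (f : {set 'I_n.+1} -> R).
Local Notation N := n.+1.
Hypotheses (dm : is_metric d) (f_ge0 : forall A, 0 <= f A) (pN : (p <= N)%N).
Variable B : nat.
Hypothesis NB : (N <= B)%N.
Implicit Types (V : view R) (S : {set 'I_N}) (Q : view R -> Prop).
Local Notation runs := (@runs R N p d f).
Local Notation nev := (@nev R N p).
Local Notation rval := (@rval R N p d).
Local Notation bev := (@bev R N p d).

Lemma nev_add V e e' : nev V (NAdd e e') = (nev V e + nev V e')%N. Proof. by []. Qed.
Lemma nev_sub V e e' : nev V (NSub e e') = (nev V e - nev V e')%N. Proof. by []. Qed.
Lemma nev_const V j : nev V (NConst j) = j. Proof. by []. Qed.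
Lemma nev_size V : nev V NSize = N. Proof. by []. Qed.
Lemma nev_card V : nev V NCard = p. Proof. by []. Qed.
Definition nevE := (nev_sC, nev_add, nev_sub, nev_const, nev_size, nev_card).
Lemma bev_nle V e e' : bev V (BNLe e e') = (nev V e <= nev V e')%N. Proof. by []. Qed.
Lemma bev_rle V e e' : bev V (BRLe e e') = (rval V e <= rval V e'). Proof. by []. Qed.
Lemma rval_add V e e' : rval V (RAdd e e') = rval V e + rval V e'. Proof. by []. Qed.

Lemma upd_upd (A : Type) (m : nat -> A) i v v' : upd (upd m i v) i v' = upd m i v'.
Proof. by apply/funext => x; rewrite /upd; case: eqP. Qed.

Lemma view_eq V V' : vo V = vo V' -> vc V = vc V' -> vs V = vs V' ->
  vr V = vr V' -> vD V = vD V' -> vE V = vE V' -> V = V'.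
Proof. by case: V => ? ? ? ? ? ?; case: V' => ? ? ? ? ? ? /= -> -> -> -> -> ->. Qed.

Definition popV V : view R :=
  putS (putS (putS V 2 (vs V 1 %/ N)) 3 (vs V 1 %% N)) 1 (vs V 1 %/ N).

Lemma runs_pop V Q : (vs V 1 <= B)%N -> Q (popV V) -> runs Pop V (200 * B) Q.
Proof.
move=> xB hQ; set x := vs V 1 in xB.
have xE := divn_eq x N.
have qB : (x %/ N <= B)%N by apply: leq_trans (leq_div x N) xB.
have B0 : (0 < B)%N by apply: leq_trans NB.
apply: runs_le.
  apply: runs_seq; apply: runs_putS; apply: runs_seq.
  apply: (@runs_while _ _ _ _ _ (fun i V' => V' = putS (putS V 2 i) 1 (x - i * N))
     (x %/ N) _ _ 50).
  - rewrite !nevE mul0n subn0; apply: view_eq => //=; apply/funext => j; rewrite /upd.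
    by case: eqP => [->|] //=; case: eqP => [->|].
  - move=> i V' hi ->; split.
      rewrite bev_nle !nevE /= /upd /=.
      have : (i.+1 * N <= x %/ N * N)%N by rewrite leq_mul2r hi orbT.
      rewrite mulSn; lia.
    apply: runs_le; first apply: runs_seq; first apply: runs_putS; first apply: runs_putS.
      rewrite !nevE /= /upd /=.
      apply: view_eq => //=; apply/funext => j; rewrite /upd.
      case: eqP => [->|] /=; first by rewrite addn1.
      by case: eqP => [_|] //=; rewrite mulSn addnC subnDA.
    by [].
  move=> V' ->; split.
    rewrite bev_nle !nevE /= /upd /=; have := ltn_pmod x (ltn0Sn n); lia.
  apply: runs_seq; apply: runs_putS; apply: runs_putS.
  suff -> : putS (putS (putS (putS V 2 (x %/ N)) 1 (x - x %/ N * N)) 3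
      (nev (putS (putS V 2 (x %/ N)) 1 (x - x %/ N * N)) (sC 1))) 1
      (nev (putS (putS (putS V 2 (x %/ N)) 1 (x - x %/ N * N)) 3
      (nev (putS (putS V 2 (x %/ N)) 1 (x - x %/ N * N)) (sC 1))) (sC 2)) = popV V by [].
  rewrite !nevE /= /upd /=; apply: view_eq => //=; apply/funext => j.
  rewrite /upd -/x; case: eqP => // j1; case: eqP => // j3; lia.
by rewrite /=; move: (x %/ N)%N qB B0 => q; clear; lia.
Qed.


(** The frame condition that protects the best output and its diversity, real scalar 3, while a
    candidate is built. *)
Definition keep (js : seq nat) V V' : Prop :=
  [/\ forall j, j \notin js -> vs V' j = vs V j, vo V' = vo V & vr V' 3 = vr V 3].

Lemma keep_trans js js' V V' V'' :
  keep js V V' -> keep js' V' V'' -> keep (js ++ js') V V''.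
Proof.
move=> [h1 h2 h3] [g1 g2 g3]; split; rewrite ?g2 ?g3 // => j.
by rewrite mem_cat negb_or => /andP[j1 j2]; rewrite g1 // h1.
Qed.

Lemma keep_sub js js' V V' : {subset js <= js'} -> keep js V V' -> keep js' V V'.
Proof.
by move=> sub [h1 h2 h3]; split => // j jn; apply: h1; apply: contra jn; exact: sub.
Qed.

Lemma keep_putS js V V' j v : j \in js -> keep js V V' -> keep js V (putS V' j v).
Proof.
move=> jj [h1 h2 h3]; split => //= i ijs; rewrite /upd; case: eqP => [ij|_]; last exact: h1.
by rewrite ij jj in ijs.
Qed.

Lemma keep_refl js V : keep js V V. Proof. by split. Qed.

Lemma keep_pop V : keep [:: 1; 2; 3]%N V (popV V).
Proof. by do 3!(apply: keep_putS => //); exact: keep_refl. Qed.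

Record rep V S : Prop := Rep {
  rep_set : stored_set N (vc V) 0 = S;
  rep_D : forall u : 'I_N, vD V u = dsum d S u;
  rep_A : vr V 0 = disp d S;
  rep_card : vs V 10 = #|S| }.

Lemma rep_eq V V' S : vc V' = vc V -> vD V' = vD V -> vr V' 0 = vr V 0 ->
  vs V' 10 = vs V 10 -> rep V S -> rep V' S.
Proof. by move=> h1 h2 h3 h4 [g1 g2 g3 g4]; split; rewrite ?h1 ?h2 ?h3 ?h4. Qed.

Lemma rep_pop V S : rep V S -> rep (popV V) S.
Proof. exact: rep_eq. Qed.

Lemma rep_in V S (v : 'I_N) : rep V S -> (vc V v <= 0)%N = (v \notin S).
Proof. by move=> [<- _ _ _]; rewrite inE add0n negbK leqn0. Qed.

Lemma dist_entry_ord (u v : 'I_N) : dist_entry d u v = d u v.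
Proof. by rewrite /dist_entry !valK. Qed.

Lemma disp_add S v : v \notin S -> disp d (v |: S) = disp d S + dsum d S v.
Proof.
have [d0 dxx dsym _] := metric_facts dm => vS.
rewrite !disp_dcross // dcrossU1 // mulrDl; congr (_ + _).
by rewrite mulrC mulKf // pnatr_eq0.
Qed.

Lemma runs_add V S (v : 'I_N) Q : rep V S -> vs V 3 = v ->
  (forall V', rep V' (v |: S) -> keep [:: 10; 11]%N V V' -> vE V' = vE V -> Q V') ->
  runs Add V (300 * B) Q.
Proof.
move=> hr v3 hQ.
have B0 : (0 < B)%N by apply: leq_trans NB.
have n3 W : vs W 3 = v -> nev W (sC 3) = v by rewrite nev_sC.
apply: runs_le.
  apply: runs_if; rewrite bev_nle nev_vc nev_sC v3 // (rep_in v hr) => vS; last first.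
    apply: (@runs_le _ _ _ _ _ _ _ (70 * N + 120)); last exact: leqnn.
    apply: runs_le; first apply: runs_skip.
      apply: hQ => //.
      rewrite (_ : v |: S = S) //; apply/finset.setUidPr; rewrite finset.sub1set.
      by rewrite negbK in vS.
    by lia.
  apply: runs_le.
    apply: runs_seq; apply: runs_putR => //; apply: runs_seq; apply: runs_putC.
      by rewrite n3.
    apply: runs_seq; apply: runs_putS.
    set V1 := putS _ _ _.
    apply: (@runs_for _ _ _ _ _ (fun i W => [/\ vc W = vc V1, vo W = vo V1,
       vr W = vr V1, vE W = vE V1 & forall j, j != 11%N -> vs W j = vs V1 j] /\
       forall u : 'I_N, vD W u = if (u < i)%N then vD V u + d v u else vD V u)
       _ _ _ N 40) => //.
    - by split => //; split => //= j; rewrite /upd => /negbTE ->.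
    - move=> i W iN Wi [[w1 w2 w3 w4 w5] w6].
      have W3 : vs W 3 = v by rewrite w5 // /V1 /= /upd /=.
      apply: runs_le; first apply: runs_putD.
      + by rewrite nev_sC Wi.
      + rewrite rval_add rval_vD ?nev_sC ?Wi // rval_dist !nev_sC Wi W3.
        split => //=; split.
          by split => //= j j11; rewrite /upd (negbTE j11) w5.
        move=> u; rewrite /upd; have [ui|ui] := eqVneq (u : nat) i.
          rewrite ui ltnSn; have := w6 u; rewrite ui ltnn => ->.
          by rewrite -ui dist_entry_ord.
        by rewrite w6 ltnS [in RHS]leq_eqVlt (negbTE ui).
      + by [].
    move=> W WN [[w1 w2 w3 w4 w5] w6]; apply: hQ => //.
    - split.
      + rewrite w1 /V1 /= !n3 //; apply/setP => u; rewrite !inE add0n /upd.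
        have [uv|uv] := eqVneq u v; first by rewrite uv eqxx.
        have -> : (u == v :> nat) = false by apply/negbTE.
        by rewrite /= -(rep_set hr) inE add0n.
      + move=> u; rewrite w6 ltn_ord (rep_D hr) dsumU1 // addrC //.
      + rewrite w3 /V1 /= /upd /= rval_add rval_vr // rval_vD ?nev_sC ?v3 //.
        by rewrite (rep_A hr) (rep_D hr) disp_add.
      + by rewrite w5 // /V1 /= /upd /= !nevE /= (rep_card hr) cardsU1 vS addn1.
    - split; rewrite ?w2 ?w3 //= => j; rewrite !inE negb_or => /andP[j10 j11].
      by rewrite w5 //= /upd (negbTE j10).
  by rewrite /=; lia.
by rewrite /=; lia.
Qed.


Lemma runs_init V Q :
  (forall V', rep V' finset.set0 -> vs V' 8 = 0%N -> keep [:: 8; 10; 11]%N V V' -> Q V') ->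
  runs Init V (200 * B) Q.
Proof.
move=> hQ; have B0 : (0 < B)%N by apply: leq_trans NB.
apply: runs_le.
  apply: runs_seq.
  apply: (@runs_for _ _ _ _ _ (fun i W => [/\ vo W = vo V, vr W = vr V &
       forall j, j != 11%N -> vs W j = vs V j] /\
       forall u : 'I_N, (u < i)%N -> vc W u = 0%N /\ vD W u = 0)
       _ _ _ N 40) => //.
  - by split => //; split => //= j; rewrite /upd => /negbTE ->.
  - move=> i W iN Wi [[w1 w2 w3] w4].
    apply: runs_le; first apply: runs_seq; first apply: runs_putC.
    + by rewrite nev_sC Wi.
    + apply: runs_putD; first by rewrite !nevE /= Wi.
      rewrite !nevE rval_nat nev_const /= Wi; split => //; split; first split => //=.
        by move=> j j11; rewrite /upd (negbTE j11) w3.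
      move=> u ui /=; rewrite /upd; case: eqP => // /eqP ui'.
      by apply: w4; rewrite ltnS leq_eqVlt (negbTE ui') in ui.
    by [].
  move=> W WN [[w1 w2 w3] w4].
  apply: runs_seq; apply: runs_putR => //; apply: runs_seq; apply: runs_putS; apply: runs_putS.
  rewrite !nevE rval_nat nev_const; apply: hQ => //=.
  - split => /=.
    + by apply/setP => u; rewrite !inE add0n (w4 u _).1.
    + by move=> u; rewrite (w4 u _).2 // /dsum big_set0.
    + by rewrite /upd /= /disp big_set0.
    + by rewrite /upd /= cards0.
  - split => //=; last by rewrite /upd /= w2.
    move=> j; rewrite !inE !negb_or => /and3P[j8 j10 j11].
    by rewrite /upd (negbTE j8) (negbTE j10) w3.
by rewrite /=; lia.
Qed.

Lemma direct_le b S x : ((direct (n := n) b S x).2 <= x)%N.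
Proof.
by elim: b S x => //= b IH S x; apply: leq_trans (IH _ _) (leq_div _ _).
Qed.

Lemma sample_sum_le k E x : ((sample_sum d k E x).2 <= x)%N.
Proof.
by elim: k E x => //= k IH E x; apply: leq_trans (IH _ _) (leq_div _ _).
Qed.

Lemma digit_val x : digit n x = (x %% N)%N :> nat.
Proof. by rewrite /digit inordK // ltn_pmod. Qed.

Lemma runs_direct V Q : rep V finset.set0 -> (vs V 1 <= B)%N ->
  (forall V', rep V' (direct_start n p (vs V 1)).1 ->
    vs V' 1 = (direct_start n p (vs V 1)).2 ->
    keep [:: 1; 2; 3; 4; 10; 11]%N V V' -> Q V') ->
  runs Direct V (1000 * (B * B)) Q.
Proof.
move=> hr xB hQ; set x := vs V 1 in xB hQ.
have B0 : (0 < B)%N by apply: leq_trans NB.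
set m := minn (x %% N) p.
have mB : (m <= B)%N by apply: leq_trans (geq_minr _ _) (leq_trans pN NB).
have [F FE] : exists F, F = direct_start n p x by exists (direct_start n p x).
apply: runs_le.
  apply: runs_seq; apply: runs_pop => //; apply: runs_seq.
  set V1 := popV V.
  have k1 : keep [:: 1; 2; 3]%N V V1 by exact: keep_pop.
  have r1 : rep V1 finset.set0 by exact: rep_pop.
  (* The invariant fixes the final result: [direct], continued from the current set and stream,
     still yields [F]. *)
  have tail : runs (Down 4 (Pop ;; Add)) (putS V1 4 m) (m * (501 * B + 26) + 9) Q.
    apply: (@runs_down _ _ _ _ _ (fun i W => exists S y, [/\ rep W S, vs W 1 = y,
       (y <= B)%N, direct (m - i) S y = F & keep [:: 1; 2; 3; 4; 10; 11]%N V W])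
       4 _ m) => //.
    - exists finset.set0, (x %/ N)%N; split => //.
      + exact: rep_eq r1.
      + by apply: leq_trans (leq_div _ _) xB.
      + by rewrite subn0 FE.
      + apply: keep_putS => //; apply: keep_sub k1 => j.
        by rewrite !inE => /or3P[]/eqP->.
    - move=> i W im W4 [S [y [w1 w2 w3 w4 w5]]].
      apply: runs_le; first apply: runs_seq; first apply: runs_pop; first by rewrite w2.
        apply: (@runs_add _ S (digit n y)) => //; first exact: rep_pop.
          by rewrite digit_val /= /upd /= w2.
        move=> W' w1' w2' w3'.
        have [ww1 ww2 ww3] := w2'.
        split; first by rewrite ww1.
        exists (digit n y |: S), (y %/ N)%N; split.
        + exact: rep_eq w1'.
        + by rewrite /= /upd /= ww1 //= /upd /= w2.
        + by apply: leq_trans (leq_div _ _) w3.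
        + move: w4; rewrite (_ : (m - i)%N = (m - i.+1).+1) //; lia.
        + apply: keep_putS => //; apply: keep_sub (keep_trans (keep_trans w5 (keep_pop W)) w2').
          by move=> j; rewrite !inE; lia.
      by lia.
    move=> W W4 [S [y [w1 w2 w3 w4 w5]]]; rewrite subnn /= in w4.
    by apply: hQ => //; rewrite -FE -w4.
  apply: (@runs_post _ _ _ _ _ _ _ _ (fun W => W = putS V1 4 m)); last first.
    by move=> W ->; exact: tail.
  apply: (@runs_if _ _ _ _ _ _ _ _ _ 20); rewrite bev_nle !nevE /= /upd /= -/x => hb.
    apply: runs_le; first apply: runs_putS.
      by rewrite nevE /m (minn_idPr _).
    by [].
  apply: runs_le; first apply: runs_putS.
    by rewrite nevE /= /upd /= -/x /m (minn_idPl _) // ltnW // ltnNge.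
  by [].
rewrite /=; nia.
Qed.

Lemma runs_params V Q : (vs V 1 <= B)%N ->
  (forall V', vs V' 5 = (vs V 1 %% N)%N -> vs V' 6 = (vs V 1 %/ N %% N)%N ->
    vs V' 7 = (vs V 1 %/ N %/ N %% N)%N -> vs V' 1 = (vs V 1 %/ N %/ N %/ N)%N ->
    (forall S, rep V S -> rep V' S) ->
    keep [:: 1; 2; 3; 5; 6; 7]%N V V' -> Q V') ->
  runs Params V (800 * B) Q.
Proof.
move=> xB hQ; set x := vs V 1 in xB hQ.
have B0 : (0 < B)%N by apply: leq_trans NB.
have x2 : (x %/ N <= B)%N by apply: leq_trans (leq_div _ _) xB.
have x3 : (x %/ N %/ N <= B)%N by apply: leq_trans (leq_div _ _) x2.
apply: runs_le.
  apply: runs_seq; apply: runs_pop => //; apply: runs_seq; apply: runs_putS.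
  apply: runs_seq; apply: runs_pop => //; apply: runs_seq; apply: runs_putS.
  apply: runs_seq; apply: runs_pop => //; apply: runs_putS.
  rewrite !nevE /popV /= /upd /= -/x; apply: hQ => //=.
    by move=> S; exact: rep_eq.
  do ?[apply: keep_putS => //]; exact: keep_refl.
by rewrite /=; lia.
Qed.


Lemma runs_refresh V S Q : rep V S -> (vs V 1 <= B)%N -> (vs V 7 <= B)%N ->
  let s := sample_sum d (vs V 7) (fun=> 0) (vs V 1 %/ N) in
  (forall V', rep V' S -> (forall u : 'I_N, vE V' u = s.1 u) -> vs V' 1 = s.2 ->
    vs V' 9 = (vs V 1 %% N)%N -> vs V' 8 = vs V 6 ->
    keep [:: 1; 2; 3; 4; 8; 9; 11]%N V V' -> Q V') ->
  runs Refresh V (1000 * (B * B)) Q.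
Proof.
move=> hr xB kB s hQ; set x := vs V 1 in xB s hQ; set k := vs V 7 in kB s hQ.
have B0 : (0 < B)%N by apply: leq_trans NB.
have x2 : (x %/ N <= B)%N by apply: leq_trans (leq_div _ _) xB.
apply: runs_le.
  apply: runs_seq; apply: runs_pop => //; apply: runs_seq; apply: runs_putS; apply: runs_seq.
  set V1 := putS _ _ _.
  have k1 : keep [:: 1; 2; 3; 9]%N V V1.
    by apply: keep_putS => //; apply: keep_sub (keep_pop V) => j; rewrite !inE; lia.
  have r1 : rep V1 S by exact: rep_eq hr.
  have v9 : vs V1 9 = (x %% N)%N by rewrite /V1 nevE.
  apply: (@runs_for _ _ _ _ _ (fun i W => [/\ rep W S, vs W 1 = (x %/ N)%N,
       vs W 9 = (x %% N)%N & keep [:: 1; 2; 3; 9; 11]%N V W] /\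
       forall u : 'I_N, (u < i)%N -> vE W u = 0) _ _ _ N 30) => //.
  - split => //; split => //; first exact: rep_eq r1.
    by apply: keep_putS => //; apply: keep_sub k1 => j; rewrite !inE; lia.
  - move=> i W iN Wi [[w1 w2 w3 w4] w5].
    apply: runs_le; first apply: runs_putE.
      rewrite rval_nat nev_const nev_sC Wi /=; split => //; split; first split => //.
      + exact: rep_eq w1.
      + apply: keep_putS => //.
      + move=> u ui /=; rewrite /upd; case: eqP => // /eqP ui'.
        by apply: w5; rewrite ltnS leq_eqVlt (negbTE ui') in ui.
    by [].
  move=> W WN [[w1 w2 w3 w4] w5].
  have [kw1 kw2 kw3] := w4.
  apply: runs_seq; apply: runs_putS; rewrite nev_sC kw1 // -/k.
  apply: runs_seq.
  apply: (@runs_down _ _ _ _ _ (fun i W => exists E y, [/\ rep W S, vs W 1 = y,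
       (y <= B)%N, vs W 9 = (x %% N)%N & forall u : 'I_N, vE W u = E u] /\
       (sample_sum d (k - i) E y = s /\ keep [:: 1; 2; 3; 4; 9; 11]%N V W))
       4 _ k (300 * B)) => //.
  - exists (fun=> 0), (x %/ N)%N; split; first split => //.
    + exact: rep_eq w1.
    + by move=> u; rewrite w5.
    + split; first by rewrite subn0.
      by apply: keep_putS => //; apply: keep_sub w4 => j; rewrite !inE; lia.
  - move=> {W WN w1 w2 w3 w4 w5 kw1 kw2 kw3} i W im W4 [E [y [[w1 w2 w3 w4 w5] [w6 w7]]]].
    apply: runs_le.
      apply: runs_seq; apply: runs_pop; first by rewrite w2.
      apply: (@runs_for _ _ _ _ _ (fun j W' => [/\ rep W' S, vs W' 1 = (y %/ N)%N,
         vs W' 9 = (x %% N)%N, vs W' 3 = (y %% N)%N & vs W' 4 = (k - i)%N] /\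
        (keep [:: 1; 2; 3; 4; 9; 11]%N V W' /\ forall u : 'I_N,
         vE W' u = if (u < j)%N then E u + d (digit n y) u else E u)) _ _ _ N 40) => //.
      + split; first split => //=; rewrite /upd /= ?w2 //.
          exact: rep_eq w1.
        split => //=; apply: keep_putS => //.
        apply: keep_sub (keep_trans w7 (keep_pop W)) => j; rewrite !inE; lia.
      + move=> j W' jN Wj [[y1 y2 y3 y4 y5] [y6 y7]].
        apply: runs_le; first apply: runs_putE.
          rewrite rval_add rval_vE rval_dist !nev_sC Wj y4 /=; split => //.
          split; first split => //=.
            exact: rep_eq y1.
          split; first by apply: keep_putS => //; case: y6.
          move=> u /=; rewrite /upd; have [uj|uj] := eqVneq (u : nat) j.
            rewrite uj ltnSn; have := y7 u; rewrite uj ltnn => ->.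
            by rewrite -uj -digit_val dist_entry_ord.
          by rewrite y7 ltnS [in RHS]leq_eqVlt (negbTE uj).
        by [].
      move=> W' WN' [[y1 y2 y3 y4 y5] [y6 y7]]; split => //.
      exists (fun u => E u + d (digit n y) u), (y %/ N)%N; split; first split => //=.
      + exact: rep_eq y1.
      + by apply: leq_trans (leq_div _ _) w3.
      + by move=> u; rewrite y7 ltn_ord.
      + split; last exact: keep_putS.
        by move: w6; rewrite (_ : (k - i)%N = (k - i.+1).+1) //; lia.
    by rewrite /=; lia.
  move=> {WN w1 w2 w3 w4 w5 kw1 kw2 kw3} {}W W4 [E [y [[w1 w2 w3 w4 w5] [w6 w7]]]].
  rewrite subnn /= in w6; rewrite -w6 in hQ.
  have [kk1 kk2 kk3] := w7.
  apply: runs_putS; rewrite nev_sC kk1 //; apply: hQ => //.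
  + exact: rep_eq w1.
  + by apply: keep_putS => //; apply: keep_sub w7 => j; rewrite !inE; lia.
rewrite /=; nia.
Qed.

Lemma runs_pick V S E Q : rep V S -> (forall u : 'I_N, vE V u = E u) ->
  (forall V', rep V' S -> vs V' 3 = greedy_pick d f a S (vs V 5) (vs V 7) (vs V 9) E ->
    vE V' = vE V -> keep [:: 3; 11]%N V V' -> Q V') ->
  runs (Pick a) V (300 * B) Q.
Proof.
move=> hr hE hQ; set r := vs V 5 in hQ; set k := vs V 7 in hQ; set z := vs V 9 in hQ.
have B0 : (0 < B)%N by apply: leq_trans NB.
set val := greedy_value d f a S r k z E.
apply: runs_le.
  apply: runs_seq; apply: runs_putR => //; apply: runs_seq; apply: runs_putS.
  apply: (@runs_for _ _ _ _ _ (fun i W => [/\ vc W = vc V, vD W = vD V, vE W = vE V,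
       vr W 0 = vr V 0 & keep [:: 3; 11]%N V W] /\
       (vs W 3 = (pick_max S val i).1 /\ vr W 1 = (pick_max S val i).2)) _ _ _ N 200) => //.
  - split; first by split => //; do 2!(apply: keep_putS => //).
    by rewrite rval_nat !nev_const.
  - move=> i W iN Wi [[w1 w2 w3 w4 w5] [w6 w7]].
    have [k1 k2 k3] := w5.
    pose u : 'I_N := inord i.
    have uE : u = i :> nat by rewrite /u inordK.
    have rW : rep W S by apply: rep_eq hr => //; rewrite k1.
    apply: (@runs_le _ _ _ _ _ _ _ _ (bcost (BNLe (NCell (cA (sC 11))) (NConst 0)) + 180).+1);
      last by [].
    apply: runs_if; rewrite bev_nle nev_vc nev_sC Wi //;
      rewrite nev_const -uE (rep_in u rW) uE => uS; last first.
      apply: runs_le; first apply: runs_skip; last by [].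
      split => //; split; first split => //.
        by apply: keep_putS.
      by rewrite /= -/u (negbTE uS) /=.
    apply: runs_le.
      apply: runs_seq; apply: runs_putC; first by rewrite nev_sC Wi.
      apply: runs_seq; apply: runs_query => //.
      apply: runs_seq; apply: runs_putC; first by rewrite nev_sC /= Wi.
      apply: runs_seq; apply: runs_putR => //.
      rewrite !nev_sC !nev_const.
      set W1 := putC (putR _ _ _) _ _.
      (* The bit of [u] was 0 before the query, so resetting it restores the whole array. *)
      have vcW1 : vc W1 = vc V.
        rewrite /W1 /= Wi upd_upd w1; apply/funext => j; rewrite /upd; case: eqP => // ->.
        by have := rep_in u hr; rewrite uS uE leqn0 => /eqP ->.
      have stE : stored_set N (upd (vc W) (vs W 11) 1) 0 = u |: S.
        apply/setP => v; rewrite !inE add0n /upd Wi -uE.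
        have [vu|vu] := eqVneq v u; first by rewrite vu eqxx.
        have -> : (v == u :> nat) = false by apply/negbTE.
        by rewrite /= -(rep_set rW) inE add0n.
      have valE : rval W1 (Value a) = val u.
        rewrite /Value.
        have -> : rval W1 (RAdd (RAdd (RCell (dA (sC 11)))
          (RDiv (RMul (RNat (sC 5)) (RMul (RCell (eA (sC 11))) (RNat (NConst a))))
          (RMul (RNat (sC 7)) (RNat (NConst a.+1)))))
          (RDiv (RMul (RNat (sC 9)) (RCell (NConst 2))) (RNat NSize)))
         = rval W1 (RCell (dA (sC 11)))
         + ((nev W1 (sC 5))%:R * (rval W1 (RCell (eA (sC 11))) * a%:R))
           / ((nev W1 (sC 7))%:R * a.+1%:R)
         + (nev W1 (sC 9))%:R * rval W1 (RCell (NConst 2)) / N%:R by [].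
        rewrite rval_vD ?nev_sC /= ?Wi // rval_vE !nev_sC rval_vr //= Wi.
        rewrite !k1 // w2 w3 -uE (rep_D hr) hE /upd /= -/r -/k -/z.
        by rewrite Wi -uE /upd in stE; rewrite stE.
      rewrite valE.
      apply: (@runs_if _ _ _ _ _ _ _ _ _ 60); rewrite bev_rle !rval_vr //= /upd /= w7 => hb.
        apply: runs_le; first apply: runs_seq; first apply: runs_putR => //; first apply: runs_putS.
          rewrite !nev_sC rval_vr //= /upd /=; split => //.
          split; first split => //=.
          * split => //=.
            move=> j; rewrite !inE negb_or => /andP[j3 j11].
            by rewrite /upd (negbTE j3) (negbTE j11) k1 // !inE negb_or j3.
          * by rewrite -/u uS hb /upd /= Wi uE.
        by [].
      apply: runs_le; first apply: runs_skip; last by [].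
      split => //; split; first split => //=.
        split => //=.
        move=> j; rewrite !inE negb_or => /andP[j3 j11].
        by rewrite /upd (negbTE j11) k1 // !inE negb_or j3.
      by rewrite -/u uS (negbTE hb) /upd /=.
    by [].
  move=> W WN [[w1 w2 w3 w4 w5] [w6 w7]]; apply: hQ => //.
  by apply: rep_eq hr => //; have [k1 _ _] := w5; rewrite k1.
by rewrite /=; lia.
Qed.


(** When the round counter is 0 the next step refreshes, so the samples and the weight are related
    to the state only inside a round. *)
Record greedy_rep V (st : gstate R n) : Prop := GreedyRep {
  greedy_rep_rep : rep V (gS st);
  greedy_rep_x : vs V 1 = gx st;
  greedy_rep_r : vs V 5 = gr st;
  greedy_rep_lc : vs V 8 = glc st;
  greedy_rep_E : glc st != 0%N -> (forall u : 'I_N, vE V u = gE st u) /\ vs V 9 = gz st }.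

Definition step_cells : seq nat := [:: 1; 2; 3; 4; 5; 8; 9; 10; 11]%N.

Lemma runs_step V st Q : greedy_rep V st -> (gx st <= B)%N -> (vs V 7 <= B)%N ->
  (forall V', greedy_rep V' (gstep d f a (vs V 6) (vs V 7) st) -> keep step_cells V V' -> Q V') ->
  runs (Step a) V (3000 * (B * B)) Q.
Proof.
move=> hg xB kB hQ; have B0 : (0 < B)%N by apply: leq_trans NB.
apply: runs_le.
  apply: runs_seq.
  apply: (@runs_post _ _ _ _ _ _ _ _ (fun W => exists st1,
     [/\ st1 = (if glc st == 0%N then refresh d (vs V 6) (vs V 7) st else st),
      rep W (gS st1), vs W 1 = gx st1, vs W 5 = gr st1 & vs W 8 = glc st1] /\
     [/\ forall u : 'I_N, vE W u = gE st1 u, vs W 9 = gz st1 &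
      keep [:: 1; 2; 3; 4; 8; 9; 11]%N V W])).
    apply: (@runs_if _ _ _ _ _ _ _ _ _ (1000 * (B * B))); rewrite bev_nle !nevE => hb.
      apply: (@runs_refresh _ (gS st)); rewrite ?(greedy_rep_x hg) //; first by case: hg.
      move=> W w1 w2 w3 w4 w5 w6; exists (refresh d (vs V 6) (vs V 7) st).
      rewrite (greedy_rep_lc hg) leqn0 in hb; rewrite hb; split; split => //=.
      by have [-> //] := w6; case: hg.
    apply: runs_le; first apply: runs_skip; last by nia.
    rewrite (greedy_rep_lc hg) leqn0 in hb; rewrite (negbTE hb); exists st.
    have [e1 e2] := greedy_rep_E hg hb.
    by case: hg => g1 g2 g3 g4 _; split; split.
  move=> W [st1 [[s1 w1 w2 w3 w4] [w5 w6 w7]]].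
  apply: runs_seq; apply: runs_putS; apply: runs_seq; apply: runs_putS.
  rewrite !nevE /= /upd /= w4 w3.
  apply: runs_seq; apply: (@runs_pick _ (gS st1) (gE st1)) => //; first exact: rep_eq w1.
  move=> W1; rewrite /= /upd /= => p1 p2 p3 p4.
  have [k1 k2 k3] := w7.
  rewrite w6 k1 // in p2.
  apply: (runs_add p1 p2) => W2 a1 a2 a3.
  have [kk1 kk2 kk3] := keep_trans p4 a2.
  have stepE : gstep d f a (vs V 6) (vs V 7) st = select d f a (vs V 7) st1.
    by rewrite /gstep -s1.
  apply: hQ; rewrite ?stepE.
  - split => /=.
    + by rewrite -subn1.
    + by rewrite kk1 //= /upd /= w2.
    + by rewrite kk1 //= /upd /= subn1.
    + by rewrite kk1 //= /upd /= subn1.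
    + by move=> _; split; [move=> u; rewrite a3 p3 /= w5 | rewrite kk1 //= /upd /= w6].
  - split => //=; rewrite ?kk2 ?kk3 //= => j jn.
    have jE : j \notin ([:: 3; 11] ++ [:: 10; 11])%N.
      by apply: contra jn; rewrite /step_cells !inE; lia.
    rewrite kk1 //= /upd.
    have -> : (j == 5)%N = false by apply/negbTE; apply: contra jn => /eqP ->.
    have -> : (j == 8)%N = false by apply/negbTE; apply: contra jn => /eqP ->.
    by rewrite k1 //; apply: contra jn; rewrite /step_cells !inE; lia.
rewrite /=; nia.
Qed.

Lemma gx_gstep L k st : (gx (gstep d f a L k st) <= gx st)%N.
Proof.
rewrite /gstep; case: ifP => _ //=.
by apply: leq_trans (sample_sum_le _ _ _) (leq_div _ _).
Qed.

Lemma runs_greedy V st Q : greedy_rep V st -> gvalid st -> (#|gS st| <= p)%N ->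
  (gx st <= B)%N -> (vs V 7 <= B)%N ->
  (forall V', rep V' (gS (iter (p - #|gS st|) (gstep d f a (vs V 6) (vs V 7)) st)) ->
    keep step_cells V V' -> Q V') ->
  runs (Greedy a) V (4000 * (B * (B * B))) Q.
Proof.
move=> hg hv cS xB kB hQ; have B0 : (0 < B)%N by apply: leq_trans NB.
have [d0 dxx dsym _] := metric_facts dm.
set m := (p - #|gS st|)%N in hQ.
have mB : (m <= B)%N by rewrite /m; lia.
apply: runs_le.
  apply: (@runs_while _ _ _ _ _ (fun i W =>
    let st' := iter i (gstep d f a (vs V 6) (vs V 7)) st in
    [/\ greedy_rep W st', (gx st' <= B)%N & keep step_cells V W]) m _ _ (3000 * (B * B))).
  - by split => //; exact: keep_refl.
  - move=> i W im [w1 w2 w3]; have [k1 k2 k3] := w3.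
    have hc : (#|gS st| + i <= N)%N by move: im; rewrite /m; lia.
    have [_ cE _] := iter_gstep_card a d0 f_ge0 (vs V 6) (vs V 7) hv hc.
    split; first by rewrite bev_nle !nevE (rep_card (greedy_rep_rep w1)) cE; move: im; rewrite /m; lia.
    apply: (runs_step w1 w2); first by rewrite k1.
    rewrite (k1 6) // (k1 7) // => W' g1 g2; split => //.
      by rewrite iterS; apply: leq_trans (gx_gstep _ _ _) w2.
    by apply: keep_sub (keep_trans w3 g2) => j; rewrite mem_cat orbb.
  - move=> W [w1 w2 w3]; split; last by apply: hQ => //; case: w1.
    have hc : (#|gS st| + m <= N)%N by rewrite /m; lia.
    have [_ cE _] := iter_gstep_card a d0 f_ge0 (vs V 6) (vs V 7) hv hc.
    by rewrite bev_nle !nevE (rep_card (greedy_rep_rep w1)) cE /m; lia.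
rewrite /=.
have : (m * (3000 * (B * B) + 20) <= B * (3000 * (B * B) + 20))%N by rewrite leq_mul2r mB orbT.
by nia.
Qed.

Lemma runs_finish V S Q : rep V S ->
  (forall V', (forall j, j != 11%N -> vs V' j = vs V j) ->
    (vr V 3 <= divers d f S /\ stored_set N (vo V') 0 = S /\ vr V' 3 = divers d f S) \/
    (divers d f S < vr V 3 /\ vo V' = vo V /\ vr V' 3 = vr V 3) -> Q V') ->
  runs Finish V (300 * B) Q.
Proof.
move=> hr hQ; have B0 : (0 < B)%N by apply: leq_trans NB.
apply: runs_le.
  apply: runs_seq; apply: runs_query => //; apply: runs_seq; apply: runs_putR => //.
  rewrite rval_add !rval_vr //= /upd /= (rep_A hr) (rep_set hr) -/(divers d f S).
  set V1 := putR _ _ _.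
  apply: (@runs_if _ _ _ _ _ _ _ _ _ (100 * B)); rewrite bev_rle !rval_vr //= /upd /= => hb.
    apply: runs_le.
      apply: runs_seq; apply: runs_putR => //; rewrite rval_vr //= /upd /=.
      apply: (@runs_for _ _ _ _ _ (fun i W => [/\ vc W = vc V, vr W 3 = divers d f S,
         forall j, j != 11%N -> vs W j = vs V j &
         forall u : 'I_N, (u < i)%N -> vo W u = vc V u]) _ _ _ N 30) => //.
      - by split => //= j; rewrite /upd => /negbTE ->.
      - move=> i W iN Wi [w1 w2 w3 w4].
        apply: runs_le; first apply: runs_putO.
        + by rewrite nev_sC Wi.
        + rewrite nev_vc ?nev_sC ?Wi //; split => //; split => //=.
            by move=> j j11; rewrite /upd (negbTE j11) w3.
          move=> u ui /=; rewrite /upd w1; case: eqP => [->//|/eqP ui'].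
          by apply: w4; rewrite ltnS leq_eqVlt (negbTE ui') in ui.
        + by [].
      move=> W WN [w1 w2 w3 w4]; apply: hQ => //; left; split => //; split => //.
      by rewrite -(rep_set hr); apply/setP => u; rewrite !inE add0n w4.
    by rewrite /=; lia.
  apply: runs_le; first apply: runs_skip; last by lia.
  by apply: hQ => //; right; rewrite ltNge hb.
by rewrite /=; lia.
Qed.

Lemma runs_count_guesses c V Q : (1 < N)%N -> (c * up_log 2 N <= B)%N ->
  (forall V', vs V' 14 = (N ^ (c * up_log 2 N))%N -> vo V' = vo V -> vr V' = vr V -> Q V') ->
  runs (CountGuesses c) V (1000 * (B * B)) Q.
Proof.
move=> N1 clB hQ; have B0 : (0 < B)%N by apply: leq_trans NB.
set l := up_log 2 N in clB hQ.
have lB : (l <= B)%N.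
  apply: leq_trans NB; apply: up_log_min => //; exact: ltnW (ltn_expl _ _).
apply: runs_le.
  apply: runs_seq; apply: runs_putS; apply: runs_seq; apply: runs_putS.
  apply: (@runs_while _ _ _ _ _ (fun i W => [/\ vs W 13 = (2 ^ i)%N,
    vs W 14 = (N ^ (c * i))%N, vo W = vo V & vr W = vr V]) l _ _ (c * (200 * B) + 100)).
  - by split => //=; rewrite /upd /= !nevE ?muln0 ?expn0.
  - move=> i W il [w1 w2 w3 w4]; split.
      rewrite bev_nle !nevE w1 addn1 ltnNge; apply/negP => h.
      by have := up_log_min (isT : (1 < 2)%N) h; rewrite -/l leqNgt il.
    apply: runs_le.
      apply: runs_seq; apply: runs_putS.
      apply: (@runs_for _ _ _ _ _ (fun j W => [/\ vs W 13 = (2 ^ i.+1)%N,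
        vs W 14 = (N ^ (c * i + j))%N, vo W = vo V & vr W = vr V]) _ _ _ c (150 * B)) => //.
      + by split => //=; rewrite /upd /= ?nevE ?w1 ?w2 ?addn0 // expnS mul2n addnn.
      + move=> j W' jc Wj [y1 y2 y3 y4].
        apply: runs_le.
          apply: runs_seq; apply: runs_putS; apply: runs_seq.
          apply: (@runs_for _ _ _ _ _ (fun q W => [/\ vs W 13 = (2 ^ i.+1)%N,
            vs W 14 = (N ^ (c * i + j))%N, vs W 15 = (q * N ^ (c * i + j))%N,
            vs W 12 = j & vo W = vo V /\ vr W = vr V]) _ _ _ N 40) => //.
          * move=> q W2 qN Wq [z1 z2 z3 z4 z5].
            apply: runs_le; first apply: runs_putS; last by [].
            by rewrite !nevE z2 z3; split => //; split => //=; rewrite /upd /= mulSn addnC.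
          * move=> W2 WN [z1 z2 z3 z4 [z5 z6]].
            apply: runs_putS; rewrite nev_sC z3; split => //=.
            by split => //=; rewrite /upd /= addnS expnS.
        by rewrite /=; lia.
      move=> W' Wc [y1 y2 y3 y4]; split => //.
      by rewrite y2 mulnS addnC.
    by rewrite /=; nia.
  move=> W [w1 w2 w3 w4]; split; last by apply: hQ.
  by rewrite bev_nle !nevE w1 addn1 -leqNgt; exact: up_logP.
rewrite /=.
(* Since [c * l <= B], the nested loops cost order [B * B], not a third power. *)
have : (l * (c * (200 * B) + 150) <= 200 * (B * B) + B * 150)%N.
  rewrite mulnDr; apply: leq_add; last by rewrite leq_mul2r lB orbT.
  have -> : (l * (c * (200 * B)) = 200 * (c * l * B))%N by lia.
  by rewrite leq_mul2l leq_mul2r clB orbT.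
by nia.
Qed.

(** The loop counts down, so after [i] iterations the guesses from [M - i] on have been tried. The
    case [i = 0] is separate in the invariant because the output has size [p] only once a candidate
    was recorded. *)
Lemma runs_main c V Q : (1 < N)%N -> (c * up_log 2 N <= B)%N ->
  (N ^ (c * up_log 2 N) <= B)%N -> vr V 3 = 0 ->
  (forall V', #|stored_set N (vo V') 0| = p ->
    (forall x, (x < N ^ (c * up_log 2 N))%N ->
      divers d f (candidate d f p a x) <= divers d f (stored_set N (vo V') 0)) -> Q V') ->
  runs (Main c a) V (3 * (4000 * (B * (B * (B * B))))) Q.
Proof.
move=> N1 clB MB v3 hQ; have B0 : (0 < B)%N by apply: leq_trans NB.
have [d0 dxx dsym _] := metric_facts dm.
set M := (N ^ (c * up_log 2 N))%N in MB hQ.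
have B12 : (B <= B * B)%N by rewrite leq_pmulr.
have B23 : (B * B <= B * (B * B))%N by rewrite leq_mul2l B12 orbT.
have M0 : (0 < M)%N by rewrite expn_gt0.
have div0 A : 0 <= divers d f A.
  by rewrite /divers disp_dcross // addr_ge0 // divr_ge0 // dcross_ge0.
apply: runs_le.
  apply: runs_seq; apply: (runs_count_guesses N1 clB) => V1 m1 m2 m3.
  apply: runs_seq; apply: runs_putS; rewrite nev_sC m1 -/M.
  apply: (@runs_down _ _ _ _ _ (fun i W => [/\ 0 <= vr W 3,
     forall x, (M - i <= x < M)%N -> divers d f (candidate d f p a x) <= vr W 3,
     i = 0%N -> vr W 3 = 0 &
     (0 < i)%N -> #|stored_set N (vo W) 0| = p /\ vr W 3 = divers d f (stored_set N (vo W) 0)])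
     0 _ M (2 * (4000 * (B * (B * B))))) => //.
  - rewrite /= m3 v3; split => // x; rewrite subn0; lia.
  - move=> i W iM W0 [w1 w2 w0 w3].
    apply: runs_le.
      apply: runs_seq; apply: runs_putS; rewrite !nevE W0.
      set W1 := putS _ _ _; set x := (M - i - 1)%N.
      have x1 : vs W1 1 = x by [].
      have xB : (x <= B)%N by rewrite /x; lia.
      apply: runs_seq; apply: runs_init => W2 r2 l2 k2; have [e2 o2 b2] := k2.
      apply: runs_seq; apply: runs_direct; rewrite ?e2 ?x1 // => W3 r3 x3 k3.
      have [e3 o3 b3] := k3.
      have x3B : (vs W3 1 <= B)%N by rewrite x3; apply: leq_trans (direct_le _ _ _) _;
        apply: leq_trans (leq_div _ _) xB.
      apply: runs_seq; apply: runs_params => // W4 r4 L4 k4 x4 rp4 kp4.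
      have [e4 o4 b4] := kp4.
      rewrite x3 in r4 L4 k4 x4.
      have g4 : greedy_rep W4 (greedy_start R n p x).
        split => //=; first exact: rp4.
        by rewrite e4 // e3 // l2.
      have kB : (vs W4 7 <= B)%N.
        by rewrite k4; apply: leq_trans NB; rewrite ltnW // ltn_pmod.
      have xB4 : (gx (greedy_start R n p x) <= B)%N by rewrite -(greedy_rep_x g4) x4 -x3;
        do 2!apply: leq_trans (leq_div _ _) _; apply: leq_trans (leq_div _ _) x3B.
      have gv : gvalid (greedy_start R n p x) by [].
      apply: runs_seq; apply: (runs_greedy g4 gv) => //.
        exact: card_direct_start.
      rewrite L4 k4 -/(candidate d f p a x) => W5 r5 k5; have [e5 o5 b5] := k5.
      apply: (runs_finish r5) => W6 e6 h6.
      have b5W : vr W5 3 = vr W 3 by rewrite b5 b4 b3 b2.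
      have o5W : vo W5 = vo W by rewrite o5 o4 o3 o2.
      split; first by rewrite e6 // e5 // e4 // e3 // e2.
      have cover y : (M - i.+1 <= y < M)%N -> y = x \/ (M - i <= y < M)%N.
        by rewrite /x; nlia.
      case: h6; rewrite b5W.
        move=> [h1 [h2 h3]]; rewrite /= h3 h2; split => //.
          move=> y /cover[->//|hy]; exact: le_trans (w2 y hy) h1.
        by rewrite card_candidate.
      move=> [h1 [h2 h3]]; rewrite /= h3 h2 o5W; split => //.
        move=> y /cover[->|hy]; [exact: ltW|exact: w2].
      (* The first candidate cannot be rejected: the record is still 0 and no diversity is
         smaller. *)
      move=> _; case: (posnP i) => i0; last exact: w3.
      by move: h1; rewrite w0 // ltNge div0.
    rewrite /=; move: B12 B23 B0; move: (B * (B * B))%N => B3.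
    by move: (B * B)%N => B2; clear; lia.
  move=> W W0 [w1 w2 w0 w3]; have [c1 c2] := w3 M0.
  by apply: hQ => // x xM; rewrite -c2; apply: w2; rewrite subnn.
rewrite /=.
have hM : (M * (2 * (4000 * (B * (B * B))) + 26)
    <= 2 * (4000 * (B * (B * (B * B)))) + B * 26)%N.
  by apply: leq_trans (leq_mul MB (leqnn _)) _; rewrite eq_leq //; lia.
have B34 : (B * (B * B) <= B * (B * (B * B)))%N by rewrite leq_mul2l B23 orbT.
move: hM B12 B23 B34 B0; move: (M * _)%N => MT; move: (B * (B * (B * B)))%N => B4.
by move: (B * (B * B))%N => B3; move: (B * B)%N => B2; clear; lia.
Qed.

End Specs.

(** * Running time and expectation *)

Section Assembly.
Variable R : realType.

Lemma init_state_conc (n : nat) (w : seq bool) :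
  init_state R w = conc n (View (fun=> 0%N) (fun=> 0%N) (fun=> 0%N)
                             (fun=> 0) (fun=> 0) (fun=> 0)) w.
Proof.
rewrite /init_state /conc /=; congr State; apply/funext => x;
  by case: ifP => // _; case: ifP.
Qed.

(** With [B = N ^ (c * up_log 2 N + 1)] the program takes at most [12000 * B ^ 4] steps; as [B >= 2]
    and [2 ^ 14 > 12000], the power [B ^ 18] absorbs the constant. *)
Definition run_time (n c : nat) : nat := (n ^ (18 * (c * up_log 2 n).+1))%N.

Lemma main_outputs (n p c a : nat) (d : 'I_n.+1 -> 'I_n.+1 -> R)
    (f : {set 'I_n.+1} -> R) (w : seq bool) :
  (0 < n)%N -> (p <= n.+1)%N -> is_metric d -> (forall A, 0 <= f A) ->
  exists S : {set 'I_n.+1},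
    [/\ outputs_within p d f (Main c a) w (run_time n.+1 c) S, #|S| = p &
     forall x, (x < n.+1 ^ (c * up_log 2 n.+1))%N ->
       divers d f (candidate d f p a x) <= divers d f S].
Proof.
move=> n0 pN dm f0; set N := n.+1; set K := (c * up_log 2 N)%N.
pose B := (N ^ K.+1)%N.
have N1 : (1 < N)%N by [].
have B2 : (2 <= B)%N.
  by apply: (@leq_trans N) => //; rewrite /B expnS leq_pmulr // expn_gt0.
have NB : (N <= B)%N by rewrite /B expnS leq_pmulr // expn_gt0.
have MB : (N ^ K <= B)%N by rewrite /B leq_pexp2l.
have KB : (K <= B)%N by apply: leq_trans MB; apply: ltnW; exact: ltn_expl.
pose V0 : view R := View (fun=> 0%N) (fun=> 0%N) (fun=> 0%N) (fun=> 0) (fun=> 0) (fun=> 0).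
have [k [V' [h1 h2 [h3 h4]]]] := @runs_main R n p a d f dm f0 pN B NB c V0
  (fun V' => #|stored_set N (vo V') 0| = p /\
    forall x, (x < N ^ K)%N ->
      divers d f (candidate d f p a x) <= divers d f (stored_set N (vo V') 0))
  N1 KB MB erefl (fun V' h h' => conj h h') w.
exists (stored_set N (vo V') 0); split => //.
exists k, (conc N V' w); split.
- by rewrite (init_state_conc N).
- apply: leq_trans h2 _.
  have -> : run_time N c = (B ^ 14 * (B * (B * (B * B))))%N.
    rewrite /run_time -/K /B -expnM -!expnD; congr (N ^ _)%N; lia.
  rewrite mulnA leq_mul2r; apply/orP; right.
  apply: (@leq_trans (2 ^ 2 * 2 ^ 12)); last first.
    by rewrite -expnD leq_exp2r.
  exact: leq_mul.
- apply/setP => i; rewrite !inE /=.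
  by have -> : (0 + i < N)%N by exact: ltn_ord.
Qed.

(** From [2 ^ (up_log 2 n - 1) < n] and [ln 2 >= 1/2] one gets [up_log 2 n - 1 <= 2 ln n], and the
    missing 1 is at most [2 ln n] as well. *)
Lemma up_log_le_ln (n : nat) : (1 < n)%N -> (up_log 2 n)%:R <= 4 * ln n%:R :> R.
Proof.
move=> n1; have n0 : 0 < n%:R :> R by rewrite ltr0n ltnW.
have h2 : 2^-1 <= ln (2 : R).
  have : ln (1 + - 2^-1 : R) <= - 2^-1 by apply: le_ln1Dx; lra.
  have -> : 1 + - 2^-1 = 2^-1 :> R by lra.
  by rewrite lnV ?posrE //; lra.
have l2 : ln (2 : R) <= ln n%:R by rewrite ler_ln ?posrE // (ler_nat R 2).
have [lb _] := andP (up_log_bounds (isT : (1 < 2)%N) n1).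
have l0 : (0 < up_log 2 n)%N by rewrite up_log_gt0.
set l := up_log 2 n in lb l0 *.
have : ln (2 ^+ l.-1 : R) <= ln n%:R.
  by rewrite ler_ln ?posrE ?exprn_gt0 // -natrX ler_nat ltnW.
rewrite lnXn // -[_ *+ l.-1]mulr_natr.
have -> : l%:R = l.-1%:R + 1 :> R by rewrite natr1 prednK.
have : 2^-1 * l.-1%:R <= ln (2 : R) * l.-1%:R by rewrite ler_wpM2r.
lra.
Qed.

Lemma expect_coins_ge (T : nat) (X : T.-tuple bool -> R) (b : R) :
  (forall w, b <= X w) -> b <= expect_coins X.
Proof.
move=> h; rewrite /expect_coins ler_pdivlMr ?exprn_gt0 //.
apply: (@le_trans _ _ (\sum_(w : T.-tuple bool) b)); last exact: ler_sum.
by rewrite sumr_const card_tuple card_bool -[b *+ _]mulr_natr natrX.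
Qed.

Lemma opt_divers_le (n p : nat) (d : 'I_n -> 'I_n -> R) (f : {set 'I_n} -> R) (r v : R) :
  0 <= v -> (forall O : {set 'I_n}, #|O| = p -> r * divers d f O <= v) ->
  r * opt_divers d f p <= v.
Proof.
move=> v0 h; have opt0 : 0 <= opt_divers d f p by exact: bigmax_ge_id.
have [r0|r0] := leP r 0; first by apply: le_trans v0; rewrite mulr_le0_ge0.
rewrite mulrC -ler_pdivlMr //; apply: bigmax_le; first by rewrite divr_ge0 // ltW.
by move=> O /eqP cO; rewrite ler_pdivlMr // mulrC h.
Qed.

Definition digits_const : R := 4 + 400 * (17 * (400 * 400)).

Lemma digits_factor_le (H : nat) : (0 < H)%N ->
  (digits_factor H)%:R <= digits_const * H%:R ^+ 4.
Proof.
move=> H0; set h : R := H%:R.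
have -> : (digits_factor H)%:R = 4 + 400 * h * (h - 1) * (16 * (400 * h) ^+ 2 + 1).
  rewrite /digits_factor natrD 3!natrM natrB // -[(16 * _).+1%:R]natr1 natrM.
  by rewrite [((400 * H) ^ 2)%:R]natrX natrM.
have h1 : 1 <= h by rewrite ler1n.
rewrite /digits_const; set g : R := 400.
have g1 : 1 <= g by rewrite /g (ler_nat R 1).
have gh : 1 <= (g * h) ^+ 2 by rewrite exprn_ege1 // mulr_ege1.
have h4 : 1 <= h ^+ 4 by rewrite exprn_ege1.
have ghh : 0 <= g * h by apply: mulr_ge0; lra.
have e1 : g * h * (h - 1) * (16 * (g * h) ^+ 2 + 1) <= g * h * h * (17 * (g * h) ^+ 2).
  apply: ler_pM; first by apply: mulr_ge0 => //; lra.
  - lra.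
  - by apply: ler_wpM2l => //; lra.
  - lra.
have e2 : g * h * h * (17 * (g * h) ^+ 2) = g * (17 * (g * g)) * h ^+ 4 by ring.
lra.
Qed.

(** 72 is the exponent 18 times the 4 of [up_log_le_ln]; the summand 18 comes from the [+ 1] in the
    exponent and is absorbed by the maximum with 1. *)
Lemma run_time_le (C eps : R) (N c : nat) : (1 < N)%N ->
  0 < eps -> 0 <= C -> c%:R <= C / eps ^+ 4 ->
  (run_time N c)%:R <= N%:R `^ ((72 * C + 18) * Num.max 1 (ln N%:R / eps ^+ 4)).
Proof.
move=> N1 e0 C0 hc; have N0 : 0 <= N%:R :> R by [].
rewrite /run_time natrX -[N%:R ^+ _]powR_mulrn // ler_powR //; first by rewrite ler1n ltnW.
set x := ln N%:R / eps ^+ 4.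
have e4 : 0 < eps ^+ 4 by rewrite exprn_gt0.
have l0 : 0 <= ln N%:R :> R by rewrite ln_ge0 // ler1n ltnW.
have hl := up_log_le_ln N1.
have h1 : (c * up_log 2 N)%:R <= 4 * C * x.
  rewrite natrM; apply: le_trans (ler_pM _ _ hc hl) _ => //.
  by rewrite le_eqVlt; apply/orP; left; apply/eqP; rewrite /x; field; rewrite gt_eqF.
have m1 : 1 <= Num.max 1 x by rewrite le_max lexx.
have m2 : x <= Num.max 1 x by rewrite le_max lexx orbT.
set m := Num.max 1 x in m1 m2 *.
have h2 : C * x <= C * m by rewrite ler_wpM2l.
rewrite natrM -natr1; lra.
Qed.

End Assembly.

Theorem theorem4 (R : realType) :
  exists C : R, 0 < C /\
  forall eps : R, 0 < eps ->
  exists P : com,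
  forall (n p : nat) (d : 'I_n -> 'I_n -> R) (f : {set 'I_n} -> R),
    (2 <= p <= n)%N ->
    is_metric d ->
    (forall A : {set 'I_n}, 0 <= f A) ->
    set_monotone f ->
    submodular f ->
    exists (T : nat) (out : T.-tuple bool -> {set 'I_n}),
      [/\ T%:R <= n%:R `^ (C * Num.max 1 (ln n%:R / eps ^+ 4)),
          forall w : T.-tuple bool, outputs_within p d f P w T (out w),
          forall w : T.-tuple bool, #|out w| = p
        & (1 - (expR 1)^-1 - eps) * opt_divers d f p
            <= expect_coins (fun w => divers d f (out w))].
Proof.
(* [H <= 41 / eps] turns the [H ^+ 4] of [digits_factor_le] into [41 ^+ 4 / eps ^+ 4]. *)
pose A : R := digits_const R * 41 ^+ 4.
have A0 : 0 <= A.
  by rewrite /A /digits_const; apply: mulr_ge0; [apply: addr_ge0; rewrite ?mulr_ge0 ?ler0n|rewrite exprn_ge0 ?ler0n].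
exists (72 * A + 18); split.
  by apply: ltr_wpDl; [rewrite mulr_ge0 ?ler0n|rewrite ltr0n].
move=> eps eps0.
have [H [c [cH hc]]] : exists H c : nat,
    (1 <= eps \/ [/\ (40 <= H)%N, 4 / H%:R <= eps & c = digits_factor H])
    /\ c%:R <= A / eps ^+ 4.
  (* For [eps >= 1] the guarantee is a nonpositive multiple of the optimum, so a single guess
     suffices. Otherwise [H] exceeds [40 / eps], which gives both [40 <= H] and [4 / H <= eps]. *)
  have [e1|e1] := leP 1 eps.
    exists 0%N, 0%N; split; first by left.
    by rewrite divr_ge0 // exprn_ge0 // ltW.
  pose H := (Num.truncn (40 / eps)).+1.
  have q0 : 0 <= 40 / eps by rewrite divr_ge0 ?ler0n // ltW.
  have /andP[t1 t2] := truncn_itv q0; rewrite -/H in t2.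
  have h40 : 40 < H%:R :> R.
    apply: lt_trans t2; rewrite ltr_pdivlMr // gtr_pMr ?ltr0n //.
  exists H, (digits_factor H); split.
    right; split => //; first by rewrite -(ler_nat R) ltW.
    rewrite ler_pdivrMr; last by apply: lt_trans h40; rewrite ltr0n.
    have := ltW t2; rewrite ler_pdivrMr // => h; rewrite mulrC; apply: le_trans h.
    by rewrite ler_nat.
  have hH : H%:R <= 41 / eps.
    rewrite /H -natr1; apply: le_trans (lerD t1 (lexx _)) _.
    have : 1 <= eps^-1 by rewrite invf_ge1 // ltW.
    lra.
  apply: le_trans (digits_factor_le R (ltn0Sn _)) _.
  rewrite /A -mulrA ler_wpM2l //.
    by rewrite /digits_const addr_ge0 ?mulr_ge0 ?ler0n.
  by rewrite -expr_div_n ler_pXn2r ?nnegrE ?divr_ge0 ?ler0n // ltW.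
exists (Main c (100 * H)) => n p d f pn dm f0 fm fs.
case: n d f pn dm f0 fm fs => [|n] d f /andP[p2 pn] dm f0 fm fs.
  by move: (leq_trans p2 pn).
have n0 : (0 < n)%N by move: (leq_trans p2 pn).
(* The bound holds for each tape separately; choice merely collects the outputs into a function of
   the tape. *)
have [out hout] := choice (fun w : (run_time n.+1 c).-tuple bool =>
  main_outputs c (100 * H) w n0 pn dm f0).
exists (run_time n.+1 c), out; split.
- exact: run_time_le.
- by move=> w; have [] := hout w.
- by move=> w; have [] := hout w.
apply: expect_coins_ge => w; have [_ cS hS] := hout w.
have [d0 dxx dsym _] := metric_facts dm.
have div0 (S : {set 'I_n.+1}) : 0 <= divers d f S.
  by rewrite /divers disp_dcross // addr_ge0 // divr_ge0 // dcross_ge0.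
apply: opt_divers_le => // O cO.
case: cH => [e1|[H40 He cE]].
  apply: le_trans (div0 _); apply: mulr_le0_ge0 => //.
  have : 0 <= (expR 1 : R)^-1 by rewrite invr_ge0 expR_ge0.
  lra.
have pn' : (2 <= p <= n.+1)%N by rewrite p2.
have l0 : (0 < up_log 2 n.+1)%N by rewrite up_log_gt0.
have [x xb hx] := guess_exists dm f0 fm fs H40 He pn' cO
  (up_logP n.+1 (isT : (1 < 2)%N)) l0.
by apply: le_trans hx (hS x _); rewrite cE.
Qed.
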